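(* Let $1<q\le p<\infty$, let $r=pq/(p-q)$ if $q<p$ and $r=\infty$ if $p=q$, and assume (N1)–(N2). For every $u,v\in L^p(\Omega;\mathbb R^d)$ there exists $A\in\Theta[u,v]$ with $\mathfrak H[u]-\mathfrak H[v]=A(u-v)$ in $L^q(\Omega;\mathbb R^n)$, where $$\Theta[u,v]=\big\{A\in L^r(\Omega;\mathbb R^{n\times d}): A(x)\in\operatorname{co}\big(\partial^CH(x,[u(x),v(x)])\big)\text{ for a.e. }x\in\Omega\big\}.$$ Furthermore, if $A\in\Theta[u,v]$ satisfies $\mathfrak H[u]-\mathfrak H[v]=A(u-v)$, then there exist measurable functions $\lambda_1,\dots,\lambda_{nd+1}\colon\Omega\to[0,1]$ and measurable $A_1,\dots,A_{nd+1}\colon\Omega\to\mathbb R^{n\times d}$ with $A_i(x)\in\partial^CH(x,[u(x),v(x)])$ for a.e. $x$, such that $\sum_{i=1}^{nd+1}\lambda_i=1$ and $A=\sum_{i=1}^{nd+1}\lambda_iA_i$ a.e. in $\Omega$.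
   Context: Let $(\Omega,\mathcal F,\mu)$ be a complete finite measure space and $H\colon\Omega\times\mathbb R^d\to\mathbb R^n$. $\partial^CH(x,z)$ is the Clarke generalized Jacobian of $H(x,\cdot)$ at $z$ (convex hull of limits of Jacobians of $H(x,\cdot)$ at differentiability points converging to $z$); $\partial^CH(x,[a,b])=\bigcup_{z\in[a,b]}\partial^CH(x,z)$; $\operatorname{co}$ denotes convex hull. (N1): $H$ is $\mathcal F\otimes\mathcal B(\mathbb R^d)$-measurable and locally Lipschitz in $z$ for every $x$. (N2): there exist $C_H>0$, $1<q\le p<\infty$ with $|H(x,z)|\le C_H(1+|z|^{p/q})$ and $|M|\le C_H(1+|z|^{p/q-1})$ for all $M\in\partial^CH(x,z)$. $\mathfrak H\colon L^p(\Omega;\mathbb R^d)\to L^q(\Omega;\mathbb R^n)$, $\mathfrak H[u](x)=H(x,u(x))$; matrices act pointwise: $(Aw)(x)=A(x)w(x)$. *)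

(* Defs.v *)
From HB Require Import structures.
From mathcomp Require Import all_boot all_order all_algebra.
From mathcomp Require Import all_classical all_reals all_analysis.
Set Implicit Arguments. Unset Strict Implicit. Unset Printing Implicit Defensive.
Import Order.TTheory GRing.Theory Num.Theory.
Import numFieldNormedType.Exports.
Local Open Scope classical_set_scope.
Local Open Scope ring_scope.

(* R^k is represented by column vectors 'cV[R]_k (normed space, norm = max norm).
   Borel sets of R^k are transported from the product sigma-algebra on
   k.-tuple R (= Borel sigma-algebra of R^k). *)
Definition tuple2cV {R : realType} (k : nat) (t : k.-tuple R) : 'cV[R]_k :=
  \col_(i < k) tnth t i.

Definition mx_measurable {R : realType} (d0 : measure_display)
  (T : measurableType d0) (m k : nat) (f : T -> 'M[R]_(m, k)) : Prop :=
  forall (i : 'I_m) (j : 'I_k), measurable_fun [set: T] (fun x => f x i j).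

Definition inLp {R : realType} (d0 : measure_display) (T : measurableType d0)
  (mu : {measure set T -> \bar R}) (s : R) (m k : nat) (f : T -> 'M[R]_(m, k)) : Prop :=
  mx_measurable f /\ (\int[mu]_x ((`|f x| `^ s)%:E) < +oo)%E.

Definition inLinf {R : realType} (d0 : measure_display) (T : measurableType d0)
  (mu : {measure set T -> \bar R}) (m k : nat) (f : T -> 'M[R]_(m, k)) : Prop :=
  mx_measurable f /\ exists M : R, {ae mu, forall x, `|f x| <= M}.

Definition conv_hull {R : realType} (V : lmodType R) (S : set V) : set V :=
  [set y | exists (m : nat) (l : 'I_m -> R) (a : 'I_m -> V),
     (forall i, 0 <= l i) /\ \sum_(i < m) l i = 1 /\
     (forall i, S (a i)) /\ y = \sum_(i < m) l i *: a i].

Definition is_jacobian {R : realType} (d n : nat) (f : 'cV[R]_d -> 'cV[R]_n)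
  (z : 'cV[R]_d) (M : 'M[R]_(n, d)) : Prop :=
  differentiable f z /\ forall w : 'cV[R]_d, ('d f z) w = M *m w.

Definition limiting_jacobians {R : realType} (d n : nat) (f : 'cV[R]_d -> 'cV[R]_n)
  (z : 'cV[R]_d) : set 'M[R]_(n, d) :=
  [set M | exists (zk : nat -> 'cV[R]_d) (Mk : nat -> 'M[R]_(n, d)),
     zk @ \oo --> z /\ (forall k, is_jacobian f (zk k) (Mk k)) /\ Mk @ \oo --> M].

Definition clarke_jacobian {R : realType} (d n : nat) (f : 'cV[R]_d -> 'cV[R]_n)
  (z : 'cV[R]_d) : set 'M[R]_(n, d) :=
  conv_hull (limiting_jacobians f z).

Definition clarke_segment {R : realType} (d n : nat) (f : 'cV[R]_d -> 'cV[R]_n)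
  (a b : 'cV[R]_d) : set 'M[R]_(n, d) :=
  [set M | exists t : R, 0 <= t <= 1 /\ clarke_jacobian f (a + t *: (b - a)) M].

Definition N1 {R : realType} (d0 : measure_display) (T : measurableType d0)
  (d n : nat) (H : T -> 'cV[R]_d -> 'cV[R]_n) : Prop :=
  (forall i : 'I_n,
     measurable_fun [set: T * d.-tuple R] (fun xz => H xz.1 (tuple2cV xz.2) i 0)) /\
  (forall (x : T) (z : 'cV[R]_d), exists r : R, exists L : R, 0 < r /\
     forall a b : 'cV[R]_d, `|a - z| < r -> `|b - z| < r ->
       `|H x a - H x b| <= L * `|a - b|).

Definition N2 {R : realType} (T : Type) (d n : nat)
  (H : T -> 'cV[R]_d -> 'cV[R]_n) (p q : R) : Prop :=
  exists CH : R, 0 < CH /\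
    forall (x : T) (z : 'cV[R]_d),
      `|H x z| <= CH * (1 + `|z| `^ (p / q)) /\
      forall M, clarke_jacobian (H x) z M -> `|M| <= CH * (1 + `|z| `^ (p / q - 1)).

Definition Theta {R : realType} (d0 : measure_display) (T : measurableType d0)
  (mu : {measure set T -> \bar R}) (d n : nat) (H : T -> 'cV[R]_d -> 'cV[R]_n)
  (p q : R) (u v : T -> 'cV[R]_d) : set (T -> 'M[R]_(n, d)) :=
  [set A | (if q < p then inLp mu (p * q / (p - q)) A else inLinf mu A) /\
     {ae mu, forall x, conv_hull (clarke_segment (H x) (u x) (v x)) (A x)}].

(* Main.v *)
Require Import Defs.
From HB Require Import structures.
From mathcomp Require Import all_boot all_order all_algebra.
From mathcomp Require Import all_classical all_reals all_analysis.
From mathcomp Require Import measurable_realfun lra ring.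

Set Implicit Arguments. Unset Strict Implicit. Unset Printing Implicit Defensive.
Import Order.TTheory GRing.Theory Num.Theory.
Import numFieldNormedType.Exports.
Local Open Scope classical_set_scope.
Local Open Scope ring_scope.

(** The heart of the matter is a description of the Clarke Jacobian that is countable, hence
    measurable in the parameter, without any measurable projection theorem.  For a locally
    Lipschitz function, Rademacher's theorem shows that the average of the Jacobian over a small
    cube is a matrix [Qmx] given by integrals of increments of the function; these matrices
    depend continuously on the cube and measurably on the parameter.  They converge to the
    Jacobian at every point of differentiability and, by separation, they lie near the convex
    hull of the nearby Jacobians.  So the limits of [Qmx] at cubes shrinking to [z] form a set
    lying between the limiting Jacobians and the Clarke Jacobian, and membership in it is a
    countable condition.  Averaging along a segment gives the mean value inclusion in the same
    way.  By Caratheodory's theorem, a matrix of the convex hull is encoded by finitely many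
    real unknowns subject to constraints that are measurable in [x] and continuous in the
    unknowns, and a measurable solution is obtained by successive minimization of the
    coordinates.

    Rademacher's theorem follows Nekvinda and Zajicek: a point of non-differentiability is, for
    some coordinate direction, a point of a measurable set that is not a density point of the
    section of this set along that direction.  Null sets are handled by averages along
    segments, which commute by Fubini's theorem, so that no measure on [R^d] is needed. *)


(** The obstacle is that [T] carries only a sigma-algebra, while Clarke Jacobians involve an
    uncountable choice of differentiability points. [Qmx] removes the choice: the average of a
    partial derivative along its own direction is an increment divided by [h], so only averages of
    values of [H] over the opposite face remain, and these can be tested at rational points. The set
    of limits of [Qmx] need not be the Clarke Jacobian, but the sandwich suffices: hulls are
    idempotent, so every matrix to be decomposed is a combination of limiting Jacobians, and the
    selected matrices only have to lie in Clarke Jacobians. Solvability within a box amounts to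
    approximate solvability by rational unknowns, a countable condition; the bound on the Jacobians
    confines all solutions at a given [x] to a box, so minima are attained. A segment may consist of
    points of non-differentiability only. The mean value inclusion therefore averages over the
    translates of the segment by a small cube. Here negligible means that averages vanish at every
    base point, not at almost every one, so that further averages may be taken. *)

(** * Lipschitz functions of one real variable *)

(** Both measures are infima over the same countable covers by half-open intervals, so the bound on
    increments passes from intervals to covers and from covers to any set. *)
Lemma lebesgue_stieltjes_measure_le (R : realType) (f : cumulative R R) (L : R)
    (A : set (measurableTypeR R)) :
  0 <= L -> (forall s t, s <= t -> f t - f s <= L * (t - s)) ->
  (lebesgue_stieltjes_measure f A <= L%:E * lebesgue_measure A)%E.
Proof.
move=> L0 fL.
have key (X : set (ocitv_type R)) : measurable X ->
    (wlength f X <= L%:E * wlength (@idfun R) X)%E.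
  move=> /ocitvP[->|[x xlt ->]]; first by rewrite !wlength0 mule0.
  by rewrite !wlength_itv_bnd ?(ltW xlt)// -EFinM lee_fin fL// ltW.
have ge0 (g : R -> R) (X : set (ocitv_type R)) : {homo g : x y / x <= y} ->
    measurable X -> (0 <= wlength g X)%E.
  move=> ndg /ocitvP[->|[x xlt ->]]; first by rewrite !wlength0.
  by rewrite wlength_itv_bnd ?(ltW xlt)// lee_fin subr_ge0 ndg// ltW.
have fnd := cumulative_is_nondecreasing f.
have [B0 B0T] : measurable_cover (A : set (ocitv_type R)) !=set0.
  case: (wlength_sigma_finite (@idfun R)) => F FT mF; exists F; split.
    by move=> i; case: (mF i).
  by rewrite -FT.
have mufA B : measurable_cover (A : set (ocitv_type R)) B ->
    (lebesgue_stieltjes_measure f A <= \sum_(0 <= k <oo) wlength f (B k))%E.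
  by move=> BA; apply: ge_ereal_inf; exists (\sum_(0 <= k <oo) wlength f (B k))%E => //; exists B.
(* [L = 0] is treated apart, since the other case divides by [L] to compare the infima. *)
move: L0; rewrite le_eqVlt => /predU1P[L0|L0].
  rewrite -L0 mul0e; apply: (le_trans (mufA _ B0T)).
  rewrite eseries0// => i _ _; apply/eqP; rewrite eq_le ge0 ?andbT//.
    by have := key _ (B0T.1 i); rewrite -L0 mul0e.
  exact: (B0T.1 i).
rewrite -lee_pdivrMl//; apply: le_ereal_inf_tmp => _ [B BA <-].
rewrite lee_pdivrMl// -nneseriesZl; last by move=> i _; apply: ge0 => //; exact: (BA.1 i).
apply: (le_trans (mufA _ BA)).
by apply: lee_nneseries => [i _ _|i _]; [apply: ge0 => //|apply: key]; exact: (BA.1 i).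
Qed.

Lemma lebesgue_stieltjes_measure_itvoc (R : realType) (f : cumulative R R) (a b : R) :
  a <= b -> lebesgue_stieltjes_measure f `]a, b]%classic = (f b - f a)%:E.
Proof.
move=> ab; rewrite /lebesgue_stieltjes_measure /measure_extension /=.
by rewrite measurable_mu_extE /= ?wlength_itv_bnd//; exact: is_ocitv.
Qed.

Lemma lipschitz_continuous (R : realType) (g : R -> R) (L : R) :
  (forall s t, `|g s - g t| <= L * `|s - t|) -> continuous g.
Proof.
move=> gL x; apply/cvgrPdist_le => e e0; near=> t.
apply: (le_trans (gL _ _)); apply: (@le_trans _ _ ((`|L| + 1) * `|x - t|)).
  by rewrite ler_wpM2r//; apply: (le_trans (ler_norm _)); rewrite lerDl.
rewrite mulrC -ler_pdivlMr ?ltr_wpDl//; near: t.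
by apply: cvgr_dist_le; [exact: cvg_id|rewrite divr_gt0// ltr_wpDl].
Unshelve. all: by end_near. Qed.

(** Adding [L * t] makes [g] nondecreasing. The resulting Stieltjes measure is absolutely
    continuous, and its Radon-Nikodym density minus [L] is the derivative. The window []-1, 2]]
    exceeds [[0, 1]] so that 0 and 1 have two-sided neighbourhoods. *)
Lemma lipschitz_ae_is_derive (R : realType) (g : R -> R) (L : R) :
  (forall s t, `|g s - g t| <= L * `|s - t|) ->
  exists rho : R -> R,
    [/\ measurable_fun [set: R] rho,
        lebesgue_measure.-integrable `]-1, 2] (EFin \o rho),
        {ae lebesgue_measure, forall t : R, -1 < t < 2 -> is_derive t 1 g (rho t)} &
        g 1 - g 0 = \int[lebesgue_measure]_(t in `[0, 1]) rho t].
Proof.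
move=> gL.
have cg := lipschitz_continuous gL.
pose g1 t := g t + L * t.
have nd : nondecreasing g1.
  move=> s t st; rewrite /g1 -subr_ge0.
  have := gL s t; rewrite ler_norml distrC (ger0_norm (_ : 0 <= t - s)) ?subr_ge0//.
  by move=> /andP[_]; lra.
have cg1 : continuous g1.
  by move=> x; apply: cvgD; [exact: cg|apply: cvgM; [exact: cvg_cst|exact: cvg_id]].
have rc : forall x, g1 y @[y --> x^'+] --> g1 x.
  exact: right_continuousW.
pose gc : cumulative R R := HB.pack g1 (isCumulative.Build R _ R g1 nd rc).
have L0 : 0 <= L by have := gL 1 0; rewrite subr0 normr1 mulr1; exact: le_trans.
pose D : set (measurableTypeR R) := `]-1, 2]%classic.
have mD : measurable D by exact: measurable_itv.
have leD : (-1 : R) <= 2 by lra.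
have finD : (lebesgue_stieltjes_measure gc D < +oo)%E.
  by rewrite /D lebesgue_stieltjes_measure_itvoc// ltry.
pose nu : {finite_measure set (measurableTypeR R) -> \bar R} := mfrestr mD finD.
have nudom : nu `<< (@lebesgue_measure R).
  apply/null_content_dominatesP => S mS S0; apply/eqP.
  rewrite eq_le measure_ge0 andbT /= /mfrestr /mrestr.
  have {S0} : lebesgue_measure (S `&` D) = 0.
    by apply: (subset_measure0 _ mS _ S0) => //; exact: measurableI.
  (* One [L] bounds the slope of [g], the other is the slope that was added. *)
  move=> SD0; have := @lebesgue_stieltjes_measure_le _ gc (L + L) (S `&` D).
  rewrite SD0 mule0; apply; first by rewrite addr_ge0.
  move=> s t st; rewrite /= /g1; have := gL t s.
  by rewrite (ger0_norm (_ : 0 <= t - s)) ?subr_ge0// ler_norml => /andP[_]; lra.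
have [f [f0 ffin fint nuE]] := radon_nikodym_sigma_finite nudom.
pose r : R -> R := fun t => fine (f t).
have rE : f = EFin \o r by apply/funext => t; rewrite /= fineK.
have FE y : -1 <= y <= 2 -> \int[lebesgue_measure]_(t in `]-1, y]) r t = g1 y - g1 (-1).
  move=> /andP[y0 y2]; rewrite /Rintegral.
  rewrite -[(\int[_]_(_ in _) _)%E]/((\int[lebesgue_measure]_(t in `](-1 : R)%R, y]) (EFin \o r) t)%E).
  rewrite -rE -nuE /= ?/mfrestr ?/mrestr; last exact: measurable_itv.
  rewrite (_ : _ `&` _ = `]-1, y]%classic).
    by rewrite lebesgue_stieltjes_measure_itvoc.
  apply/seteqP; split => t /=; rewrite /D /= !in_itv/=; first by case.
  by move=> /andP[-> ty]; rewrite ty; split => //; rewrite (le_trans ty).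
have rint (A : set R) : measurable A -> lebesgue_measure.-integrable A (EFin \o r).
  by move=> mA; rewrite -rE; apply: integrableS fint.
have mr : measurable_fun [set: R] r.
  by apply/measurable_EFinP; rewrite -rE; case/integrableP : fint.
exists (fun t => r t - L); split.
- by apply: measurable_funB => //; exact: measurable_cst.
- rewrite (_ : _ \o _ = ((EFin \o r) \- (EFin \o cst L))%E)//.
  apply: integrableB => //; first exact: rint.
  apply: measurable_bounded_integrable => //.
  + have : (lebesgue_measure (`](-1)%R, 2%R]%classic : set R) < +oo)%E.
      by rewrite lebesgue_measure_itv/=; case: ifP => // _; rewrite -EFinD ltry.
    exact.
  + exact: bounded_cst.
- have := @FTC1 R r (BRight (-1)) (fun y => rint _ (measurable_itv _)).
  have lr : locally_integrable setT r.
    by apply: open_integrable_locally; [exact: openT|exact: rint].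
  move=> /(_ lr); apply: filterS.
    exact: (ae_filter_ringOfSetsType (@lebesgue_measure R)).
  move=> t + /andP[t1 t2].
  move=> H; have {H}[dF FE'] := H t1.
  (* [F] is the indefinite integral of the density, differentiated by [FTC1]; by [FE] it agrees with
     [g1] up to a constant on the window. *)
  have [F [Fg iF]] : exists F : R -> R,
      (forall y, -1 <= y <= 2 -> F y = g1 y - g1 (-1)) /\ is_derive t 1 F (r t).
    by eexists; split; [exact: FE|apply: DeriveDef; [exact: dF|rewrite -derive1E; exact: FE']].
  have : is_derive t 1 (fun y => F y + g1 (-1) - L * y) (r t - L).
    apply: is_deriveB.
    + by rewrite -[r t]addr0; apply: is_deriveD.
    + by rewrite -[L in is_derive _ _ _ L]mulr1; apply: is_deriveZ.
  apply: near_eq_is_derive.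
  near=> y; rewrite Fg; first by rewrite /g1; ring.
  apply/andP; split; apply: ltW; near: y; [exact: lt_nbhsr|exact: lt_nbhsl].
- have E1 : \int[lebesgue_measure]_(t in `]-1, 1]) r t = g1 1 - g1 (-1).
    by apply: FE; lra.
  have E0 : \int[lebesgue_measure]_(t in `]-1, 0]) r t = g1 0 - g1 (-1).
    by apply: FE; lra.
  have mu1 : (lebesgue_measure (`[0%R, 1%R]%classic : set R) < +oo)%E.
    by rewrite lebesgue_measure_itv/= lte01 -EFinD ltry.
  rewrite RintegralB//; [|exact: rint|]; last first.
    by apply: measurable_bounded_integrable => //; exact: bounded_cst.
  rewrite Rintegral_cst//= lebesgue_measure_itv/= lte01 -EFinD/= subr0 mulr1.
  rewrite -Rintegral_itv_obnd_cbnd; last by exact: rint.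
  have := @Rintegral_itvB R r (BRight (-1)) (BRight 1) 0 (rint _ (measurable_itv _)).
  rewrite !bnd_simp E0 E1 => <-; rewrite /g1; [ring|lra|lra].
Unshelve. all: by end_near. Qed.

(** * Averages along segments *)

Lemma measurable_itv01 (R : realType) : measurable (`[0, 1]%classic : set (measurableTypeR R)).
Proof. exact: measurable_itv. Qed.

Lemma lebesgue_itv01 (R : realType) :
  @lebesgue_measure R (`[0%R, 1%R]%classic : set (measurableTypeR R)) = 1%E.
Proof. by rewrite lebesgue_measure_itv/= lte01 oppr0 adde0. Qed.

Lemma lebesgue_itv01_lty (R : realType) :
  (@lebesgue_measure R (`[0%R, 1%R]%classic : set (measurableTypeR R)) < +oo)%E.
Proof. by rewrite lebesgue_itv01 ltry. Qed.

(** A finite measure on the whole line rather than an integration domain: Fubini's theorem then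
    applies without restricting to subsets. *)
Definition leb01 (R : realType) : set (measurableTypeR R) -> \bar R :=
  mfrestr (@measurable_itv01 R) (@lebesgue_itv01_lty R).

HB.instance Definition _ (R : realType) := Measure.on (@leb01 R).
HB.instance Definition _ (R : realType) :=
  Measure_isFinite.Build _ _ _ (@leb01 R)
    (@fin_num_measure _ _ _ (mfrestr (@measurable_itv01 R) (@lebesgue_itv01_lty R))).

Definition clamp01 (R : realType) (t : R) : R := Num.max 0 (Num.min t 1).

Lemma clamp01_itv (R : realType) (t : R) : 0 <= clamp01 t <= 1.
Proof. by rewrite /clamp01 le_max lexx/= ge_max ler01/= ge_min lexx orbT. Qed.

Lemma clamp01_id (R : realType) (t : R) : 0 <= t <= 1 -> clamp01 t = t.
Proof. by move=> /andP[t0 t1]; rewrite /clamp01 min_l// max_r. Qed.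

Lemma measurable_clamp01 (R : realType) : measurable_fun [set: R] (@clamp01 R).
Proof.
apply: measurable_maxr; first exact: measurable_cst.
by apply: measurable_minr => //; exact: measurable_cst.
Qed.

Lemma leb01E (R : realType) A :
  @leb01 R A = lebesgue_measure (A `&` `[0, 1]%classic).
Proof. by []. Qed.

Lemma leb01_setT (R : realType) : @leb01 R setT = 1%E.
Proof. by rewrite leb01E setTI lebesgue_itv01. Qed.

Lemma integrable_leb01 (R : realType) (f : R -> R) (M : R) :
  measurable_fun [set: R] f -> (forall t, `|f t| <= M) ->
  (@leb01 R).-integrable setT (EFin \o f).
Proof.
move=> mf fM; apply: measurable_bounded_integrable => //.
  by rewrite /= leb01_setT ltry.
exists M; split; first exact: num_real.
by move=> N MN t _ /=; exact: le_trans (fM t) (ltW MN).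
Qed.

Lemma Rintegral_leb01 (R : realType) (f : R -> R) (M : R) :
  measurable_fun [set: R] f -> (forall t, 0 <= t <= 1 -> `|f t| <= M) ->
  \int[@leb01 R]_t f (clamp01 t) = \int[lebesgue_measure]_(t in `[0, 1]) f t.
Proof.
move=> mf fM; rewrite /Rintegral; congr fine.
have mfc : measurable_fun [set: R] (f \o @clamp01 R).
  by apply: measurableT_comp => //; exact: measurable_clamp01.
rewrite (@negligible_integral _ _ _ (@leb01 R) setT (~` `[0%R, 1%R]%classic))//.
- rewrite setTD setCK; under eq_integral.
    by move=> t; rewrite inE/= in_itv/= => t01; rewrite clamp01_id//; over.
  apply: eq_measure_integral => A mA A01.
  by rewrite [LHS]leb01E setIidl.
- by apply: measurableC; exact: measurable_itv.
- by apply: (@integrable_leb01 _ _ M) => // t; exact/fM/clamp01_itv.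
- by rewrite [LHS]leb01E setICl measure0.
Qed.

Lemma Rintegral_leb01_cst (R : realType) (c : R) : \int[@leb01 R]_t c = c.
Proof. by rewrite (Rintegral_cst _ (@measurableT _ (measurableTypeR R))) /= leb01_setT mulr1. Qed.

Section average.
Context {R : realType} {d0 : measure_display} {T : measurableType d0} {d : nat}.
Implicit Types (F G : T -> 'cV[R]_d -> R) (w : 'cV[R]_d).

Definition jmeas F := measurable_fun [set: T * d.-tuple R]
  (fun s => F s.1 (tuple2cV s.2)).

Definition lbounded F := forall x r, exists M, forall y, `|y| <= r -> `|F x y| <= M.

Lemma jmeas_comp d' (S : measurableType d') F (a : S -> T) (b : S -> 'cV[R]_d) :
  jmeas F -> measurable_fun setT a ->
  (forall i, measurable_fun [set: S] (fun s => b s i 0)) ->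
  measurable_fun [set: S] (fun s => F (a s) (b s)).
Proof.
move=> mF ma mb.
pose b' s : d.-tuple R := [tuple b s i 0 | i < d].
have bE s : b s = tuple2cV (b' s).
  by apply/matrixP => i j; rewrite mxE tnth_mktuple ord1.
under eq_fun do rewrite bE.
apply: (@measurableT_comp _ _ _ _ _ _ (fun s => F s.1 (tuple2cV s.2)) _
  (fun s => (a s, b' s)) mF).
apply: measurable_fun_pair => //; apply/measurable_fun_tnthP => i.
by rewrite (_ : _ \o _ = fun s => b s i 0)//; apply/funext => s /=; rewrite tnth_mktuple.
Qed.

Lemma measurable_tuple2cV i :
  measurable_fun [set: T * d.-tuple R] (fun s => tuple2cV s.2 i 0).
Proof.
under eq_fun do rewrite mxE.
apply: (measurableT_comp (measurable_tnth i)); exact: measurable_snd.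
Qed.

Lemma jmeas_shift F w : jmeas F -> jmeas (fun x y => F x (y + w)).
Proof.
move=> mF; apply: (jmeas_comp (a := fst) mF) => [|i]; first exact: measurable_fst.
under eq_fun do rewrite mxE.
by apply: measurable_funD; [exact: measurable_tuple2cV|exact: measurable_cst].
Qed.

Lemma jmeas_cst c : jmeas (fun _ _ => c). Proof. exact: measurable_cst. Qed.

Lemma jmeasD F G : jmeas F -> jmeas G -> jmeas (fun x y => F x y + G x y).
Proof. exact: measurable_funD. Qed.

Lemma jmeasB F G : jmeas F -> jmeas G -> jmeas (fun x y => F x y - G x y).
Proof. exact: measurable_funB. Qed.

Lemma jmeasM F G : jmeas F -> jmeas G -> jmeas (fun x y => F x y * G x y).
Proof. exact: measurable_funM. Qed.

Lemma lbounded_shift F w : lbounded F -> lbounded (fun x y => F x (y + w)).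
Proof.
move=> bF x r; have [M FM] := bF x (r + `|w|); exists M => y yr.
by apply: FM; rewrite (le_trans (ler_normD _ _))// lerD2r.
Qed.

Lemma lbounded_cst c : lbounded (fun _ _ => c).
Proof. by move=> x r; exists `|c|. Qed.

Lemma lboundedD F G : lbounded F -> lbounded G -> lbounded (fun x y => F x y + G x y).
Proof.
move=> bF bG x r; have [M FM] := bF x r; have [N GN] := bG x r; exists (M + N) => y yr.
by rewrite (le_trans (ler_normD _ _))// lerD ?FM ?GN.
Qed.

Lemma lboundedM F G : lbounded F -> lbounded G -> lbounded (fun x y => F x y * G x y).
Proof.
move=> bF bG x r; have [M FM] := bF x r; have [N GN] := bG x r; exists (M * N) => y yr.
by rewrite normrM ler_pM ?FM ?GN.
Qed.

(** The class of integrands stable under all later operations: joint measurability survives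
    averaging, and local boundedness gives integrability along every segment. *)
Definition jlb F := jmeas F /\ lbounded F.

Lemma jlb_shift F w : jlb F -> jlb (fun x y => F x (y + w)).
Proof. by case=> *; split; [exact: jmeas_shift|exact: lbounded_shift]. Qed.

Lemma jlb_cst c : jlb (fun _ _ => c).
Proof. by split; [exact: jmeas_cst|exact: lbounded_cst]. Qed.

Lemma jlbD F G : jlb F -> jlb G -> jlb (fun x y => F x y + G x y).
Proof. by case=> mF bF [mG bG]; split; [exact: jmeasD|exact: lboundedD]. Qed.

Lemma jlbM F G : jlb F -> jlb G -> jlb (fun x y => F x y * G x y).
Proof. by case=> mF bF [mG bG]; split; [exact: jmeasM|exact: lboundedM]. Qed.

Lemma jlbZ c F : jlb F -> jlb (fun x y => c * F x y).
Proof. by apply: jlbM; exact: jlb_cst. Qed.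

Lemma jlbB F G : jlb F -> jlb G -> jlb (fun x y => F x y - G x y).
Proof.
move=> jF jG; have := jlbD jF (jlbZ (-1) jG).
by under [X in jlb X -> _]eq_fun do under eq_fun do rewrite mulN1r.
Qed.

Lemma jlb_sum (I : Type) (s : seq I) (F : I -> T -> 'cV[R]_d -> R) :
  (forall i, jlb (F i)) -> jlb (fun x y => \sum_(i <- s) F i x y).
Proof.
move=> jF; elim: s => [|i s IHs].
  by under eq_fun do under eq_fun do rewrite big_nil; exact: jlb_cst.
by under eq_fun do under eq_fun do rewrite big_cons; exact: jlbD.
Qed.

(* The clamp does not change the integral; it makes the integrand bounded on the whole line. *)
Definition avg w F : T -> 'cV[R]_d -> R :=
  fun x y => \int[@leb01 R]_t F x (y + clamp01 t *: w).

Lemma norm_shift_clamp (y w : 'cV[R]_d) t : `|y + clamp01 t *: w| <= `|y| + `|w|.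
Proof.
rewrite (le_trans (ler_normD _ _))// lerD2l normrZ ler_piMl//.
by have /andP[t0 t1] := clamp01_itv t; rewrite ger0_norm.
Qed.

Lemma measurable_line F x y w : jmeas F -> measurable_fun [set: R] (fun t => F x (y + t *: w)).
Proof.
move=> mF; apply: (jmeas_comp (a := fun=> x) mF) => [|i]; first exact: measurable_cst.
under eq_fun do rewrite !mxE.
by apply: measurable_funD; [exact: measurable_cst|exact: measurable_funM].
Qed.

Lemma integrable_avg F w x y : jlb F ->
  (@leb01 R).-integrable setT (EFin \o (fun t => F x (y + clamp01 t *: w))).
Proof.
case=> mF bF; have [M FM] := bF x (`|y| + `|w|).
apply: (@integrable_leb01 _ _ M) => [|t]; last exact/FM/norm_shift_clamp.
exact: (measurableT_comp (measurable_line x y w mF) (@measurable_clamp01 R)).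
Qed.

Lemma avgD F G w x y : jlb F -> jlb G ->
  avg w (fun x y => F x y + G x y) x y = avg w F x y + avg w G x y.
Proof. by move=> jF jG; rewrite /avg RintegralD//; exact: integrable_avg. Qed.

Lemma avgZ c F w x y : jlb F -> avg w (fun x y => c * F x y) x y = c * avg w F x y.
Proof. by move=> jF; rewrite /avg RintegralZl//; exact: integrable_avg. Qed.

Lemma avg_cst c w x y : avg w (fun _ _ => c) x y = c.
Proof. exact: Rintegral_leb01_cst. Qed.

Lemma avg_le F G w x y : jlb F -> jlb G ->
  (forall t, 0 <= t <= 1 -> F x (y + t *: w) <= G x (y + t *: w)) ->
  avg w F x y <= avg w G x y.
Proof.
move=> jF jG FG; apply: le_Rintegral => //; [exact: integrable_avg|exact: integrable_avg|].
by move=> t _; apply/FG/clamp01_itv.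
Qed.

Lemma avg_shift F w v x y :
  avg w (fun x y => F x (y + v)) x y = avg w F x (y + v).
Proof. by apply: eq_Rintegral => t _; rewrite addrAC. Qed.

Lemma jlb_avg F w : jlb F -> jlb (avg w F).
Proof.
move=> jF; have [mF bF] := jF; split; last first.
  move=> x r; have [M FM] := bF x (r + `|w|); exists M => y yr.
  have FM' t : 0 <= t <= 1 -> `|F x (y + t *: w)| <= M.
    move=> t01; apply: FM; rewrite -(clamp01_id t01).
    by rewrite (le_trans (norm_shift_clamp _ _ _))// lerD2r.
  rewrite ler_norml; apply/andP; split.
    rewrite -(avg_cst (- M) w x y); apply: avg_le => //; first exact: jlb_cst.
    by move=> t /FM'; rewrite ler_norml => /andP[].
  rewrite -(avg_cst M w x y); apply: avg_le => //; first exact: jlb_cst.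
  by move=> t /FM'; rewrite ler_norml => /andP[].
pose f (z : (T * d.-tuple R) * (measurableTypeR R)) : \bar R :=
  (F z.1.1 (tuple2cV z.1.2 + clamp01 z.2 *: w))%:E.
have mf : measurable_fun setT f.
  apply/measurable_EFinP; apply: (jmeas_comp (a := fst \o fst) mF) => [|i].
    exact: (measurableT_comp measurable_fst measurable_fst).
  under eq_fun do rewrite !mxE.
  apply: measurable_funD.
    exact: (measurableT_comp (measurable_tnth i)
      (measurableT_comp measurable_snd measurable_fst)).
  apply: measurable_funM; last exact: measurable_cst.
  by apply: (measurableT_comp (@measurable_clamp01 R)); exact: measurable_snd.
(* Measurability of the integral in its parameter comes from Fubini's theorem, which wants a measure
   on the parameter space; for the zero measure integrability is immediate. *)
have intf : (mzero \x @leb01 R)%E.-integrable setT f.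
  apply/integrable12ltyP => //=.
  by rewrite integral_measure_zero ltry.
exact: (measurableT_comp (fine_measurable measurableT) (measurable_fubini_F intf)).
Qed.

Lemma avgC F w v x y : jlb F -> avg w (avg v F) x y = avg v (avg w F) x y.
Proof.
move=> jF; have [mF bF] := jF.
pose g (t s : R) := F x (y + clamp01 t *: w + clamp01 s *: v).
have [M FM] := bF x (`|y| + `|w| + `|v|).
have gM t s : `|g t s| <= M.
  apply: FM; apply: (le_trans (norm_shift_clamp _ _ _)).
  by rewrite lerD2r norm_shift_clamp.
pose f (z : measurableTypeR R * measurableTypeR R) : \bar R := (g z.1 z.2)%:E.
have mf : measurable_fun setT f.
  apply/measurable_EFinP; apply: (jmeas_comp (a := fun=> x) mF) => [|i].
    exact: measurable_cst.
  under eq_fun do rewrite !mxE.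
  apply: measurable_funD.
    apply: measurable_funD; first exact: measurable_cst.
    apply: measurable_funM; last exact: measurable_cst.
    by apply: (measurableT_comp (@measurable_clamp01 R)); exact: measurable_fst.
  apply: measurable_funM; last exact: measurable_cst.
  by apply: (measurableT_comp (@measurable_clamp01 R)); exact: measurable_snd.
have intf : (@leb01 R \x @leb01 R)%E.-integrable setT f.
  apply: measurable_bounded_integrable => //.
  - by rewrite -setXTT /= product_measure1E//= leb01_setT mule1 ltry.
  - exact/measurable_EFinP.
  - exists M; split; first exact: num_real.
    by move=> N MN t _ /=; exact: le_trans (gM _ _) (ltW MN).
have := Fubini intf; rewrite /f/=.
have E1 t : (\int[@leb01 R]_s (g t s)%:E)%E = (avg v F x (y + clamp01 t *: w))%:E.
  rewrite /avg /Rintegral fineK//; apply: integrable_fin_num => //.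
  exact: integrable_avg.
have E2 s : (\int[@leb01 R]_t (g t s)%:E)%E = (avg w F x (y + clamp01 s *: v))%:E.
  rewrite /avg /Rintegral fineK//; last first.
    by apply: integrable_fin_num => //; exact: integrable_avg.
  by apply: eq_integral => t _; rewrite /g addrAC.
under eq_integral do rewrite E1.
under [X in _ = X -> _]eq_integral do rewrite E2.
by rewrite /avg /Rintegral => ->.
Qed.

End average.

(** * Measurable predicates *)

Definition mprop d (S : measurableType d) (P : S -> Prop) := measurable [set s | P s].

Section measurable_predicates.
Context d (S : measurableType d).
Implicit Types P Q : S -> Prop.

Lemma mprop_not P : mprop P -> mprop (fun s => ~ P s).
Proof. exact: measurableC. Qed.

Lemma mprop_and P Q : mprop P -> mprop Q -> mprop (fun s => P s /\ Q s).
Proof. exact: measurableI. Qed.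

Lemma mprop_exists (I : countType) (P : I -> S -> Prop) :
  (forall i, mprop (P i)) -> mprop (fun s => exists i, P i s).
Proof.
move=> mP; rewrite /mprop (_ : [set s | _] = \bigcup_i [set s | P i s]).
  by apply: countable_bigcupT_measurable => //; exact: countableP.
by apply/seteqP; split => s [i]; [exists i|move=> _; exists i].
Qed.

Lemma mprop_forall (I : countType) (P : I -> S -> Prop) :
  (forall i, mprop (P i)) -> mprop (fun s => forall i, P i s).
Proof.
move=> mP; have := mprop_not (mprop_exists (fun i => mprop_not (mP i))).
rewrite /mprop; congr measurable; apply/seteqP; split => s /=; last first.
  by move=> Ps [i]; apply; exact: Ps.
by move=> nP i; apply: contrapT => nPi; apply: nP; exists i.
Qed.

Lemma mprop_cst (c : Prop) : mprop (fun _ : S => c).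
Proof.
rewrite /mprop; have [cT|cF] := pselect c.
  by rewrite (_ : [set _ | _] = setT)//; apply/seteqP; split.
by rewrite (_ : [set _ | _] = set0)//; apply/seteqP; split.
Qed.

Lemma mprop_imp P Q : mprop P -> mprop Q -> mprop (fun s => P s -> Q s).
Proof.
move=> mP mQ; have := mprop_not (mprop_and mP (mprop_not mQ)).
rewrite /mprop; congr measurable; apply/seteqP; split => s /=.
  by move=> nPQ Ps; apply: contrapT => nQ; exact: nPQ.
by move=> PQ [/PQ].
Qed.

Lemma mprop_le (R : realType) (f g : S -> R) :
  measurable_fun setT f -> measurable_fun setT g -> mprop (fun s => f s <= g s).
Proof.
move=> mf mg; rewrite /mprop -[X in measurable X]setTI.
by apply: (measurable_fun_ler mf mg) => //; exact: (_ : measurable [set true]).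
Qed.

Lemma mprop_lt (R : realType) (f g : S -> R) :
  measurable_fun setT f -> measurable_fun setT g -> mprop (fun s => f s < g s).
Proof.
move=> mf mg; rewrite /mprop -[X in measurable X]setTI.
by apply: (measurable_fun_ltr mf mg) => //; exact: (_ : measurable [set true]).
Qed.

Lemma mprop_comp d' (S' : measurableType d') (h : S' -> S) P :
  measurable_fun setT h -> mprop P -> mprop (P \o h).
Proof. by move=> mh mP; rewrite /mprop -[X in measurable X]setTI; exact: mh. Qed.

End measurable_predicates.

(** * Density of measurable sets of reals *)

(** This is non-porosity of [A] at [t], the only consequence of Lebesgue density that is used. *)
Definition dense_at (R : realType) (A : set R) (t : R) := forall eta : R, 0 < eta ->
  exists delta : R, 0 < delta /\ forall rho tau, 0 < rho < delta -> `|tau| <= rho ->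
    exists tau', `|tau' - tau| <= eta * rho /\ A (t + tau').

(** A hole of radius [eta * rho] occupies the fraction [eta / 2] of the ball of radius [rho * 2],
    which is impossible at small scales around a density point. *)
Lemma ae_dense_at (R : realType) (A : set (measurableTypeR R)) :
  measurable A -> {ae lebesgue_measure, forall t, A t -> dense_at A t}.
Proof.
move=> mA; have := lebesgue_density mA; apply: filterS.
  exact: (ae_filter_ringOfSetsType (@lebesgue_measure R)).
move=> t + At eta0 eta0_gt0.
(* The cap 1 keeps the hole inside the ball of radius [rho * 2]. *)
pose eta := Num.min eta0 1.
have eta_gt0 : 0 < eta by rewrite /eta lt_min eta0_gt0 ltr01.
have eta1 : eta <= 1 by rewrite /eta ge_min lexx orbT.
have eta_le : eta <= eta0 by rewrite /eta ge_min lexx.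
rewrite indicE mem_set//= => cvA.
have lt1 : ((1 - eta / 2)%:E < 1%:E :> \bar R)%E by rewrite lte_fin; lra.
have : nbhs (0 : R)^'+ (fun r => ((1 - eta / 2)%:E <
   lebesgue_measure (A `&` ball t r) * (lebesgue_measure (ball t r))^-1)%E).
  exact: cvA (open_ereal_gt' lt1).
move=> [delta /= delta0 H]; exists (delta / 2); split; first by rewrite divr_gt0.
move=> rho tau /andP[rho0 rhod] taur; apply: contrapT => nex.
have := H (rho * 2); rewrite /= sub0r normrN gtr0_norm ?mulr_gt0//.
rewrite -ltr_pdivlMr// => H1; have {H1}/= : _ := H1 rhod isT.
have r2 : 0 < rho * 2 by rewrite mulr_gt0.
have mb (c r : R) : measurable (ball c r : set (measurableTypeR R)).
  exact: measurable_ball.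
have eta_rho : 0 <= eta * rho by rewrite mulr_ge0// ltW.
have sub1 : A `&` ball t (rho * 2) `<=` ball t (rho * 2) `\` ball (t + tau) (eta * rho).
  move=> s [As bs]; split => //; rewrite /ball/= => bs'.
  apply: nex; exists (s - t); split; last by rewrite addrC subrK.
  rewrite (_ : s - t - tau = - (t + tau - s)); last by ring.
  rewrite normrN; apply: ltW; apply: (lt_le_trans bs').
  by rewrite ler_wpM2r// ltW.
have sub2 : ball (t + tau) (eta * rho) `<=` ball t (rho * 2).
  move=> s; rewrite /ball/= => bs.
  rewrite (_ : t - s = (t + tau - s) - tau); last by ring.
  rewrite (le_lt_trans (ler_normB _ _))// (_ : rho * 2 = rho + rho); last by ring.
  rewrite ltr_leD//; apply: (lt_le_trans bs); rewrite ger_pMl//.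
have le1 : (lebesgue_measure (A `&` ball t (rho * 2)) <=
    (rho * 4 - eta * rho * 2)%:E)%E.
  apply: (@le_trans _ _ (lebesgue_measure (ball t (rho * 2) `\` ball (t + tau) (eta * rho)))).
    apply: le_measure => //; rewrite inE; first exact: measurableI.
    exact: measurableD.
  have Bfin : (lebesgue_measure (ball t (rho * 2) : set (measurableTypeR R)) < +oo)%E.
    by rewrite lebesgue_measure_ball ?ltry// ltW.
  pose B1 : set (measurableTypeR R) := ball t (rho * 2).
  pose B2 : set (measurableTypeR R) := ball (t + tau) (eta * rho).
  have BD : lebesgue_measure (B1 `\` B2) = (lebesgue_measure B1 - lebesgue_measure B2)%E.
    by rewrite -[in RHS](setIidr (sub2 : B2 `<=` B1)); apply: measureD => //; exact: mb.
  rewrite BD /B1 /B2 !lebesgue_measure_ball ?(ltW r2)//.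
  by rewrite -EFinB lee_fin !mulr2n; lra.
rewrite lebesgue_measure_ball ?(ltW r2)// inver mulrn_eq0/= gt_eqF//.
have c0 : 0 < (rho * 2 *+ 2)^-1 by rewrite invr_gt0 mulrn_wgt0.
move=> lt2; have := lt_le_trans lt2 (lee_wpmul2r (_ : 0 <= ((rho * 2 *+ 2)^-1)%:E)%E le1).
rewrite lee_fin ltW// => /(_ isT); rewrite -EFinM lte_fin ltr_pdivlMr ?mulrn_wgt0//.
by rewrite mulr2n (_ : (1 - eta / 2) * _ = rho * 4 - eta * rho * 2) ?ltxx//; field.
Unshelve. all: by end_near. Qed.

(** * Directional derivatives of Lipschitz functions *)

Lemma is_derive_eps (R : realType) (g : R -> R) (t l : R) : is_derive t 1 g l ->
  forall e, 0 < e -> exists delta, 0 < delta /\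
    forall h, `|h| < delta -> `|g (t + h) - g t - l * h| <= e * `|h|.
Proof.
move=> [dg gl] e e0; have : h^-1 *: (g (h *: 1 + t) - g t) @[h --> (0 : R)^'] --> l.
  by rewrite -gl; exact: dg.
move=> /cvgrPdist_le/(_ _ e0)[delta /= delta0 H]; exists delta; split => // h hd.
have [->|h0] := eqVneq h 0; first by rewrite addr0 subrr mulr0 subrr normr0 mulr0.
have := H h; rewrite /= sub0r normrN => /(_ hd h0).
rewrite -(ler_pM2r (_ : 0 < `|h|)) ?normr_gt0// -normrM => H1.
rewrite (_ : _ - _ = - ((l - h^-1 *: (g (h *: 1 + t) - g t)) * h)) ?normrN//.
rewrite -[h *: 1]/(h * 1) mulr1 (addrC t) -[h^-1 *: _]/(h^-1 * _).
by rewrite mulrBl mulrAC mulVf// mul1r opprB addrC.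
Qed.

Lemma norm_limn_sup_le (R : realType) (u : nat -> R) (M : R) :
  (forall n, `|u n| <= M) -> `|limn_sup u| <= M.
Proof.
move=> uM.
have bu : bounded_fun u.
  by exists M; split; [exact: num_real|move=> N MN n _; exact: le_trans (uM n) (ltW MN)].
have supsM n : - M <= sups u n <= M.
  apply/andP; split.
    apply: (@le_trans _ _ (u n)); first by have := uM n; rewrite ler_norml => /andP[].
    apply: ub_le_sup; last by exists n => /=.
    by exists M => _ [k _ <-]; apply: le_trans (uM k); exact: ler_norm.
  apply: ge_sup; first by exists (u n); exists n => /=.
  by move=> _ [k _ <-]; apply: le_trans (uM k); exact: ler_norm.
rewrite limn_supE// ler_norml; apply/andP; split.
  apply: lb_le_inf; first by exists (sups u 0); exists 0%N.
  by move=> _ [n _ <-]; have /andP[] := supsM n.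
apply: (@le_trans _ _ (sups u 0)); last by have /andP[] := supsM 0%N.
apply: ge_inf; last by exists 0%N.
by exists (- M) => _ [n _ <-]; have /andP[] := supsM n.
Qed.

Section directional.
Context {R : realType} {d0 : measure_display} {T : measurableType d0} {d : nat}.
Implicit Types (F G : T -> 'cV[R]_d -> R) (w : 'cV[R]_d).

Definition lipb F := forall x r, exists L, forall y z,
  `|y| <= r -> `|z| <= r -> `|F x y - F x z| <= L * `|y - z|.

Lemma lipb_nneg F : lipb F -> forall x r, exists L, 0 <= L /\ forall y z,
  `|y| <= r -> `|z| <= r -> `|F x y - F x z| <= L * `|y - z|.
Proof.
move=> lF x r; have [L HL] := lF x r; exists `|L|; split => // y z yr zr.
by apply: le_trans (HL _ _ yr zr) _; rewrite ler_wpM2r// ler_norm.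
Qed.

Lemma lipb_lbounded F : lipb F -> lbounded F.
Proof.
move=> /lipb_nneg lF x r; have [L [L0 HL]] := lF x (`|r|).
exists (L * `|r| + `|F x 0|) => y yr.
rewrite -[F x y](subrK (F x 0)) (le_trans (ler_normD _ _))// lerD2r.
have yr' : `|y| <= `|r| by rewrite (le_trans yr)// ler_norm.
by rewrite (le_trans (HL _ _ yr' _)) ?normr0// subr0 ler_wpM2l.
Qed.

Definition ddiff w F (n : nat) x y := n.+1%:R * (F x (y + n.+1%:R^-1 *: w) - F x y).

(** An upper limit over a sequence of steps is defined at every point and jointly measurable,
    whether or not the derivative exists; by [dderP] it is the derivative where there is one. *)
Definition dder w F x y := limn_sup (fun n => ddiff w F n x y).

Lemma ddiff_bounded F w : lipb F ->
  forall x r, exists M, forall n y, `|y| <= r -> `|ddiff w F n x y| <= M.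
Proof.
move=> /lipb_nneg lF x r; have [L [L0 HL]] := lF x (r + `|w|); exists (L * `|w|) => n y yr.
rewrite /ddiff normrM ger0_norm// -ler_pdivlMl//.
apply: (le_trans (HL _ _ _ _)).
- rewrite (le_trans (ler_normD _ _))// lerD// normrZ ler_piMl//.
  by rewrite ger0_norm ?invr_ge0// invf_le1// ler1n.
- by rewrite (le_trans yr)// lerDl.
- by rewrite addrAC subrr add0r normrZ ger0_norm ?invr_ge0// mulrCA.
Qed.

Lemma jmeas_ddiff F w n : jmeas F -> jmeas (ddiff w F n).
Proof.
move=> mF; apply: jmeasM; first exact: jmeas_cst.
by apply: jmeasB => //; exact: jmeas_shift.
Qed.

Lemma jlb_dder F w : jmeas F -> lipb F -> jlb (dder w F).
Proof.
move=> mF lF; have bd := ddiff_bounded w lF; split.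
  apply: (@measurable_fun_limn_sup _ _ _ _ (fun n s => ddiff w F n s.1 (tuple2cV s.2))).
  - move=> s _; have [M HM] := bd s.1 `|tuple2cV s.2|; exists M => _ [n _ <-].
    by rewrite (le_trans (ler_norm _))// HM.
  - move=> s _; have [M HM] := bd s.1 `|tuple2cV s.2|; exists (- M) => _ [n _ <-].
    by have := HM n _ (lexx _); rewrite ler_norml => /andP[].
  - by move=> n; exact: jmeas_ddiff.
move=> x r; have [M HM] := bd x r; exists M => y yr.
by apply: norm_limn_sup_le => n; exact: HM.
Qed.

Definition has_dder w F x y := forall e, 0 < e -> exists delta, 0 < delta /\
  forall t, `|t| < delta -> `|F x (y + t *: w) - F x y - dder w F x y * t| <= e * `|t|.

Lemma dderP w F x y l :
  (forall e, 0 < e -> exists delta, 0 < delta /\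
    forall t, `|t| < delta -> `|F x (y + t *: w) - F x y - l * t| <= e * `|t|) ->
  dder w F x y = l.
Proof.
move=> H; have cv : ddiff w F ^~ x ^~ y @ \oo --> l.
  apply/cvgrPdist_le => e e0; have [delta [delta0 Hd]] := H e e0.
  near=> n; rewrite /ddiff.
  have n0 : 0 < n.+1%:R^-1 :> R by rewrite invr_gt0.
  have := Hd n.+1%:R^-1; rewrite ger0_norm; last exact: ltW.
  have nd : n.+1%:R^-1 < delta.
    near: n; exact: (near_infty_natSinv_lt (PosNum delta0)).
  move=> /(_ nd) H1; set a := F x _ - F x y in H1 *; clearbody a.
  rewrite (_ : l - _ = - (n.+1%:R * (a - l * n.+1%:R^-1))); last first.
    by rewrite mulrBr mulrCA divff// mulr1 opprB.
  by rewrite normrN normrM ger0_norm// -ler_pdivlMl// (mulrC _ e).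
by have [_ E] := cvg_limn_inf_sup cv; exact: E.
Unshelve. all: by end_near. Qed.

(** Projection onto [[-1, 2]]: composed with it, a function that is Lipschitz on balls becomes
    globally Lipschitz along a line, unchanged around [[0, 1]]. *)
Let cl (t : R) := Num.max (-1) (Num.min t 2).

Let cl_itv t : -1 <= cl t <= 2.
Proof. by rewrite /cl le_max lexx/= ge_max ge_min lexx orbT andbT; lra. Qed.

Let cl_id t : -1 <= t <= 2 -> cl t = t.
Proof. by move=> /andP[t0 t1]; rewrite /cl min_l// max_r. Qed.

Let cl_lip s t : `|cl s - cl t| <= `|s - t|.
Proof.
have clE u : cl u = if u <= -1 then -1 else if u <= 2 then u else 2.
  rewrite /cl minEle maxEle; case: (leP u 2) => u2; case: (leP u (-1)) => u1; case: ifPn => //.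
  - by move=> ?; apply/eqP; rewrite eq_le u1.
  - by move/negP => ?; exfalso; lra.
  - by move=> ?; exfalso; lra.
  - by move/negP => ?; exfalso; lra.
rewrite !clE; case: (leP s (-1)) => s1; case: (leP s 2) => s2; case: (leP t (-1)) => t1;
  case: (leP t 2) => t2; case: (ler0P (s - t)) => st; rewrite ?ler_norml ?lexx //; apply/andP; split; lra.
Qed.

(** The one-variable theorem on the line through [y]. The equality holds for every [x] and [y], so
    increments and averaged derivatives may be exchanged under further averages. *)
Lemma dder_FTC F w x y : jmeas F -> lipb F ->
  F x (y + w) - F x y = avg w (dder w F) x y /\
  {ae lebesgue_measure, forall t : R, 0 <= t <= 1 -> has_dder w F x (y + t *: w)}.
Proof.
move=> mF lF.
have [L [L0 HL]] := lipb_nneg lF x (`|y| + 2 * `|w|).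
pose G t := F x (y + cl t *: w).
have cly t : `|y + cl t *: w| <= `|y| + 2 * `|w|.
  rewrite (le_trans (ler_normD _ _))// lerD2l normrZ ler_wpM2r//.
  by rewrite ler_norml; have /andP[] := cl_itv t; lra.
have GL s t : `|G s - G t| <= L * `|w| * `|s - t|.
  rewrite (le_trans (HL _ _ (cly s) (cly t)))// -mulrA ler_wpM2l//.
  rewrite opprD addrACA subrr add0r -scalerBl normrZ mulrC ler_wpM2l//.
have [rho [mrho irho drho Erho]] := lipschitz_ae_is_derive GL.
have key (t : R) : 0 <= t <= 1 -> is_derive t 1 G (rho t) ->
    dder w F x (y + t *: w) = rho t /\ has_dder w F x (y + t *: w).
  move=> /andP[t0 t1] /is_derive_eps dG.
  have H e : 0 < e -> exists delta, 0 < delta /\ forall s, `|s| < delta ->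
      `|F x (y + t *: w + s *: w) - F x (y + t *: w) - rho t * s| <= e * `|s|.
    move=> /dG[delta [delta0 Hd]]; exists (Num.min delta 1); split.
      by rewrite lt_min delta0/=.
    move=> s; rewrite lt_min => /andP[sd s1]; have := Hd s sd.
    rewrite /G !cl_id; last 2 first.
    - by lra.
    - by move: s1; rewrite ltr_norml; lra.
    by rewrite scalerDl addrA.
  have E := dderP H; split => // e /H[delta [delta0 Hd]]; exists delta; split => // s sd.
  by rewrite E; exact: Hd.
split; last first.
  move: drho; apply: filterS; first exact: (ae_filter_ringOfSetsType (@lebesgue_measure R)).
  by move=> t dt t01; have [] := key t t01 (dt _) => //; move: t01; lra.
have [mD bD] := jlb_dder w mF lF.
have [M HM] := bD x (`|y| + `|w|).
rewrite /avg (@Rintegral_leb01 _ (fun t => dder w F x (y + t *: w)) M); last 2 first.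
- exact: measurable_line.
- move=> t t01; apply: HM; rewrite -(clamp01_id t01); exact: norm_shift_clamp.
have -> : F x (y + w) - F x y = G 1 - G 0.
  by rewrite /G !cl_id; [rewrite scale1r scale0r addr0|lra|lra].
rewrite Erho /Rintegral; congr fine; apply: ae_eq_integral => //.
- by apply/measurable_EFinP; exact: measurable_funTS.
- by apply/measurable_EFinP; apply: measurable_funTS; exact: measurable_line.
- move: drho; apply: filterS; first exact: (ae_filter_ringOfSetsType (@lebesgue_measure R)).
  move=> t dt /=; rewrite in_itv/= => t01.
  have t02 : -1 < t < 2 by move: t01; lra.
  by have [->] := key t t01 (dt t02).
Qed.

Lemma jlb_indic (N : T -> 'cV[R]_d -> Prop) :
  mprop (fun s : T * d.-tuple R => N s.1 (tuple2cV s.2)) ->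
  jlb (fun x y => (`[< N x y >])%:R).
Proof.
move=> mN; split; first exact: (measurable_indic mN).
by move=> x r; exists 1 => y _; case: asbool; rewrite ?normr0 ?normr1.
Qed.

Lemma avg_indic_null (N : T -> 'cV[R]_d -> Prop) w x y :
  mprop (fun s : T * d.-tuple R => N s.1 (tuple2cV s.2)) ->
  {ae lebesgue_measure, forall t : R, 0 <= t <= 1 -> ~ N x (y + t *: w)} ->
  avg w (fun x y => (`[< N x y >])%:R) x y = 0.
Proof.
move=> mN aeN; have [mI bI] := jlb_indic mN.
have mI' := measurable_line x y w mI.
rewrite /avg (@Rintegral_leb01 _ (fun t => (`[< N x (y + t *: w) >])%:R) 1)//; last first.
  by move=> t _; case: asbool; rewrite ?normr0 ?normr1.
rewrite [RHS](_ : _ = \int[lebesgue_measure]_(t in `[0, 1]) (0 : R)); last first.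
  by rewrite /Rintegral integral0.
rewrite /Rintegral; congr fine; apply: ae_eq_integral => //.
- by apply/measurable_EFinP; exact: measurable_funTS.
- move: aeN; apply: filterS; first exact: (ae_filter_ringOfSetsType (@lebesgue_measure R)).
  by move=> t Nt /=; rewrite in_itv/= => /Nt nN; rewrite asboolF.
Qed.

End directional.

(** * The max norm, and iterated averages *)

Section matrix_norm.
Context {R : realType} (m n : nat).
Implicit Type A : 'M[R]_(m, n).

Lemma norm_coord_le A i j : `|A i j| <= `|A|.
Proof.
rewrite [leRHS]mx_normrE.
by rewrite (le_bigmax _ (fun ij : 'I_m * 'I_n => `|A ij.1 ij.2|) (i, j)).
Qed.

Lemma norm_le_coord A (M : R) : 0 <= M -> (forall i j, `|A i j| <= M) -> `|A| <= M.
Proof.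
move=> M0 AM; rewrite [leLHS]mx_normrE; apply/bigmax_leP; split => // ij _; exact: AM.
Qed.

Lemma norm_lt_coord A (M : R) : 0 < M -> (forall i j, `|A i j| < M) -> `|A| < M.
Proof.
move=> M0 AM; rewrite [ltLHS]mx_normrE; apply/bigmax_ltP; split => // ij _; exact: AM.
Qed.

End matrix_norm.

Section iterated_average.
Context {R : realType} {d0 : measure_display} {T : measurableType d0} {d : nat}.
Implicit Types (F G : T -> 'cV[R]_d -> R) (w : 'cV[R]_d) (ws : seq 'cV[R]_d).

Definition avgs ws F : T -> 'cV[R]_d -> R := foldr avg F ws.

Lemma jlb_avgs F ws : jlb F -> jlb (avgs ws F).
Proof. by move=> jF; elim: ws => //= w ws; exact: jlb_avg. Qed.

Lemma avgs_avg F w ws : jlb F -> avgs ws (avg w F) = avg w (avgs ws F).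
Proof.
move=> jF; elim: ws => //= v ws ->.
by apply/funext => x; apply/funext => y; apply: avgC; exact: jlb_avgs.
Qed.

(** Averages commute, so any one of the list can be made the innermost. *)
Lemma avgs_rem F w ws : jlb F -> w \in ws -> avgs ws F = avgs (rem w ws) (avg w F).
Proof.
move=> jF; elim: ws => //= v ws IH; rewrite in_cons eq_sym.
by case: eqVneq => [->|_] /=; [rewrite avgs_avg|move=> /IH ->].
Qed.

Lemma avgs_cst c ws x y : avgs ws (fun _ _ => c) x y = c.
Proof.
elim: ws x y => //= w ws IH x y; rewrite (_ : avgs ws _ = fun _ _ => c) ?avg_cst//.
by apply/funext => x'; apply/funext => y'.
Qed.

Lemma avgsD F G ws x y : jlb F -> jlb G ->
  avgs ws (fun x y => F x y + G x y) x y = avgs ws F x y + avgs ws G x y.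
Proof.
move=> jF jG; elim: ws x y => //= w ws IH x y.
rewrite (_ : avgs ws _ = fun x y => avgs ws F x y + avgs ws G x y).
  by rewrite avgD//; exact: jlb_avgs.
by apply/funext => x'; apply/funext => y'.
Qed.

Lemma avgsZ c F ws x y : jlb F ->
  avgs ws (fun x y => c * F x y) x y = c * avgs ws F x y.
Proof.
move=> jF; elim: ws x y => //= w ws IH x y.
rewrite (_ : avgs ws _ = fun x y => c * avgs ws F x y).
  by rewrite avgZ//; exact: jlb_avgs.
by apply/funext => x'; apply/funext => y'.
Qed.

Lemma avgsB F G ws x y : jlb F -> jlb G ->
  avgs ws (fun x y => F x y - G x y) x y = avgs ws F x y - avgs ws G x y.
Proof.
move=> jF jG; rewrite (_ : (fun _ _ => _) = fun x y => F x y + (-1) * G x y).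
  by rewrite avgsD//; [rewrite avgsZ// mulN1r|exact: jlbZ].
by apply/funext => x'; apply/funext => y'; rewrite mulN1r.
Qed.

Lemma avgs_sum (I : Type) (s : seq I) (F : I -> T -> 'cV[R]_d -> R) ws x y :
  (forall i, jlb (F i)) ->
  avgs ws (fun x y => \sum_(i <- s) F i x y) x y = \sum_(i <- s) avgs ws (F i) x y.
Proof.
move=> jF; elim: s => [|i s IHs].
  rewrite big_nil (_ : (fun _ _ => _) = (fun _ _ => 0)) ?avgs_cst//.
  by apply/funext => x'; apply/funext => y'; rewrite big_nil.
rewrite big_cons -IHs -avgsD//; last exact: jlb_sum.
by congr (avgs ws _ x y); apply/funext => x'; apply/funext => y'; rewrite big_cons.
Qed.

Lemma avgs_shift F ws v x y :
  avgs ws (fun x y => F x (y + v)) x y = avgs ws F x (y + v).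
Proof.
elim: ws x y => //= w ws IH x y; rewrite (_ : avgs ws _ = fun x y => avgs ws F x (y + v)).
  exact: avg_shift.
by apply/funext => x'; apply/funext => y'.
Qed.

Lemma avgs_le F G ws x y : jlb F -> jlb G ->
  (forall y', `|y' - y| <= \sum_(w <- ws) `|w| -> F x y' <= G x y') ->
  avgs ws F x y <= avgs ws G x y.
Proof.
move=> jF jG; elim: ws y => /= [y FG|w ws IH y FG].
  by apply: FG; rewrite subrr normr0 big_nil.
apply: avg_le; [exact: jlb_avgs|exact: jlb_avgs|move=> t /andP[t0 t1]].
apply: IH => y' yy'; apply: FG; rewrite big_cons.
rewrite (_ : y' - y = t *: w + (y' - (y + t *: w))); last first.
  by apply/matrixP => i j; rewrite !mxE; ring.
rewrite (le_trans (ler_normD _ _))// lerD// normrZ ger0_norm//.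
by rewrite ler_piMl.
Qed.

(** The substitute for the fact that a set which is null on all lines of one direction is null in
    the whole space. *)
Lemma avgs_null (N : T -> 'cV[R]_d -> R) w ws :
  jlb N -> w \in ws -> (forall x y, avg w N x y = 0) -> forall x y, avgs ws N x y = 0.
Proof.
move=> jN wws N0 x y; rewrite (avgs_rem jN wws) (_ : avg w N = fun _ _ => 0) ?avgs_cst//.
by apply/funext => x'; apply/funext => y'.
Qed.

End iterated_average.

(** * Rademacher's theorem *)

Lemma rat_near (R : realType) (x e : R) : 0 < e -> exists q : rat, `|x - ratr q| < e.
Proof.
move=> e0; have [q] := @rat_in_itvoo R (x - e) (x + e) (ltac:(lra)).
by rewrite in_itv/= => /andP[q1 q2]; exists q; rewrite ltr_norml; lra.
Qed.

Lemma inv_nat_lt (R : realType) (e : R) : 0 < e -> exists n : nat, n.+1%:R^-1 < e.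
Proof.
move=> e0; have [n _ H] := near_infty_natSinv_lt (PosNum e0).
by exists n; apply: H => /=.
Qed.

Lemma measurable_norm d (S : measurableType d) (R : realType) (f : S -> R) :
  measurable_fun setT f -> measurable_fun setT (fun s => `|f s|).
Proof. by move=> mf; apply: (measurableT_comp _ mf); exact: normr_measurable. Qed.

Lemma ae_forall_countable d (S : measurableType d) (R : realType) (I : countType)
    (mu : {measure set S -> \bar R}) (P : I -> S -> Prop) :
  (forall i, {ae mu, forall s, P i s}) -> {ae mu, forall s, forall i, P i s}.
Proof.
move=> H; have FF : Filter (nbhs (almost_everywhere mu)).
  exact: ae_filter_ringOfSetsType.
have : {ae mu, forall s, forall n, if unpickle n is Some i then P i s else True}.
  apply: ae_foralln => n; case: (unpickle n) => [i|]; first exact: H.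
  exact: aeW.
by apply: filterS => s Hs i; have := Hs (pickle i); rewrite pickleK.
Qed.

Section rademacher.
Context {R : realType} {d0 : measure_display} {T : measurableType d0} {d : nat}.
Implicit Types (F : T -> 'cV[R]_d -> R) (h : R) (c : 'cV[rat]_d).

Definition rv c : 'cV[R]_d := map_mx ratr c.

Lemma rvE c j : rv c j 0 = ratr (c j 0).
Proof. by rewrite mxE. Qed.

Definition low (i : nat) c := forall j : 'I_d, (i <= j)%N -> c j 0 = 0.

Definition basis h (i : 'I_d) : 'cV[R]_d := h *: delta_mx i 0.

Definition dot (a b : 'I_d -> R) := \sum_j a j * b j.

Definition pdiff F h x y (j : 'I_d) := dder (basis h j) F x y.

(* [F x] is differentiable at [y] relatively to the span of the first [i] coordinate vectors,
   tested on the countable set of the increments [h c], [c] rational. *)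
Definition diff_upto F h (i : nat) x y := forall p : nat, exists m : nat, forall c,
  low i c -> `|rv c| < m.+1%:R^-1 ->
  `|F x (y + h *: rv c) - F x y - dot (pdiff F h x y) (fun j => rv c j 0)|
    <= p.+1%:R^-1 * `|rv c|.

(** Differentiability with a rational slope, a fixed tolerance and a fixed radius: these sets are
    measurable and countably many, so density holds for all of them simultaneously on almost all of
    a line. *)
Definition near_linear F h (i : nat) (p m : nat) (r : 'cV[rat]_d) x y := forall c,
  low i c -> `|rv c| < m.+1%:R^-1 ->
  `|F x (y + h *: rv c) - F x y - dot (fun j => rv r j 0) (fun j => rv c j 0)|
    <= p.+1%:R^-1 * `|rv c|.

Lemma jmeas_dot F h (a : 'I_d -> R) : jmeas F -> lipb F ->
  jmeas (fun x y => dot (pdiff F h x y) a).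
Proof.
move=> mF lF; have [+ _] : jlb (fun x y => dot (pdiff F h x y) a).
  apply: jlb_sum => j; apply: jlbM; last exact: jlb_cst.
  exact: jlb_dder.
exact.
Qed.

Lemma mprop_diff_upto F h i : jmeas F -> lipb F ->
  mprop (fun s : T * d.-tuple R => diff_upto F h i s.1 (tuple2cV s.2)).
Proof.
move=> mF lF; apply: mprop_forall => p; apply: mprop_exists => m.
apply: mprop_forall => c; apply: mprop_imp; first exact: mprop_cst.
apply: mprop_imp; first exact: mprop_cst.
apply: mprop_le; last exact: measurable_cst.
apply: measurable_norm.
exact: (jmeasB (jmeasB (jmeas_shift _ mF) mF) (jmeas_dot h _ mF lF)).
Qed.

Lemma mprop_near_linear F h i p m r : jmeas F ->
  mprop (fun s : T * d.-tuple R => near_linear F h i p m r s.1 (tuple2cV s.2)).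
Proof.
move=> mF; apply: mprop_forall => c; apply: mprop_imp; first exact: mprop_cst.
apply: mprop_imp; first exact: mprop_cst.
apply: mprop_le; last exact: measurable_cst.
apply: measurable_norm.
exact: (jmeasB (jmeasB (jmeas_shift _ mF) mF) (jmeas_cst _)).
Qed.

Lemma dot_le (a b : 'I_d -> R) (v : 'cV[R]_d) e : 
  (forall j, `|a j - b j| <= e / d.+1%:R) -> 0 <= e ->
  `|dot a (fun j => v j 0) - dot b (fun j => v j 0)| <= e * `|v|.
Proof.
move=> ab e0; rewrite /dot -sumrB.
apply: (le_trans (ler_norm_sum _ _ _)).
apply: (@le_trans _ _ (\sum_(j < d) (e / d.+1%:R * `|v|))).
  apply: ler_sum => j _; rewrite -mulrBl normrM ler_pM//.
  exact: norm_coord_le.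
rewrite sumr_const card_ord -[_ *+ d]mulr_natl mulrA ler_wpM2r//.
rewrite mulrCA ler_piMr// ler_pdivrMr// mul1r ler_nat//.
Qed.

(** The increment is split into [tau] along direction [i] and [c'] in the lower coordinates. The
    behaviour along [c'] is known at [y] but needed after the displacement along [i]. Density
    provides a displacement [tau'] close to [tau] after which [F] is nearly linear with the same
    slope and radius; the Lipschitz bound pays for the change from [tau] to [tau']. *)
Lemma diff_upto_step F h (i : 'I_d) x y : 0 < h -> lipb F ->
  diff_upto F h i x y -> has_dder (basis h i) F x y ->
  (forall p m r, near_linear F h i p m r x y ->
     forall eta : R, 0 < eta -> exists delta : R, 0 < delta /\
     forall rho tau, 0 < rho < delta -> `|tau| <= rho ->
     exists tau', `|tau' - tau| <= eta * rho /\
       near_linear F h i p m r x (y + tau' *: basis h i)) ->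
  diff_upto F h i.+1 x y.
Proof.
move=> h0 lF Gi Di dens p.
(* The errors [H1] and [H5] together, then [H2], [H3] and [H4], cost [1 + 2 + 2 + 1] times
   [e * rho], which 8 covers. *)
pose e : R := (8 * p.+1%:R)^-1.
have e0 : 0 < e by rewrite invr_gt0 mulr_gt0.
have [P Pe] := inv_nat_lt e0.
have [m1 Hm1] := Gi P.
have [r Hr] : exists r : 'cV[rat]_d, forall j, `|pdiff F h x y j - rv r j 0| <= e / d.+1%:R.
  have H j : exists q : rat, `|pdiff F h x y j - ratr q| < e / d.+1%:R.
    by apply: rat_near; rewrite divr_gt0.
  have [f Hf] := choice H.
  by exists (\col_j f j) => j; rewrite !mxE ltW.
(* The successor of [4 * p + 3] is [4 * p.+1], so the tolerance is [2 * e]: one [e] for the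
   derivative, one for rounding the slope to [r]. *)
have nl : near_linear F h i (4 * p + 3) m1 r x y.
  move=> c lc cm; have H1 := Hm1 c lc cm.
  have H2 := dot_le (rv c) Hr (ltW e0).
  set a := _ - F x y in H1 *; set D := dot (pdiff F h x y) _ in H1 H2.
  set D' := dot _ _ in H2 *.
  rewrite (_ : a - D' = (a - D) + (D - D')); last by ring.
  rewrite (le_trans (ler_normD _ _))// (le_trans (lerD H1 H2))//.
  rewrite -mulrDl ler_wpM2r//.
  rewrite (_ : (4 * p + 3).+1%:R^-1 = e + e); first by rewrite lerD2r ltW.
  rewrite (_ : (4 * p + 3).+1 = 4 * p.+1)%N; last by rewrite mulnS addnC -addnS.
  by rewrite natrM /e; field.
(* The lower part contributes at most [h] and the displacement [tau'] at most [2 * h]. *)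
have [L [L0 HL]] := lipb_nneg lF x (`|y| + 3 * h).
pose Di' := pdiff F h x y i.
pose K := h * L + `|Di'| + 1.
have K0 : 0 < K by rewrite /K ltr_wpDl// addr_ge0// mulr_ge0// ltW.
pose eta := Num.min 1 (e / K).
have eta0 : 0 < eta by rewrite /eta lt_min ltr01 divr_gt0.
have eta1 : eta <= 1 by rewrite /eta ge_min lexx.
have etaK : eta * K <= e by rewrite -ler_pdivlMr// /eta ge_min lexx orbT.
have [del1 [del10 Hd1]] := dens _ _ _ nl eta eta0.
have [del2 [del20 Hd2]] := Di e e0.
(* [del2] is halved because [tau'] is only bounded by [2 * rho]. *)
have [m2 Hm2] : exists m2 : nat, m2.+1%:R^-1 <
    Num.min (Num.min del1 (del2 / 2)) (Num.min m1.+1%:R^-1 1).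
  by apply: inv_nat_lt; rewrite !lt_min del10 divr_gt0//= invr_gt0 ltr0n/=.
exists m2 => c lc; set rho := `|rv c| => cm.
move: (lt_trans cm Hm2); rewrite !lt_min => /andP[/andP[rd1 rd2] /andP[rm1 r1]].
have [c0|c0] := eqVneq (rv c) 0.
  rewrite /rho c0 scaler0 addr0 subrr sub0r normrN normr0 mulr0.
  by rewrite /dot big1 ?normr0// => j _; rewrite mxE mulr0.
have rho0 : 0 < rho by rewrite normr_gt0.
pose tau := rv c i 0.
have taur : `|tau| <= rho by exact: norm_coord_le.
have [tau' [Htau nl']] := Hd1 rho tau (ltac:(by apply/andP)) taur.
pose c' : 'cV[rat]_d := \col_j (if j == i then 0 else c j 0).
have lc' : low i c'.
  move=> j ij; rewrite mxE; case: eqVneq => // ji; apply: lc.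
  by rewrite ltn_neqAle ij andbT eq_sym.
have c'r : `|rv c'| <= rho.
  apply: norm_le_coord => [|j k]; first exact: ltW.
  rewrite ord1 !mxE; case: eqP => _; first by rewrite rmorph0 normr0 ltW.
  by have := norm_coord_le (rv c) j 0; rewrite rvE.
have cE : h *: rv c = h *: rv c' + tau *: basis h i.
  apply/matrixP => j k; rewrite ord1 !mxE /= eqxx andbT /tau mxE; case: eqP => [->|_] /=.
    by rewrite rmorph0; ring.
  by ring.
have dotE : dot (pdiff F h x y) (fun j => rv c j 0) =
    dot (pdiff F h x y) (fun j => rv c' j 0) + Di' * tau.
  rewrite /dot (bigD1 i)//= [in RHS](bigD1 i)//=.
  have -> : rv c' i 0 = 0 by rewrite rvE mxE eqxx rmorph0.
  rewrite (mulr0 (pdiff F h x y i)) add0r addrC; congr (_ + _); apply: eq_bigr => j ji.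
  by rewrite !rvE mxE (negbTE ji).
have tau'r : `|tau'| <= 2 * rho.
  rewrite (_ : tau' = (tau' - tau) + tau); last by ring.
  rewrite (le_trans (ler_normD _ _))//.
  have : eta * rho <= rho by rewrite ger_pMl.
  by move: Htau taur; lra.
have H1 : `|F x (y + h *: rv c) - F x (y + tau' *: basis h i + h *: rv c')| <= L * (h * (eta * rho)).
  have hr : h * `|rv c'| <= h * 1 by rewrite ler_wpM2l ?(ltW h0)// (le_trans c'r)// ltW.
  have hb v : `|v *: basis h i| <= `|v| * h.
    rewrite normrZ ler_wpM2l//; apply: norm_le_coord => [|j k]; first exact: ltW.
    rewrite !mxE; case: (_ && _); rewrite ?mulr1 ?mulr0 ?normr0 ?(ltW h0)//.
    by rewrite ger0_norm// ltW.
  have hv : `|h *: rv c'| <= h by rewrite normrZ ger0_norm ?(ltW h0)// -[leRHS]mulr1.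
  rewrite (le_trans (HL _ _ _ _))//.
  - rewrite cE (le_trans (ler_normD _ _))// lerD2l (le_trans (ler_normD _ _))//.
    have := hb tau; have : `|tau| * h <= 1 * h.
      by rewrite ler_wpM2r ?(ltW h0)// (le_trans taur)// ltW.
    lra.
  - rewrite -addrA (le_trans (ler_normD _ _))// lerD2l (le_trans (ler_normD _ _))//.
    have := hb tau'; have : `|tau'| * h <= 2 * h.
      by rewrite ler_wpM2r ?(ltW h0)// (le_trans tau'r)// ger_pMr// ltW.
    lra.
  rewrite ler_wpM2l// cE (_ : _ - _ = (tau - tau') *: basis h i); last first.
    by apply/matrixP => j k; rewrite !mxE; ring.
  by rewrite (le_trans (hb _))// mulrC ler_wpM2l ?(ltW h0)// distrC.
have H2 := nl' c' lc' (le_lt_trans c'r rm1).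
have H3 := Hd2 tau' (ltac:(apply: (le_lt_trans tau'r); move: rd2; lra)).
have H4 := dot_le (rv c') Hr (ltW e0).
have H5 : `|Di' * (tau' - tau)| <= `|Di'| * (eta * rho) by rewrite normrM ler_wpM2l.
rewrite dotE.
rewrite (_ : F x (y + h *: rv c) - _ - _ =
  (F x (y + h *: rv c) - F x (y + tau' *: basis h i + h *: rv c')) +
  (F x (y + tau' *: basis h i + h *: rv c') - F x (y + tau' *: basis h i)
     - dot (fun j => rv r j 0) (fun j => rv c' j 0)) +
  (F x (y + tau' *: basis h i) - F x y - Di' * tau') +
  - (dot (pdiff F h x y) (fun j => rv c' j 0) - dot (fun j => rv r j 0) (fun j => rv c' j 0)) +
  Di' * (tau' - tau)); last by ring.
have tri5 (a1 a2 a3 a4 a5 : R) :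
    `|a1 + a2 + a3 + a4 + a5| <= `|a1| + `|a2| + `|a3| + `|a4| + `|a5|.
  by do 4 (apply: (le_trans (ler_normD _ _)); rewrite lerD2r).
apply: (le_trans (tri5 _ _ _ _ _)); rewrite normrN.
have e1 : L * (h * (eta * rho)) + `|Di'| * (eta * rho) <= e * rho.
  apply: (@le_trans _ _ (eta * K * rho)); last by rewrite ler_wpM2r// ltW.
  rewrite -subr_ge0 (_ : _ - _ = eta * rho); first by rewrite mulr_ge0// ltW.
  by rewrite /K; ring.
have e2 : e * `|tau'| <= e * (2 * rho) by rewrite ler_wpM2l// ltW.
have e3 : e * `|rv c'| <= e * rho by rewrite ler_wpM2l// ltW.
have e4 : (4 * p + 3).+1%:R^-1 * `|rv c'| <= 2 * e * rho.
  rewrite (_ : (4 * p + 3).+1 = 4 * p.+1)%N; last by rewrite mulnS addnC -addnS.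
  rewrite (_ : (4 * p.+1)%:R^-1 = 2 * e); last by rewrite natrM /e; field.
  by rewrite ler_wpM2l// mulr_ge0// ltW.
have e5 : 8 * (e * rho) = p.+1%:R^-1 * rho by rewrite /e; field.
have e6 : 0 <= e * rho by rewrite mulr_ge0// ltW.
apply: (le_trans (lerD (lerD (lerD (lerD H1 H2) H3) H4) H5)).
rewrite -e5; move: e1 e2 e3 e4 e6.
move: ((4 * p + 3).+1%:R^-1 * `|rv c'|) (e * `|tau'|) (e * `|rv c'|) (`|Di'| * (eta * rho)) (L * (h * (eta * rho))) => q1 q2 q3 q4 q5.
rewrite -mulrA [e * (2 * rho)]mulrCA; move: (e * rho) => q6; lra.
Qed.

Lemma mprop_line (N : T -> 'cV[R]_d -> Prop) x y w :
  mprop (fun s : T * d.-tuple R => N s.1 (tuple2cV s.2)) ->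
  mprop (fun t : R => N x (y + t *: w)).
Proof.
move=> mN; pose b (t : R) : d.-tuple R := [tuple (y + t *: w) i 0 | i < d].
have mb : measurable_fun [set: R] (fun t => (x, b t)).
  apply: measurable_fun_pair; first exact: measurable_cst.
  apply/measurable_fun_tnthP => i.
  rewrite (_ : _ \o _ = fun t => y i 0 + t * w i 0).
    by apply: measurable_funD; [exact: measurable_cst|exact: measurable_funM].
  by apply/funext => t; rewrite /= tnth_mktuple !mxE.
have := mprop_comp mb mN; rewrite /mprop; congr measurable.
apply/seteqP; split => t /=; rewrite (_ : tuple2cV (b t) = y + t *: w)//;
  by apply/matrixP => i j; rewrite mxE tnth_mktuple ord1.
Qed.

Definition bad F h (i : nat) x y := diff_upto F h i x y /\ ~ diff_upto F h i.+1 x y.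

(** Almost every point of a line in direction [i] has a derivative along it and is well surrounded
    by each of the countably many sets [near_linear] containing it; [diff_upto_step] then forbids
    [bad]. *)
Lemma avg_bad F h (i : 'I_d) x y : 0 < h -> jmeas F -> lipb F ->
  avg (basis h i) (fun x y => (`[< bad F h i x y >])%:R) x y = 0.
Proof.
move=> h0 mF lF; apply: avg_indic_null.
  by apply: mprop_and; [|apply: mprop_not]; exact: mprop_diff_upto.
have [_ dF] := dder_FTC (basis h i) x y mF lF.
have aed (k : nat * nat * 'cV[rat]_d) : {ae lebesgue_measure, forall t : R,
    let A := [set t | near_linear F h i k.1.1 k.1.2 k.2 x (y + t *: basis h i)] in
    A t -> dense_at A t}.
  by apply: ae_dense_at; apply: mprop_line; exact: mprop_near_linear.
have {}aed : {ae lebesgue_measure, forall t : R, forall k : nat * nat * 'cV[rat]_d,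
    let A := [set t | near_linear F h i k.1.1 k.1.2 k.2 x (y + t *: basis h i)] in
    A t -> dense_at A t}.
  exact: ae_forall_countable.
have FF : Filter (nbhs (almost_everywhere (@lebesgue_measure R))).
  exact: ae_filter_ringOfSetsType.
apply: filterS2 dF aed => t dt At t01 [Gi]; apply.
apply: (diff_upto_step h0 lF Gi (dt t01)).
move=> p m r nl eta eta0; have [delta [delta0 H]] := At (p, m, r) nl eta eta0.
exists delta; split => // rho tau rhod taur; have [tau' [H1 H2]] := H rho tau rhod taur.
by exists tau'; split => //; move: H2; rewrite /= scalerDl addrA.
Qed.

Lemma diff_upto0 F h x y : diff_upto F h 0 x y.
Proof.
move=> p; exists 0%N => c lc _.
have -> : rv c = 0 by apply/matrixP => i j; rewrite ord1 !mxE lc// rmorph0.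
rewrite scaler0 addr0 subrr sub0r normrN normr0 mulr0.
by rewrite /dot big1 ?normr0// => j _; rewrite mxE mulr0.
Qed.

Lemma jlb_nondiff F h i : jmeas F -> lipb F ->
  jlb (fun x y => (`[< ~ diff_upto F h i x y >])%:R : R).
Proof. by move=> mF lF; apply: jlb_indic; apply: mprop_not; exact: mprop_diff_upto. Qed.

(** At a point of non-differentiability there is a first coordinate where [diff_upto] breaks down,
    so the point is [bad] for it, and the average in that direction vanishes. *)
Lemma avgs_nondiff F h ws x y : 0 < h -> jmeas F -> lipb F ->
  (forall i, basis h i \in ws) ->
  avgs ws (fun x y => (`[< ~ diff_upto F h d x y >])%:R) x y = 0.
Proof.
move=> h0 mF lF hws.
have jbad i : jlb (fun x y => (`[< bad F h i x y >])%:R : R).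
  by apply: jlb_indic; apply: mprop_and; [|apply: mprop_not]; exact: mprop_diff_upto.
have jnd := jlb_nondiff h d mF lF.
apply/eqP; rewrite eq_le; apply/andP; split; last first.
  rewrite -(avgs_cst 0 ws x y); apply: avgs_le => //; first exact: jlb_cst.
rewrite (_ : 0 = avgs ws (fun x y => \sum_(i < d) (`[< bad F h i x y >])%:R) x y).
  apply: avgs_le => //; first exact: jlb_sum.
  move=> y' _; have [nd|nd] := asboolP (~ _); last by rewrite sumr_ge0.
  have [i bi] : exists i : 'I_d, bad F h i x y'.
    apply: contrapT => nb; apply: nd.
    suff : forall k, (k <= d)%N -> diff_upto F h k x y' by apply.
    elim=> [_|k IH kd]; first exact: diff_upto0.
    apply: contrapT => nk; apply: nb; exists (Ordinal kd); split => //.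
    exact/IH/ltnW.
  rewrite (bigD1 i)//= asboolT//= lerDl sumr_ge0//.
rewrite avgs_sum ?big1// => i _; apply: (avgs_null (w := basis h i)) => // x' y'.
exact: avg_bad.
Qed.

(** Rational increments are dense and [F] is Lipschitz. The factor [h^-1] appears because [pdiff]
    differentiates along [h] times a unit vector. *)
Lemma diff_uptoP F h x y : 0 < h -> lipb F -> diff_upto F h d x y ->
  forall e, 0 < e -> exists delta, 0 < delta /\ forall v : 'cV[R]_d, `|v| < delta ->
    `|F x (y + v) - F x y - dot (fun j => h^-1 * pdiff F h x y j) (fun j => v j 0)| <= e * `|v|.
Proof.
move=> h0 lF Gd e e0.
have [p pe] := inv_nat_lt (mulr_gt0 e0 h0).
have [m Hm] := Gd p.
have m0 : 0 < m.+1%:R^-1 :> R by rewrite invr_gt0.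
exists (h * m.+1%:R^-1); split; first by rewrite mulr_gt0.
move=> v; rewrite -ltr_pdivrMl// => vm.
have [L [L0 HL]] := lipb_nneg lF x (`|y| + `|v| + h).
pose D := pdiff F h x y.
pose K := L * h + e * h + \sum_j `|D j|.
have K0 : 0 <= K by rewrite /K !addr_ge0// ?sumr_ge0// mulr_ge0// ltW.
(* The rational approximation is chosen after [v], so its error [e'] can tend to zero independently
   of the size of [v]. *)
apply/ler_addgt0Pr => e' e'0.
pose eta := Num.min (Num.min 1 (m.+1%:R^-1 - h^-1 * `|v|)) (e' / (K + 1)).
have eta0 : 0 < eta.
  by rewrite /eta !lt_min ltr01 subr_gt0 vm/= divr_gt0// ltr_wpDl.
have eta1 : eta <= 1 by rewrite /eta !ge_min lexx.
have etam : eta <= m.+1%:R^-1 - h^-1 * `|v| by rewrite /eta !ge_min lexx orbT.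
have etaK : eta * K <= e'.
  apply: (@le_trans _ _ (eta * (K + 1))); first by rewrite ler_wpM2l ?lerDl// ltW.
  by rewrite -ler_pdivlMr ?ltr_wpDl// /eta !ge_min lexx orbT.
have [c Hc] : exists c, `|h^-1 *: v - rv c| < eta.
  have H j : exists q : rat, `|(h^-1 *: v) j 0 - ratr q| < eta by exact: rat_near.
  have [f Hf] := choice H.
  exists (\col_j f j); apply: norm_lt_coord => // i j.
  by rewrite ord1; have := Hf i; rewrite !mxE.
have cr : `|rv c| < h^-1 * `|v| + eta.
  rewrite -[rv c](subrK (h^-1 *: v)) addrC (le_lt_trans (ler_normD _ _))//.
  by rewrite normrZ ger0_norm ?invr_ge0 ?(ltW h0)// distrC ltrD2l.
have := Hm c; rewrite -/D => /(_ _ (lt_le_trans cr _))H1.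
have {}H1 : `|F x (y + h *: rv c) - F x y - dot D (fun j => rv c j 0)| <= p.+1%:R^-1 * `|rv c|.
  by apply: H1; [move=> j; rewrite leqNgt ltn_ord|by rewrite addrC -lerBrDr].
have H2 : `|F x (y + v) - F x (y + h *: rv c)| <= L * (h * eta).
  have hv : h * (h^-1 * `|v|) = `|v| by rewrite mulrA divff ?mul1r// gt_eqF.
  rewrite (le_trans (HL _ _ _ _))//.
  - by rewrite (le_trans (ler_normD _ _))// lerDl ltW.
  - rewrite (le_trans (ler_normD _ _))// -addrA lerD2l normrZ ger0_norm ?(ltW h0)//.
    apply: (@le_trans _ _ (h * (h^-1 * `|v| + eta))); first by rewrite ler_wpM2l ?ltW.
    by rewrite mulrDr hv lerD2l ler_piMr// ltW.
  rewrite ler_wpM2l// (_ : _ - _ = h *: (h^-1 *: v - rv c)).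
    by rewrite normrZ ger0_norm ?(ltW h0)// ler_wpM2l ?ltW.
  rewrite scalerBr scalerA divff ?gt_eqF// scale1r.
  by apply/matrixP => i j; rewrite !mxE; ring.
have H3 : `|dot D (fun j => rv c j 0) - dot (fun j => h^-1 * D j) (fun j => v j 0)|
    <= (\sum_j `|D j|) * eta.
  rewrite /dot -sumrB mulr_suml (le_trans (ler_norm_sum _ _ _))//.
  apply: ler_sum => j _; rewrite (_ : _ - _ = D j * (rv c - h^-1 *: v) j 0); last first.
    by rewrite !mxE; ring.
  rewrite normrM ler_wpM2l// (le_trans (norm_coord_le _ _ _))// distrC ltW//.
have H4 : p.+1%:R^-1 * `|rv c| <= e * `|v| + e * h * eta.
  apply: (@le_trans _ _ (e * h * (h^-1 * `|v| + eta))).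
    by apply: ler_pM => //; exact: ltW.
  by rewrite mulrDr -(mulrA e) mulrA !mulrA mulfK ?gt_eqF//.
rewrite -/D (_ : F x (y + v) - _ - _ = (F x (y + v) - F x (y + h *: rv c)) +
  (F x (y + h *: rv c) - F x y - dot D (fun j => rv c j 0)) +
  (dot D (fun j => rv c j 0) - dot (fun j => h^-1 * D j) (fun j => v j 0))); last by ring.
apply: (le_trans (ler_normD _ _)); apply: (le_trans (lerD (ler_normD _ _) (lexx _))).
apply: (le_trans (lerD (lerD H2 (le_trans H1 H4)) H3)).
rewrite [leLHS](_ : _ = e * `|v| + eta * K); last by rewrite /K; ring.
by rewrite lerD2l.
Qed.

End rademacher.

(** * Convex hulls and Caratheodory's theorem *)

Section convex_hull.
Context {R : realType} {V : lmodType R}.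
Implicit Types (S : set V) (s : V).

(** A prescribed number of points, as compactness and selection require; it is a successor since the
    weights of an empty combination cannot sum to one. *)
Definition chull_rep S (k : nat) s := exists (l : 'I_k.+1 -> R) (a : 'I_k.+1 -> V),
  (forall i, 0 <= l i) /\ \sum_i l i = 1 /\ (forall i, S (a i)) /\ s = \sum_i l i *: a i.

Lemma conv_hullP S s : conv_hull S s <-> exists k, chull_rep S k s.
Proof.
split=> [[m [l [a [l0 [l1 [Sa sE]]]]]]|[k [l [a H]]]]; last by exists k.+1, l, a.
case: m l a l0 l1 Sa sE => [|k] l a l0 l1 Sa sE; last by exists k, l, a.
by move: l1; rewrite big_ord0 => /eqP; rewrite eq_sym oner_eq0.
Qed.

Lemma chull_rep_extend S k s s' tau : chull_rep S k s -> S s' -> 0 <= tau <= 1 ->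
  chull_rep S k.+1 ((1 - tau) *: s + tau *: s').
Proof.
move=> [l [a [l0 [l1 [Sa ->]]]]] Ss' /andP[t0 t1].
exists (fun i => if unlift ord0 i is Some j then (1 - tau) * l j else tau).
exists (fun i => if unlift ord0 i is Some j then a j else s'); split.
  by move=> i; case: unliftP => [j _|_]//; rewrite mulr_ge0// subr_ge0.
split; first by rewrite big_ord_recl unlift_none; under eq_bigr do rewrite liftK;
  rewrite -mulr_sumr l1 mulr1 addrC subrK.
split; first by move=> i; case: unliftP => [j _|_].
rewrite [RHS]big_ord_recl unlift_none addrC; congr (_ + _).
by under [RHS]eq_bigr do rewrite liftK -scalerA; rewrite scaler_sumr.
Qed.

Lemma conv_hull_extend S s s' tau : conv_hull S s -> S s' -> 0 <= tau <= 1 ->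
  conv_hull S ((1 - tau) *: s + tau *: s').
Proof.
move=> /conv_hullP[k ks] Ss' t01; apply/conv_hullP; exists k.+1.
exact: chull_rep_extend.
Qed.

Lemma sub_conv_hull S s : S s -> conv_hull S s.
Proof.
move=> Ss; exists 1%N, (fun=> 1), (fun=> s).
by rewrite !big_ord1 scale1r; do !split.
Qed.

Lemma conv_hull_mono S S' s : S `<=` S' -> conv_hull S s -> conv_hull S' s.
Proof. by move=> SS' [m [l [a [l0 [l1 [Sa sE]]]]]]; exists m, l, a; split=> //; split=> //; split=> // i; exact/SS'. Qed.

End convex_hull.

Section caratheodory.
Context {R : realType} {n d : nat}.
Implicit Types (S : set 'M[R]_(n, d)) (s : 'M[R]_(n, d)).

(** Each matrix is flattened to a row and completed by an entry 1, so that a linear dependence of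
    the rows is an affine one. Its coefficients sum to zero without all vanishing, so one is
    positive. *)
Lemma affine_dependence k (a : 'I_k -> 'M[R]_(n, d)) : ((n * d).+1 < k)%N ->
  exists mu : 'I_k -> R,
    [/\ exists i, 0 < mu i, \sum_i mu i = 0 & \sum_i mu i *: a i = 0].
Proof.
move=> Nk.
pose X : 'M[R]_(k, n * d + 1) := \matrix_(i, j) (row_mx (mxvec (a i)) 1%:M) 0 j.
have nf : ~~ row_free X.
  by rewrite /row_free neq_ltn (leq_ltn_trans (rank_leq_col X))//= addn1.
have : kermx X != 0 by rewrite kermx_eq0.
move=> /rowV0Pn[mu /sub_kermxP muX mu0].
have XE j : \sum_i mu 0 i * X i j = 0.
  by have := congr1 (fun A : 'rV[R]_(n * d + 1) => A 0 j) muX; rewrite !mxE.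
have sum0 : \sum_i mu 0 i = 0.
  rewrite -[RHS](XE (rshift _ 0)); apply: eq_bigr => i _.
  by rewrite mxE row_mxEr mxE eqxx mulr1.
have suma : \sum_i mu 0 i *: a i = 0.
  apply/eqP; rewrite -(inj_eq (can_inj mxvecK)) linear0 linear_sum/=; apply/eqP.
  apply/matrixP => z j; rewrite ord1 summxE [RHS]mxE -[RHS](XE (lshift _ j)).
  by apply: eq_bigr => i _; rewrite linearZ/= [LHS]mxE; congr (_ * _); rewrite mxE row_mxEl.
have [i mui] : exists i, 0 < mu 0 i; last by exists (mu 0); split => //; exists i.
apply: contrapT => npos; move/negP: mu0; apply; apply/eqP/matrixP => z i.
rewrite ord1 [RHS]mxE.
have mule i' : mu 0 i' <= 0.
  by rewrite leNgt; apply/negP => h; apply: npos; exists i'.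
have := sum0; rewrite (bigD1 i)//= => /eqP.
have : \sum_(i0 < k | i0 != i) mu 0 i0 <= 0 by apply: sumr_le0.
move: (mule i); set r := \sum_(_ < _ | _) _; clearbody r => h1 h2 /eqP h3.
by apply/eqP; rewrite eq_le h1/=; lra.
Qed.

(** The weights move along an affine dependence until the first of them vanishes; the smallest ratio
    [l i / mu i] says how far this can go with all weights nonnegative. *)
Lemma chull_rep_reduce S k s : (n * d <= k)%N -> chull_rep S k.+1 s -> chull_rep S k s.
Proof.
move=> Nk [l [a [l0 [l1 [Sa sE]]]]].
have [mu [[i mui] mu0 mua]] := affine_dependence a (Nk : ((n * d).+1 < k.+2)%N).
have [i0 mu0i Hi0] := @arg_minP _ _ _ i (fun i => 0 < mu i) (fun i => l i / mu i) mui.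
pose tau := l i0 / mu i0.
have tau0 : 0 <= tau by rewrite divr_ge0// ltW.
pose l' j := l j - tau * mu j.
have l'0 j : 0 <= l' j.
  rewrite subr_ge0; have [muj|muj] := ltP 0 (mu j).
    by rewrite -ler_pdivlMr//; exact: Hi0.
  by apply: le_trans (l0 j); rewrite mulr_ge0_le0.
have l'i0 : l' i0 = 0 by rewrite /l' /tau divfK ?gt_eqF// subrr.
exists (fun j => l' (lift i0 j)), (fun j => a (lift i0 j)); split=> [j//|]; split.
  have : \sum_j l' j = 1 by rewrite /l' sumrB -mulr_sumr mu0 mulr0 subr0.
  by rewrite (bigD1_ord i0)//= l'i0 add0r.
split=> [j//|].
have : \sum_j l' j *: a j = s.
  rewrite /l'; under eq_bigr do rewrite scalerBl -scalerA.
  by rewrite sumrB -scaler_sumr mua scaler0 subr0.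
by rewrite (bigD1_ord i0)//= l'i0 scale0r add0r => <-.
Qed.

Lemma caratheodory S s : conv_hull S s -> chull_rep S (n * d) s.
Proof.
move=> /conv_hullP[k ks]; have [kN|Nk] := leqP k (n * d).
  (* With too few points, the combination is padded by a repeated point of weight 0. *)
  elim: (n * d)%N kN => [|N IH]; first by rewrite leqn0 => /eqP <-.
  rewrite leq_eqVlt => /predU1P[<-//|]; rewrite ltnS => /IH rN.
  have [l [a [_ [_ [Sa _]]]]] := rN.
  have := chull_rep_extend rN (Sa ord0) (_ : 0 <= 0 <= 1); rewrite lexx ler01.
  by rewrite subr0 scale1r scale0r addr0; apply.
elim: k Nk ks => // k IH; rewrite ltnS => Nk /(chull_rep_reduce Nk).
by move: Nk; rewrite leq_eqVlt => /predU1P[->//|]; exact: IH.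
Qed.

Lemma conv_hull_norm S s C : (forall s, S s -> `|s| <= C) -> conv_hull S s -> `|s| <= C.
Proof.
move=> SC [m [l [a [l0 [l1 [Sa ->]]]]]]; rewrite (le_trans (ler_norm_sum _ _ _))//.
apply: (@le_trans _ _ (\sum_(i < m) l i * C)); last by rewrite -mulr_suml l1 mul1r.
by apply: ler_sum => i _; rewrite normrZ ger0_norm// ler_wpM2l// SC.
Qed.

End caratheodory.

(** * Approximate separation from a convex hull *)

Section separation.
Context {R : realType} {n d : nat}.
Implicit Types (S : set 'M[R]_(n, d)) (A B C s : 'M[R]_(n, d)).

(** The Frobenius product: separation needs a quadratic distance, which the max norm does not
    provide. *)
Definition ip A B := \sum_i \sum_j A i j * B i j.

Lemma ipDr A B C : ip A (B + C) = ip A B + ip A C.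
Proof.
rewrite /ip -big_split/=; apply: eq_bigr => i _; rewrite -big_split/=.
by apply: eq_bigr => j _; rewrite mxE mulrDr.
Qed.

Lemma ipZr A c B : ip A (c *: B) = c * ip A B.
Proof.
rewrite /ip mulr_sumr; apply: eq_bigr => i _; rewrite mulr_sumr.
by apply: eq_bigr => j _; rewrite mxE mulrCA.
Qed.

Lemma ipC A B : ip A B = ip B A.
Proof. by apply: eq_bigr => i _; apply: eq_bigr => j _; rewrite mulrC. Qed.

Lemma ipBr A B C : ip A (B - C) = ip A B - ip A C.
Proof. by rewrite ipDr -scaleN1r ipZr mulN1r. Qed.

Lemma ip_sqrB t B C :
  ip (B - t *: C) (B - t *: C) = ip B B - 2 * t * ip B C + t ^+ 2 * ip C C.
Proof.
rewrite ipBr ipZr (ipC _ B) (ipC _ C) !ipBr !ipZr (ipC C B); ring.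
Qed.

Lemma ip_ge0 A : 0 <= ip A A.
Proof. by apply: sumr_ge0 => i _; apply: sumr_ge0 => j _; rewrite -expr2 sqr_ge0. Qed.

Lemma norm_sqr_le_ip A : `|A| ^+ 2 <= ip A A.
Proof.
rewrite -[leRHS]sqr_sqrtr ?ip_ge0// ler_pXn2r ?nnegrE ?sqrtr_ge0//.
apply: norm_le_coord => [|i j]; first exact: sqrtr_ge0.
rewrite -sqrtr_sqr ler_sqrt ?ip_ge0// /ip (bigD1 i)//= (bigD1 j)//= -expr2 -addrA lerDl.
rewrite addr_ge0//; last apply: sumr_ge0 => i' _; apply: sumr_ge0 => j' _; rewrite -expr2 sqr_ge0//.
Qed.

Lemma ip_le A B : ip A B <= (n * d)%:R * (`|A| * `|B|).
Proof.
apply: (@le_trans _ _ (\sum_(i < n) \sum_(j < d) (`|A| * `|B|))).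
  apply: ler_sum => i _; apply: ler_sum => j _; rewrite (le_trans (ler_norm _))// normrM.
  by rewrite ler_pM// norm_coord_le.
by rewrite !sumr_const !card_ord -mulrnA mulr_natl mulnC.
Qed.

(** The hull need not be closed, so an almost nearest point [s] replaces the projection. Moving from
    [s] towards a point of [S] can hardly shorten the distance to [A]; this gives a half-space
    containing [S], hence [A], which forces [A] to be close to [s]. *)
Lemma separation S A M e : (forall s, S s -> `|s| <= M) ->
  (forall B c, (forall s, S s -> ip B s <= c) -> ip B A <= c) ->
  0 < e -> exists s, conv_hull S s /\ `|A - s| < e.
Proof.
move=> SM sepA e0; apply: contrapT => nex.
have [s0 Ss0] : S !=set0.
  apply: contrapT => S0.
  (* An empty [S] would lie in the empty half-space given by [B = 0] and [c = -1]. *)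
  have : ip 0 A <= -1 by apply: sepA => s Ss; exfalso; apply: S0; exists s.
  by rewrite -(scale0r 0) ipC ipZr mul0r; lra.
have M0 : 0 <= M by apply: le_trans (SM _ Ss0).
pose dist2 s := ip (A - s) (A - s).
have dist2e s : conv_hull S s -> e ^+ 2 <= dist2 s.
  move=> Ks; apply: le_trans (norm_sqr_le_ip _); rewrite ler_pXn2r ?nnegrE ?(ltW e0)//.
  by rewrite leNgt; apply/negP => h; apply: nex; exists s.
pose delta := inf [set dist2 s | s in conv_hull S].
have hinf : has_inf [set dist2 s | s in conv_hull S].
  split; first by exists (dist2 s0); exists s0 => //; exact: sub_conv_hull.
  by exists (e ^+ 2) => _ [s Ks <-]; exact: dist2e.
pose D : R := (n * d)%:R * ((M + M) * (M + M)).
have D0 : 0 <= D by rewrite mulr_ge0// mulr_ge0// addr_ge0.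
pose tau := Num.min 1 (e ^+ 2 / (1 + D)).
have tau0 : 0 < tau by rewrite lt_min ltr01 divr_gt0// ?exprn_gt0// ltr_pwDl.
have tau1 : tau <= 1 by rewrite ge_min lexx.
have tauD : tau * (1 + D) <= e ^+ 2 by rewrite -ler_pdivlMr ?ltr_pwDl// ge_min lexx orbT.
(* The slack [tau ^+ 2] has the order of the quadratic term of a step [tau]; after division by [tau]
   an error of at most [e ^+ 2 / 2] is left. *)
have [_ [s Ks <-] Hs] : exists2 r, [set dist2 s | s in conv_hull S] r & r < delta + tau ^+ 2.
  by apply: inf_adherent => //; rewrite exprn_gt0.
have key s' : S s' -> ip (A - s) s' <= ip (A - s) s + tau * (1 + D) / 2.
  move=> Ss'; have := conv_hull_extend Ks Ss' (_ : 0 <= tau <= 1).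
  rewrite (ltW tau0) tau1 => /(_ isT) Kt.
  have : delta <= dist2 ((1 - tau) *: s + tau *: s').
    by apply: ge_inf; [exact: hinf.2|exists ((1 - tau) *: s + tau *: s')].
  have -> : dist2 ((1 - tau) *: s + tau *: s') =
      dist2 s - 2 * tau * ip (A - s) (s' - s) + tau ^+ 2 * ip (s' - s) (s' - s).
    rewrite /dist2 (_ : A - _ = (A - s) - tau *: (s' - s)); last first.
      by apply/matrixP => i j; rewrite !mxE; ring.
    exact: ip_sqrB.
  have Dle : ip (s' - s) (s' - s) <= D.
    apply: (le_trans (ip_le _ _)); rewrite ler_wpM2l//.
    have : `|s' - s| <= M + M.
      by apply: (le_trans (ler_normB _ _)); apply: lerD; [exact: SM|exact: conv_hull_norm SM Ks].
    by move=> h; rewrite ler_pM.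
  rewrite ipBr; set p := ip (A - s) s'; set q := ip (A - s) s.
  move: Hs Dle; set r := dist2 s; set t := ip (s' - s) _; move=> Hs Dle Hd.
  have h1 : 2 * tau * (p - q) <= tau ^+ 2 * (1 + t).
    by move: Hs Hd; clear; clearbody p q r t delta tau; lra.
  have h2 : tau * (2 * (p - q)) <= tau * (tau * (1 + D)).
    rewrite (le_trans _ (_ : tau ^+ 2 * (1 + t) <= _))//; first by move: h1; lra.
    by rewrite expr2 mulrA ler_wpM2l ?mulr_ge0 ?(ltW tau0)// lerD2l.
  by move: h2; rewrite ler_pM2l//; lra.
have := sepA _ _ key; rewrite -lerBlDl -ipBr => h.
have := dist2e _ Ks; rewrite /dist2 => h'.
have : 0 < e ^+ 2 by rewrite exprn_gt0.
lra.
Qed.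

End separation.

(** * Subsequences, Jacobians and their limits *)

Lemma increasing_seq_ge (f : nat -> nat) k : increasing_seq f -> (k <= f k)%N.
Proof.
move=> fi; elim: k => // k IH; apply: (leq_ltn_trans IH).
by have := fi k.+1 k; rewrite !leEnat ltnn ltnNge => ->.
Qed.

Lemma cvg_subsequence (X : topologicalType) (u : nat -> X) (l : X) (f : nat -> nat) :
  increasing_seq f -> u @ \oo --> l -> (u \o f) @ \oo --> l.
Proof.
move=> fi ul; apply: (cvg_comp _ _ _ ul) => A [N _ NA].
by exists N => // k /= Nk; apply: NA => /=; exact: leq_trans (increasing_seq_ge k fi).
Qed.

Lemma bounded_subsequence (R : realType) (I : finType) (u : nat -> I -> R) (M : R) :
  (forall k i, `|u k i| <= M) ->
  exists (f : nat -> nat) (w : I -> R), increasing_seq f /\ forall i, u (f k) i @[k --> \oo] --> w i.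
Proof.
move=> uM.
suff H (s : seq I) : exists f : nat -> nat, increasing_seq f /\
    forall i, i \in s -> cvgn (fun k => u (f k) i).
  have [f [fi Hf]] := H (enum I).
  exists f, (fun i => limn (fun k => u (f k) i)); split => // i.
  by apply: Hf; rewrite mem_enum.
elim: s => [|i s [f [fi Hf]]]; first by exists id.
have [|g gi Hg] := @bolzano_weierstrass R (fun k => u (f k) i).
  exists M; split; first exact: num_real.
  by move=> N MN k _; exact: le_trans (uM _ _) (ltW MN).
exists (f \o g); split; first by move=> a b /=; exact: etrans (fi _ _) (gi _ _).
move=> j; rewrite in_cons => /predU1P[->//|/Hf].
by move=> /cvg_ex[l ul]; apply/cvg_ex; exists l; exact: cvg_subsequence ul.
Qed.

Section jacobian.
Context {R : realType} {d n : nat}.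
Implicit Types (f : 'cV[R]_d -> 'cV[R]_n) (z v : 'cV[R]_d) (M : 'M[R]_(n, d)).

Lemma norm_mulmx_le M v : `|M *m v| <= d%:R * (`|M| * `|v|).
Proof.
apply: norm_le_coord => [|i j]; first by rewrite !mulr_ge0.
rewrite mxE (le_trans (ler_norm_sum _ _ _))//.
apply: (@le_trans _ _ (\sum_(k < d) (`|M| * `|v|))).
  by apply: ler_sum => k _; rewrite normrM ler_pM// norm_coord_le.
by rewrite sumr_const card_ord mulr_natl.
Qed.

Lemma mulmx_continuous M : continuous ((mulmx M : {linear 'cV[R]_d -> 'cV[R]_n}) : 'cV[R]_d -> 'cV[R]_n).
Proof.
move=> v; apply/(@cvgrPdist_le _ _ _ (nbhs v) (nbhs_filter v)) => e e0.
have K0 : 0 < d%:R * `|M| + 1 by rewrite ltr_wpDl// mulr_ge0.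
have := nbhsx_ballx v (e / (d%:R * `|M| + 1)) (divr_gt0 e0 K0).
apply: filterS => v'; rewrite -ball_normE /= => vv'.
rewrite -mulmxBr (le_trans (norm_mulmx_le _ _))// mulrA.
apply: (@le_trans _ _ ((d%:R * `|M| + 1) * `|v - v'|)).
  by rewrite ler_wpM2r// lerDl.
by rewrite mulrC -ler_pdivlMr// ltW.
Qed.

Lemma is_jacobianP f z M : is_jacobian f z M <->
  forall e, 0 < e -> exists delta, 0 < delta /\ forall v, `|v| < delta ->
    `|f (z + v) - f z - M *m v| <= e * `|v|.
Proof.
split=> [[df dE] e e0|H].
  have := diff_locally df => /eqaddoP/(_ _ e0)/nbhs_ballP[delta /= delta0 Hd].
  exists delta; split => // v vd; have := Hd v.
  rewrite -ball_normE /= sub0r normrN => /(_ vd).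
  by rewrite /cst/= -[X in `|X|]/(f (v + z) - (f z + 'd f z v)) dE opprD addrA (addrC v).
pose df : {linear 'cV[R]_d -> 'cV[R]_n} := mulmx M.
have E : f \o shift z = cst (f z) + df +o_ (0 : 'cV[R]_d) id.
  apply/eqaddoP => e e0; have [delta [delta0 Hd]] := H e e0.
  apply/nbhs_ballP; exists delta => // v; rewrite -ball_normE /= sub0r normrN => /Hd.
  by rewrite /cst/= -[X in _ -> is_true (`|X| <= _)]/(f (v + z) - (f z + M *m v))
    opprD addrA (addrC v).
have cdf : continuous df by exact: mulmx_continuous.
have dE := diff_unique cdf E.
split; last by move=> w; rewrite dE.
by apply/diff_locallyP; rewrite dE; split; [exact: cdf|exact: E].
Qed.

Definition lip_balls f := forall r, exists L, 0 <= L /\ forall y z,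
  `|y| <= r -> `|z| <= r -> `|f y - f z| <= L * `|y - z|.

(** Small increments along unit vectors bound each entry by the Lipschitz constant; the ball is
    enlarged by 1 to contain them. *)
Lemma jacobian_bounded f r : lip_balls f -> exists C, forall y M,
  `|y| <= r -> is_jacobian f y M -> `|M| <= C.
Proof.
move=> fL; have [L [L0 HL]] := fL (r + 1); exists L => y M yr /is_jacobianP jM.
apply: norm_le_coord => // i j; apply/ler_addgt0Pr => e e0.
have [delta [delta0 Hd]] := jM e e0.
pose h := Num.min 1 (delta / 2).
have h0 : 0 < h by rewrite lt_min ltr01 divr_gt0.
have h1 : h <= 1 by rewrite ge_min lexx.
have hd : h < delta.
  by rewrite gt_min ltr_pdivrMr// ltr_pMr// ltr1n orbT.
pose v : 'cV[R]_d := basis h j.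
have nv : `|v| <= h.
  apply: norm_le_coord => [|k l]; first exact: ltW.
  rewrite !mxE; case: (_ && _); rewrite ?mulr1 ?mulr0 ?normr0 ?(ltW h0)//.
  by rewrite ger0_norm// ltW.
have Mv : (M *m v) i 0 = h * M i j.
  rewrite mxE (bigD1 j)//= !mxE !eqxx mulr1 big1 ?addr0 1?mulrC// => k kj.
  by rewrite !mxE (negbTE kj) mulr0 mulr0.
rewrite -(ler_pM2l h0) -[X in X * _](ger0_norm (ltW h0)) -normrM -Mv.
rewrite -[M *m v](subrK (f (y + v) - f y)).
apply: (le_trans (norm_coord_le _ i 0)); apply: (le_trans (ler_normD _ _)).
rewrite addrC mulrDr lerD//.
  apply: (le_trans (HL _ _ _ _)).
  - by rewrite (le_trans (ler_normD _ _))// lerD// (le_trans nv).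
  - by rewrite (le_trans yr)// lerDl.
  by rewrite addrAC subrr add0r mulrC ler_wpM2r.
by rewrite distrC (le_trans (Hd _ (le_lt_trans nv hd)))// mulrC ler_wpM2r// ltW.
Qed.

Definition near_jacobians f (a b : 'cV[R]_d) (e : R) : set 'M[R]_(n, d) :=
  [set M | exists t y, 0 <= t <= 1 /\ `|y - (a + t *: (b - a))| < e /\ is_jacobian f y M].

Definition limiting_segment f (a b : 'cV[R]_d) : set 'M[R]_(n, d) :=
  [set M | exists t : R, 0 <= t <= 1 /\ limiting_jacobians f (a + t *: (b - a)) M].

Lemma seg_norm (a b : 'cV[R]_d) t : 0 <= t <= 1 -> `|a + t *: (b - a)| <= `|a| + `|b|.
Proof.
move=> /andP[t0 t1]; rewrite (_ : a + _ = (1 - t) *: a + t *: b); last first.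
  by apply/matrixP => i j; rewrite !mxE; ring.
rewrite (le_trans (ler_normD _ _))// !normrZ !ger0_norm ?subr_ge0//.
by rewrite lerD// ler_piMl// gerBl.
Qed.

Lemma near_jacobians_bounded f a b : lip_balls f -> exists C, forall e M,
  e <= 1 -> near_jacobians f a b e M -> `|M| <= C.
Proof.
move=> fL; have [C HC] := jacobian_bounded (`|a| + `|b| + 1) fL; exists C.
move=> e M e1 [t [y [t01 [ye jM]]]]; apply: HC jM.
rewrite -[y](subrK (a + t *: (b - a))) addrC (le_trans (ler_normD _ _))//.
by rewrite lerD ?seg_norm// (le_trans (ltW ye)).
Qed.

Lemma cvg_mx (p q : nat) (u : nat -> 'M[R]_(p, q)) (l : 'M[R]_(p, q)) :
  (forall i j, u k i j @[k --> \oo] --> l i j) -> u @ \oo --> l.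
Proof.
move=> H; apply/cvgrPdist_lt => e e0.
have H' (ij : 'I_p * 'I_q) : \forall k \near \oo, `|l ij.1 ij.2 - u k ij.1 ij.2| < e.
  by have /cvgrPdist_lt/(_ _ e0) := H ij.1 ij.2.
have : \forall k \near \oo, forall ij : 'I_p * 'I_q, `|l ij.1 ij.2 - u k ij.1 ij.2| < e.
  exact: filter_forall.
apply: filterS => k Hk.
by apply: norm_lt_coord => // i j; have := Hk (i, j); rewrite !mxE.
Qed.

(** By Caratheodory's theorem the number of terms does not depend on [k], so weights, parameters on
    the segment and matrices form a bounded sequence in a fixed finite dimension. The
    differentiability points need not be extracted: they follow the parameters at distance less than
    [k.+1%:R^-1]. *)
Lemma limiting_compact f a b (A : nat -> 'M[R]_(n, d)) : lip_balls f ->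
  (forall k, conv_hull (near_jacobians f a b k.+1%:R^-1) (A k)) ->
  exists A' : 'M[R]_(n, d), conv_hull (limiting_segment f a b) A' /\
    exists s : nat -> nat, increasing_seq s /\ A \o s @ \oo --> A'.
Proof.
move=> fL HA.
have [C HC] := near_jacobians_bounded a b fL.
have H k : exists q : (('I_(n * d).+1 -> R) * ('I_(n * d).+1 -> 'M[R]_(n, d))) *
    (('I_(n * d).+1 -> R) * ('I_(n * d).+1 -> 'cV[R]_d)),
    [/\ forall i, 0 <= q.1.1 i, \sum_i q.1.1 i = 1, A k = \sum_i q.1.1 i *: q.1.2 i &
    forall i, 0 <= q.2.1 i <= 1 /\ `|q.2.2 i - (a + q.2.1 i *: (b - a))| < k.+1%:R^-1 /\
      is_jacobian f (q.2.2 i) (q.1.2 i)].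
  have [l [M [l0 [l1 [SM AE]]]]] := caratheodory (HA k).
  have [t Ht] := choice SM; have [y Hy] := choice Ht.
  by exists ((l, M), (t, y)).
have [q Hq] := choice H.
pose I := ('I_(n * d).+1 * (bool + 'I_n * 'I_d))%type.
pose u (k : nat) (i : I) : R := match i.2 with
  | inl true => (q k).1.1 i.1 | inl false => (q k).2.1 i.1
  | inr kj => (q k).1.2 i.1 kj.1 kj.2 end.
have uM k i : `|u k i| <= Num.max 1 C.
  have [l0 l1 _ Hy] := Hq k; case: i => i [[]|[j1 j2]]; rewrite /u/= le_max.
  - rewrite ger0_norm// -l1 (bigD1 i)//= lerDl sumr_ge0//.
  - by have [/andP[t0 t1] _] := Hy i; rewrite ger0_norm// t1.
  - apply/orP; right; rewrite (le_trans (norm_coord_le _ _ _))//.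
    have [t01 [ye jM]] := Hy i.
    apply: (HC k.+1%:R^-1); first by rewrite invf_le1// ler1n.
    by exists ((q k).2.1 i), ((q k).2.2 i).
have [s [w [si Hw]]] := bounded_subsequence uM.
pose l i := w (i, inl true); pose t i := w (i, inl false).
pose M i : 'M[R]_(n, d) := \matrix_(j1, j2) w (i, inr (j1, j2)).
have Ml i : (q (s k)).1.2 i @[k --> \oo] --> M i.
  by apply: cvg_mx => j1 j2; rewrite mxE; exact: (Hw (i, inr (j1, j2))).
have yE k i := (let: And4 _ _ _ Hy := Hq k in Hy i).
have ti i : (q (s k)).2.1 i @[k --> \oo] --> t i by exact: (Hw (i, inl false)).
have li i : (q (s k)).1.1 i @[k --> \oo] --> l i by exact: (Hw (i, inl true)).
have t01 i : 0 <= t i <= 1.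
  apply/andP; split.
    by apply: (cvgr_to_ge (ti i)); near=> k; have [/andP[]] := yE (s k) i.
  by apply: (cvgr_to_le (ti i)); near=> k; have [/andP[]] := yE (s k) i.
exists (\sum_i l i *: M i); split.
  exists (n * d).+1, l, M; split.
    by move=> i; apply: (cvgr_to_ge (li i)); near=> k; have [] := Hq (s k).
  split.
    have : (\sum_i (q (s k)).1.1 i) @[k --> \oo] --> \sum_i l i.
      by apply: cvg_big => //; exact: add_continuous.
    rewrite (_ : (fun _ => _) = fun=> 1); first by move=> h; apply: (cvg_unique _ h (cvg_cst _)); exact: Rhausdorff.
    by apply/funext => k; have [] := Hq (s k).
  split=> [i|//]; exists (t i); split => //.
  exists (fun k => (q (s k)).2.2 i), (fun k => (q (s k)).1.2 i); split; last first.
    by split=> // k; have [_ []] := yE (s k) i.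
  apply/cvgrPdist_lt => e e0.
  have K0 : 0 < `|b - a| + 1 by rewrite ltr_wpDl.
  have e2 : 0 < e / 2 by rewrite divr_gt0.
  have /cvgrPdist_lt/(_ _ (divr_gt0 e2 K0)) Hti := ti i.
  near=> k.
  have [_ [ye _]] := yE (s k) i.
  rewrite (_ : a + _ - _ = (t i - (q (s k)).2.1 i) *: (b - a) -
    ((q (s k)).2.2 i - (a + (q (s k)).2.1 i *: (b - a)))); last first.
    by apply/matrixP => j1 j2; rewrite !mxE; ring.
  rewrite (le_lt_trans (ler_normB _ _))// (splitr e) ler_ltD//.
    rewrite normrZ; apply: (@le_trans _ _ (`|t i - (q (s k)).2.1 i| * (`|b - a| + 1))).
      by rewrite ler_wpM2l// lerDl.
    by rewrite -ler_pdivlMr// ltW//; near: k.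
  apply: (lt_le_trans ye); apply: (@le_trans _ _ k.+1%:R^-1).
    by rewrite lef_pV2 ?posrE// ler_nat ltnS increasing_seq_ge.
  by apply: ltW; near: k; exact: (near_infty_natSinv_lt (PosNum e2)).
exists s; split => //.
rewrite (_ : A \o s = fun k => \sum_i (q (s k)).1.1 i *: (q (s k)).1.2 i); last first.
  by apply/funext => k /=; have [_ _ -> _] := Hq (s k).
apply: cvg_mx => j1 j2; rewrite summxE.
under eq_fun do rewrite summxE.
apply: cvg_big => //; first exact: add_continuous.
move=> i _; rewrite !mxE; under eq_fun do rewrite !mxE.
by apply: cvgM => //; exact: (Hw (i, inr (j1, j2))).
Unshelve. all: by end_near. Qed.

End jacobian.

Lemma uniform_delta (R : realType) (I : finType) (P : I -> R -> Prop) :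
  (forall i, exists e, 0 < e /\ forall x, x < e -> P i x) ->
  exists e, 0 < e /\ forall i x, x < e -> P i x.
Proof.
move=> H; have [f Hf] := choice H.
exists (\big[Num.min/1]_i f i); split.
  by apply/bigmin_gtP; split => // i _; have [] := Hf i.
by move=> i x xe; have [_] := Hf i; apply; apply: (lt_le_trans xe); exact: bigmin_le_cond.
Qed.

(** Otherwise pairs in the ball with difference quotients above every [k] subconverge to some [y]
    and [z]. If [y = z], the local bound there is violated; if not, increments stay bounded and
    distances stay away from zero. *)
Lemma locally_lipschitz_lip_balls (R : realType) (d n : nat) (f : 'cV[R]_d -> 'cV[R]_n) :
  (forall z, exists r : R, exists L : R, 0 < r /\
     forall a b : 'cV[R]_d, `|a - z| < r -> `|b - z| < r -> `|f a - f b| <= L * `|a - b|) ->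
  lip_balls f.
Proof.
move=> fL r; apply: contrapT => nL.
have H (k : nat) : exists q : 'cV[R]_d * 'cV[R]_d,
    [/\ `|q.1| <= r, `|q.2| <= r & k%:R * `|q.1 - q.2| < `|f q.1 - f q.2|].
  apply: contrapT => nq; apply: nL; exists k%:R; split => // y z yr zr.
  by rewrite leNgt; apply/negP => h; apply: nq; exists (y, z).
have [q Hq] := choice H.
pose u k (i : 'I_d + 'I_d) : R := match i with inl j => (q k).1 j 0 | inr j => (q k).2 j 0 end.
have uM k i : `|u k i| <= r.
  by have [h1 h2 _] := Hq k; case: i => j; apply: (le_trans (norm_coord_le _ _ _)).
have [s [w [si Hw]]] := bounded_subsequence uM.
pose y : 'cV[R]_d := \col_j w (inl j); pose z : 'cV[R]_d := \col_j w (inr j).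
have cy : (fun k => (q (s k)).1) @ \oo --> y.
  by apply: cvg_mx => i j; rewrite ord1 mxE; exact: (Hw (inl i)).
have cz : (fun k => (q (s k)).2) @ \oo --> z.
  by apply: cvg_mx => i j; rewrite ord1 mxE; exact: (Hw (inr i)).
have [ry [Ly [ry0 HLy]]] := fL y.
have [rz [Lz [rz0 HLz]]] := fL z.
have near_y e : 0 < e -> \forall k \near \oo, `|(q (s k)).1 - y| < e.
  by move=> e0; have /cvgrPdist_lt/(_ _ e0) := cy; apply: filterS => k; rewrite distrC.
have near_z e : 0 < e -> \forall k \near \oo, `|(q (s k)).2 - z| < e.
  by move=> e0; have /cvgrPdist_lt/(_ _ e0) := cz; apply: filterS => k; rewrite distrC.
have big (C : R) : \forall k \near \oo, C < (s k)%:R.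
  have [N _ HN] := nbhs_infty_gtr C; exists N => // k /= Nk; apply: HN => /=.
  exact: leq_trans (increasing_seq_ge k si).
have [yz|yz] := eqVneq y z.
  near \oo => k.
  have [_ _] := Hq (s k); apply/negP; rewrite -leNgt.
  have h1 : `|(q (s k)).1 - y| < ry by near: k; exact: near_y.
  have h2 : `|(q (s k)).2 - y| < ry by rewrite yz; near: k; exact: near_z.
  apply: (le_trans (HLy _ _ h1 h2)); rewrite ler_wpM2r//; apply: ltW.
  by near: k; exact: big.
have del0 : 0 < `|y - z| by rewrite normr_gt0 subr_eq0.
pose C := `|Ly| * ry + `|f y - f z| + `|Lz| * rz.
have e4 : 0 < `|y - z| / 4 by rewrite divr_gt0.
near \oo => k.
have [_ _] := Hq (s k); apply/negP; rewrite -leNgt.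
have h1 : `|(q (s k)).1 - y| < ry by near: k; exact: near_y.
have h2 : `|(q (s k)).2 - z| < rz by near: k; exact: near_z.
have h3 : `|(q (s k)).1 - y| < `|y - z| / 4 by near: k; exact: near_y.
have h4 : `|(q (s k)).2 - z| < `|y - z| / 4 by near: k; exact: near_z.
have h5 : C / (`|y - z| / 2) < (s k)%:R by near: k; exact: big.
have h6 : `|y - z| / 2 <= `|(q (s k)).1 - (q (s k)).2|.
  have : `|y - z| <= `|(q (s k)).1 - y| + `|(q (s k)).1 - (q (s k)).2| + `|(q (s k)).2 - z|.
    rewrite (_ : y - z = - ((q (s k)).1 - y) + ((q (s k)).1 - (q (s k)).2) + ((q (s k)).2 - z)).
      by apply: (le_trans (ler_normD _ _)); rewrite lerD2r -[X in _ <= X + _]normrN ler_normD.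
    by apply/matrixP => i j; rewrite !mxE; ring.
  by move: h3 h4; lra.
have h7 : `|f (q (s k)).1 - f (q (s k)).2| <= C.
  rewrite (_ : _ - _ = (f (q (s k)).1 - f y) + (f y - f z) - (f (q (s k)).2 - f z)); last first.
    by apply/matrixP => i j; rewrite !mxE; ring.
  apply: (le_trans (ler_normB _ _)); apply: lerD; last first.
    apply: (le_trans (HLz _ _ h2 _)); first by rewrite subrr normr0.
    apply: (@le_trans _ _ (`|Lz| * `|(q (s k)).2 - z|)); first by rewrite ler_wpM2r// ler_norm.
    by rewrite ler_wpM2l// ltW.
  apply: (le_trans (ler_normD _ _)); rewrite lerD2r.
  apply: (le_trans (HLy _ _ h1 _)); first by rewrite subrr normr0.
  apply: (@le_trans _ _ (`|Ly| * `|(q (s k)).1 - y|)); first by rewrite ler_wpM2r// ler_norm.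
  by rewrite ler_wpM2l// ltW.
apply: (le_trans h7); move: h5; rewrite ltr_pdivrMr ?divr_gt0// => h5.
by apply: (le_trans (ltW h5)); rewrite ler_wpM2l.
Unshelve. all: by end_near. Qed.

(** * Cube averages of the Jacobian and the mean value inclusion *)

Section Q_matrix.
Context {R : realType} {d0 : measure_display} {T : measurableType d0} {d n : nat}.
Context (H : T -> 'cV[R]_d -> 'cV[R]_n).
Implicit Types (x : T) (y v : 'cV[R]_d) (h : R).

Definition component (k : 'I_n) : T -> 'cV[R]_d -> R := fun x y => H x y k 0.

Hypothesis mH : forall k, jmeas (component k).
Hypothesis lH : forall x, lip_balls (H x).

Lemma comp_lipb k : lipb (component k).
Proof.
move=> x r; have [L [_ HL]] := lH x r; exists L => y z yr zr.
by have := norm_coord_le (H x y - H x z) k 0; rewrite !mxE => /le_trans; apply; exact: HL.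
Qed.

Lemma comp_jlb k : jlb (component k).
Proof. by split; [exact: mH|exact/lipb_lbounded/comp_lipb]. Qed.

Definition cube h : seq 'cV[R]_d := [seq basis h j | j <- enum 'I_d].

Lemma basis_cube h i : basis h i \in cube h.
Proof. by apply: map_f; rewrite mem_enum. Qed.

Lemma norm_basis h i : 0 <= h -> `|basis h i : 'cV[R]_d| <= h.
Proof.
move=> h0; apply: norm_le_coord => // j k; rewrite !mxE.
by case: (_ && _); rewrite ?mulr1 ?mulr0 ?normr0// ger0_norm.
Qed.

Lemma cube_norm h : 0 <= h -> \sum_(w <- cube h) `|w| <= d%:R * h.
Proof.
move=> h0; rewrite big_map big_enum/=.
apply: (@le_trans _ _ (\sum_(j < d) h)); first by apply: ler_sum => j _; exact: norm_basis.
by rewrite sumr_const card_ord mulr_natl.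
Qed.

Definition gap (w : 'cV[R]_d) k x y := component k x (y + w) - component k x y.

Lemma gap_jlb w k : jlb (gap w k).
Proof. by apply: jlbB; [apply: jlb_shift|]; exact: comp_jlb. Qed.

Lemma gap_avg w k : gap w k = avg w (dder w (component k)).
Proof.
apply/funext => x; apply/funext => y.
by have [] := dder_FTC w x y (mH k) (comp_lipb k).
Qed.

(* Average over the cube [y + [0, h]^d] of the Jacobian of [H x], in a form where only
   the values of [H] occur. *)
Definition Qmx h x y : 'M[R]_(n, d) :=
  \matrix_(k, j) (h^-1 * avgs (rem (basis h j) (cube h)) (gap (basis h j) k) x y).

Lemma Qmx_jlb h k j : jlb (fun x y => Qmx h x y k j).
Proof.
under [X in jlb X]eq_fun do under eq_fun do rewrite mxE.
by apply: jlbZ; apply: jlb_avgs; exact: gap_jlb.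
Qed.

(** The increment along [basis h j] is itself the average of the derivative in this direction, which
    restores the direction removed from the cube. *)
Lemma QmxE h x y k j :
  Qmx h x y k j = h^-1 * avgs (cube h) (dder (basis h j) (component k)) x y.
Proof.
rewrite mxE gap_avg (@avgs_rem _ _ _ _ (dder _ _) (basis h j))//.
  by apply: jlb_dder => //; exact: comp_lipb.
exact: basis_cube.
Qed.

Lemma sum_rem_norm (w : 'cV[R]_d) (ws : seq 'cV[R]_d) :
  \sum_(v <- rem w ws) `|v| <= \sum_(v <- ws) `|v|.
Proof.
elim: ws => [|v ws IH] //=; case: eqP => _; first by rewrite big_cons lerDr.
by rewrite !big_cons lerD2l.
Qed.

Lemma avgs_near (F : T -> 'cV[R]_d -> R) ws x y c e : jlb F ->
  (forall y', `|y' - y| <= \sum_(w <- ws) `|w| -> `|F x y' - c| <= e) ->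
  `|avgs ws F x y - c| <= e.
Proof.
move=> jF Fe; rewrite ler_distl; apply/andP; split.
  rewrite -(avgs_cst (c - e) ws x y); apply: avgs_le => //; first exact: jlb_cst.
  by move=> y' /Fe; rewrite ler_distl => /andP[].
rewrite -(avgs_cst (c + e) ws x y); apply: avgs_le => //; first exact: jlb_cst.
by move=> y' /Fe; rewrite ler_distl => /andP[].
Qed.

(** The constant [h^-1 * (2 * L)] comes from the two values of [H] in an increment. It blows up as
    [h] tends to zero, so [delta] depends on [h] and the scale must be fixed before the point is
    moved. *)
Lemma Qmx_continuous h x y e : 0 < h -> 0 < e -> exists delta, 0 < delta /\
  forall v, `|v| < delta -> `|Qmx h x (y + v) - Qmx h x y| <= e.
Proof.
move=> h0 e0.
have [L [L0 HL]] := lH x (`|y| + d%:R * h + h + 1).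
pose K := h^-1 * (2 * L).
have K0 : 0 <= K by rewrite mulr_ge0 ?mulr_ge0// invr_ge0 ltW.
exists (Num.min 1 (e / (K + 1))); split.
  by rewrite lt_min ltr01 divr_gt0// ltr_wpDl.
move=> v; rewrite lt_min => /andP[v1 ve].
apply: norm_le_coord => [|k j]; first exact: ltW.
rewrite mxE [X in `|X + _|]mxE [X in `|_ + X|]mxE [X in `|_ - X|]mxE -mulrBr normrM.
rewrite ger0_norm ?invr_ge0 ?(ltW h0)//.
set ws := rem _ _; set F := gap _ _.
have jF : jlb F by exact: gap_jlb.
have -> : avgs ws F x (y + v) - avgs ws F x y =
    avgs ws (fun x y => F x (y + v) - F x y) x y.
  by rewrite avgsB ?avgs_shift//; exact: jlb_shift.
have key : `|avgs ws (fun x y => F x (y + v) - F x y) x y - 0| <= 2 * L * `|v|.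
  apply: avgs_near => [|y' yy']; first by apply: jlbB => //; exact: jlb_shift.
  have y'r : `|y'| <= `|y| + d%:R * h.
    rewrite -[y'](subrK y) addrC (le_trans (ler_normD _ _))// lerD2l (le_trans yy')//.
    by rewrite (le_trans (sum_rem_norm _ _))// cube_norm// ltW.
  have bh := norm_basis j (ltW h0).
  have hx (c : 'I_n) a b : `|a| <= `|y| + d%:R * h + h + 1 -> `|b| <= `|y| + d%:R * h + h + 1 ->
      `|component c x a - component c x b| <= L * `|a - b|.
    move=> ar br; have := norm_coord_le (H x a - H x b) c 0.
    by rewrite !mxE => /le_trans; apply; exact: HL.
  rewrite subr0 /F /gap.
  rewrite (_ : _ - _ = (component k x (y' + v + basis h j) - component k x (y' + basis h j)) -
    (component k x (y' + v) - component k x y')); last by ring.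
  apply: (le_trans (ler_normB _ _)); rewrite -mulrA mulr_natl mulr2n lerD//.
    apply: (le_trans (hx _ _ _ _ _)).
    - rewrite (le_trans (ler_normD _ _))// (le_trans (lerD (ler_normD _ _) bh))//.
      by move: y'r v1; lra.
    - by rewrite (le_trans (ler_normD _ _))//; move: y'r bh; lra.
    by rewrite (_ : _ - _ = v)//; apply/matrixP => a b; rewrite !mxE; ring.
  apply: (le_trans (hx _ _ _ _ _)).
  - by rewrite (le_trans (ler_normD _ _))//; move: y'r v1 h0; lra.
  - by move: y'r h0; lra.
  by rewrite addrAC subrr add0r.
rewrite subr0 in key; apply: (@le_trans _ _ (K * `|v|)).
  by rewrite /K -mulrA ler_wpM2l// invr_ge0 ltW.
apply: (@le_trans _ _ ((K + 1) * `|v|)); first by rewrite ler_wpM2r// lerDl.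
by rewrite mulrC -ler_pdivlMr ?ltr_wpDl// ltW.
Qed.

Definition diffpt h x y := forall k, diff_upto (component k) h d x y.

Definition Jmx h x y : 'M[R]_(n, d) := \matrix_(k, j) (h^-1 * pdiff (component k) h x y j).

Lemma diffpt_jacobian h x y : 0 < h -> diffpt h x y -> is_jacobian (H x) y (Jmx h x y).
Proof.
move=> h0 D; apply/is_jacobianP => e e0.
have Hk k : exists delta, 0 < delta /\ forall r, r < delta -> forall v, `|v| <= r ->
    `|component k x (y + v) - component k x y - dot (fun j => h^-1 * pdiff (component k) h x y j)
      (fun j => v j 0)| <= e * `|v|.
  have [del [del0 Hd]] := diff_uptoP h0 (comp_lipb k) (D k) e0.
  by exists del; split => // r rd v vr; apply: Hd; exact: le_lt_trans vr rd.
have [delta [delta0 Hd]] := uniform_delta Hk.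
exists delta; split => // v vd; apply: norm_le_coord => [|k j].
  by rewrite mulr_ge0// ltW.
have := Hd k _ vd v (lexx _); rewrite ord1 !mxE /dot /component.
by under [X in _ -> is_true (`|_ - X| <= _)]eq_bigr do rewrite mxE.
Qed.

(** Over the cube the increments are those of the linear map [M] up to [e / K] times displacements
    of size at most [d%:R * h + h] and [d%:R * h]; their sum is [K * h]. *)
Lemma Qmx_limit x y M : is_jacobian (H x) y M -> forall e, 0 < e ->
  exists delta, 0 < delta /\ forall h, 0 < h < delta -> `|Qmx h x y - M| <= e.
Proof.
move=> /is_jacobianP jM e e0.
pose K : R := d%:R + d%:R + 1.
have K0 : 0 < K by rewrite ltr_wpDl// addr_ge0.
have [delta [delta0 Hd]] := jM (e / K) (divr_gt0 e0 K0).
have d10 : 0 < d.+2%:R :> R by [].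
exists (delta / d.+2%:R); split; first by rewrite divr_gt0.
move=> h /andP[h0]; rewrite ltr_pdivlMr// => hd.
apply: norm_le_coord => [|k j]; first exact: ltW.
have Mb (v : 'cV[R]_d) : (M *m (v + basis h j)) k 0 = (M *m v) k 0 + h * M k j.
  rewrite mulmxDr mxE; congr (_ + _).
  rewrite mxE (bigD1 j)//= !mxE !eqxx mulr1 big1 ?addr0 1?mulrC// => l lj.
  by rewrite !mxE (negbTE lj) mulr0 mulr0.
have Hc v : `|v| < delta ->
    `|component k x (y + v) - component k x y - (M *m v) k 0| <= e / K * `|v|.
  move=> /Hd; apply: le_trans.
  by have := norm_coord_le (H x (y + v) - H x y - M *m v) k 0; rewrite /component !mxE.
have key : `|avgs (rem (basis h j) (cube h)) (gap (basis h j) k) x y - h * M k j| <= e * h.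
  apply: avgs_near => [|y' yy']; first exact: gap_jlb.
  have y'h : `|y' - y| <= d%:R * h.
    by rewrite (le_trans yy')// (le_trans (sum_rem_norm _ _))// cube_norm// ltW.
  have y'bh : `|y' - y + basis h j| <= d%:R * h + h.
    by rewrite (le_trans (ler_normD _ _))// lerD// norm_basis// ltW.
  have hd' : d%:R * h + h < delta.
    apply: le_lt_trans hd; rewrite (_ : d%:R * h + h = h * (d%:R + 1)); last by ring.
    by rewrite ler_wpM2l ?(ltW h0)// -natr1 -natr1 lerDl.
  have h1 := Hc _ (le_lt_trans y'bh hd').
  have h2 : `|component k x (y + (y' - y)) - component k x y - (M *m (y' - y)) k 0| <= e / K * `|y' - y|.
    by apply: Hc; apply: (le_lt_trans y'h); apply: le_lt_trans hd'; rewrite lerDl ltW.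
  rewrite Mb in h1.
  have e1 : y + (y' - y + basis h j) = y' + basis h j by rewrite addrA (addrC y) subrK.
  have e2 : y + (y' - y) = y' by rewrite addrC subrK.
  rewrite e1 in h1; rewrite e2 in h2; rewrite /gap.
  set p := (M *m (y' - y)) k 0 in h1 h2.
  rewrite (_ : _ - _ - _ = (component k x (y' + basis h j) - component k x y - (p + h * M k j)) -
     (component k x y' - component k x y - p)); last by ring.
  apply: (le_trans (ler_normB _ _)); apply: (le_trans (lerD h1 h2)).
  have eK0 : 0 <= e / K by rewrite divr_ge0// ltW.
  rewrite -mulrDr; apply: (@le_trans _ _ (e / K * (d%:R * h + h + d%:R * h))).
    by rewrite ler_wpM2l// lerD.
  rewrite (_ : d%:R * h + h + d%:R * h = K * h); last by rewrite /K; ring.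
  by rewrite mulrA divfK// gt_eqF.
rewrite mxE [X in `|X + _|]mxE [X in `|_ + X|]mxE.
rewrite (_ : _ - _ = h^-1 * (avgs (rem (basis h j) (cube h)) (gap (basis h j) k) x y
  - h * M k j)); last by field; rewrite gt_eqF.
by rewrite normrM ger0_norm ?invr_ge0 ?(ltW h0)// ler_pdivrMl// (mulrC h e).
Qed.

(** Where differentiability fails only the bound [K] on [F] is available. The penalty
    [(K + |c|) * nd] makes up for it at these points and has average zero. *)
Lemma avgs_diffpt_le (F : T -> 'cV[R]_d -> R) h ws x y c : 0 < h -> jlb F ->
  (forall i, basis h i \in ws) ->
  (forall y', `|y' - y| <= \sum_(w <- ws) `|w| -> diffpt h x y' -> F x y' <= c) ->
  avgs ws F x y <= c.
Proof.
move=> h0 jF hws Fc; have [mF bF] := jF.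
pose r := `|y| + \sum_(w <- ws) `|w|.
have [K HK] := bF x r.
pose nd x y : R := \sum_(k < n) (`[< ~ diff_upto (component k) h d x y >])%:R.
have jnd1 k : jlb (fun x y => (`[< ~ diff_upto (component k) h d x y >])%:R : R).
  by apply: jlb_nondiff => //; exact: comp_lipb.
have jnd : jlb nd by exact: jlb_sum.
have nd0 : avgs ws nd x y = 0.
  rewrite avgs_sum// big1// => k _; apply: avgs_nondiff => //; exact: comp_lipb.
have K0 : 0 <= K.
  by apply: le_trans (HK y _); rewrite ?normr_ge0// lerDl sumr_ge0.
have Kc0 : 0 <= K + `|c| by rewrite addr_ge0.
have <- : avgs ws (fun x y => c + (K + `|c|) * nd x y) x y = c.
  rewrite avgsD; [|exact: jlb_cst|exact: jlbZ].
  by rewrite avgs_cst avgsZ// nd0 mulr0 addr0.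
apply: avgs_le => //; first by apply: jlbD; [exact: jlb_cst|exact: jlbZ].
move=> y' yy'; have [D|nD] := pselect (diffpt h x y').
  by rewrite (le_trans (Fc _ yy' D))// lerDl mulr_ge0// sumr_ge0.
have [k nk] : exists k, ~ diff_upto (component k) h d x y'.
  by apply: contrapT => nk; apply: nD => k; apply: contrapT => h1; apply: nk; exists k.
have nd1 : 1 <= nd x y'.
  by rewrite /nd (bigD1 k)//= asboolT//= lerDl sumr_ge0.
have y'r : `|y'| <= r.
  by rewrite -[y'](subrK y) addrC (le_trans (ler_normD _ _))// lerD2l.
apply: (le_trans (ler_norm _)); apply: (le_trans (HK _ y'r)).
have h1 : K + `|c| <= (K + `|c|) * nd x y' by rewrite ler_peMr.
have h2 : - c <= `|c| by rewrite -normrN ler_norm.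
by move: h1 h2; lra.
Qed.

Lemma jlb_ip (B : 'M[R]_(n, d)) (J : T -> 'cV[R]_d -> 'M[R]_(n, d)) :
  (forall k j, jlb (fun x y => J x y k j)) -> jlb (fun x y => ip B (J x y)).
Proof. by move=> jJ; apply: jlb_sum => k; apply: jlb_sum => j; exact: jlbZ. Qed.

(** For each [B], the product of [B] with [Qmx] is the average of its product with the Jacobian, so
    every half-space containing the Jacobians of the cube contains [Qmx]; [separation] concludes. *)
Lemma Qmx_near_hull h x y e : 0 < h -> 0 < e -> exists A,
  conv_hull [set M | exists y', `|y' - y| <= d%:R * h /\ is_jacobian (H x) y' M] A /\
  `|Qmx h x y - A| < e.
Proof.
move=> h0 e0.
have [C HC] := jacobian_bounded (`|y| + d%:R * h) (lH x).
apply: (@separation _ _ _ _ _ C) => //.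
  move=> M [y' [yy' jM]]; apply: HC jM.
  by rewrite -[y'](subrK y) addrC (le_trans (ler_normD _ _))// lerD2l.
move=> B c Bc.
have jJ k j : jlb (fun x y => Jmx h x y k j).
  under [X in jlb X]eq_fun do under eq_fun do rewrite mxE.
  by apply: jlbZ; apply: jlb_dder => //; exact: comp_lipb.
have -> : ip B (Qmx h x y) = avgs (cube h) (fun x y => ip B (Jmx h x y)) x y.
  rewrite /ip avgs_sum; last by move=> k; apply: jlb_sum => j; exact: jlbZ.
  apply: eq_bigr => k _; rewrite avgs_sum; last by move=> j; exact: jlbZ.
  apply: eq_bigr => j _; rewrite avgsZ// QmxE; congr (_ * _).
  rewrite -avgsZ; last by apply: jlb_dder => //; exact: comp_lipb.
  by congr (avgs _ _ x y); apply/funext => x'; apply/funext => y'; rewrite mxE.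
apply: avgs_diffpt_le (@basis_cube h) _ => //; first exact: jlb_ip.
move=> y' yy' D; apply: Bc; exists y'; split; last exact: diffpt_jacobian.
by rewrite (le_trans yy')// cube_norm// ltW.
Qed.

Lemma dder_jacobian w x y M k : is_jacobian (H x) y M -> dder w (component k) x y = (M *m w) k 0.
Proof.
move=> /is_jacobianP jM; apply: dderP => e e0.
have K0 : 0 < `|w| + 1 by rewrite ltr_wpDl.
have [delta [delta0 Hd]] := jM (e / (`|w| + 1)) (divr_gt0 e0 K0).
exists (delta / (`|w| + 1)); split; first by rewrite divr_gt0.
move=> t; rewrite ltr_pdivlMr// => td.
have tw : `|t *: w| <= `|t| * (`|w| + 1) by rewrite normrZ ler_wpM2l// lerDl.
have := norm_coord_le (H x (y + t *: w) - H x y - M *m (t *: w)) k 0.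
rewrite -scalemxAr !mxE [t * _]mulrC => /le_trans; apply.
rewrite scalemxAr (le_trans (Hd _ (le_lt_trans tw td)))//.
rewrite -mulrA ler_wpM2l ?(ltW e0)// ler_pdivrMl// mulrC//.
Qed.

(** Separation is applied to the images [M *m w]. The increment from [a] to [b] is compared with its
    average over a small cube of base points, where differentiability fails only on a negligible
    set. *)
Lemma mean_value x a b e e' : 0 < e <= 1 -> 0 < e' -> exists A,
  conv_hull (near_jacobians (H x) a b e) A /\ `|H x b - H x a - A *m (b - a)| < e'.
Proof.
move=> /andP[e0 e1] e'0; pose w := b - a.
pose S : set 'cV[R]_n := [set M *m w | M in near_jacobians (H x) a b e].
suff [s [Ss Hs]] : exists s, conv_hull S s /\ `|(H x b - H x a) - s| < e'.
  have [m [l [v [l0 [l1 [Sv sE]]]]]] := Ss.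
  have [M HM] := choice (fun i => (let: ex_intro2 M p q := Sv i in ex_intro _ M (conj p q)
     : exists M, near_jacobians (H x) a b e M /\ M *m w = v i)).
  exists (\sum_i l i *: M i); split.
    by exists m, l, M; split=> //; split=> //; split=> // i; have [] := HM i.
  rewrite mulmx_suml (_ : \sum_(_ < _) _ = s)// sE; apply: eq_bigr => i _.
  by rewrite -scalemxAl; have [_ ->] := HM i.
have [C HC] := near_jacobians_bounded a b (lH x).
apply: (@separation _ _ _ _ _ (d%:R * (C * `|w|))) => //.
  move=> _ [M SM <-]; apply: (le_trans (norm_mulmx_le _ _)); rewrite ler_wpM2l//.
  by rewrite ler_wpM2r//; exact: HC SM.
move=> B c Bc.
pose G x y := ip B (H x (y + w) - H x y).
have GE : G = fun x y => \sum_k B k 0 * gap w k x y.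
  apply/funext => x'; apply/funext => y'; apply: eq_bigr => k _.
  by rewrite big_ord1 !mxE.
have jG : jlb G by rewrite GE; apply: jlb_sum => k; apply: jlbZ; exact: gap_jlb.
pose F x y := \sum_k B k 0 * dder w (component k) x y.
have jd k : jlb (dder w (component k)) by apply: jlb_dder => //; exact: comp_lipb.
have jF : jlb F by apply: jlb_sum => k; exact: jlbZ.
have GF : G = avg w F.
  rewrite GE; apply/funext => x'; apply/funext => y'.
  transitivity (avgs [:: w] F x' y'); last by [].
  rewrite avgs_sum; last by move=> k; exact: jlbZ.
  by apply: eq_bigr => k _; rewrite avgsZ//= gap_avg.
rewrite (_ : H x b - H x a = H x (a + w) - H x a); last by rewrite /w (addrC a) subrK.
rewrite -/(G x a); apply/ler_addgt0Pr => eps eps0.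
have [L [L0 HL]] := lH x (`|a| + `|w| + 1).
pose K := (n * 1)%:R * (`|B| * (2 * L * d%:R)).
have K0 : 0 <= K by rewrite !mulr_ge0.
pose D : R := d%:R + 1.
have D0 : 0 < D by rewrite ltr_wpDl.
(* The three bounds keep the cube within [e] of the segment, keep all points in the ball where [L]
   is valid, and make [G] vary by at most [eps] on the cube. *)
pose h := Num.min (Num.min (e / (2 * D)) D^-1) (eps / (K + 1)).
have h0 : 0 < h by rewrite !lt_min !divr_gt0//= ?invr_gt0// ?mulr_gt0// ?ltr_wpDl.
have hD : h <= D^-1 by rewrite !ge_min lexx orbT.
have he : h <= e / (2 * D) by rewrite !ge_min lexx.
have hK : h * (K + 1) <= eps by rewrite -ler_pdivlMr ?ltr_wpDl// !ge_min lexx !orbT.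
have dh : d%:R * h <= D * h by rewrite ler_wpM2r ?(ltW h0)// lerDl.
have dh1 : d%:R * h <= 1 by apply: (le_trans dh); rewrite -ler_pdivlMl// mulr1.
have dhe : d%:R * h < e.
  apply: (le_lt_trans dh); apply: (@le_lt_trans _ _ (e / 2)); last first.
    by rewrite ltr_pdivrMr// ltr_pMr// ltr1n.
  by rewrite -ler_pdivlMl// (_ : D^-1 * _ = e / (2 * D))//; field; rewrite gt_eqF.
have lower : G x a - eps <= avgs (cube h) G x a.
  rewrite -[leLHS](avgs_cst (G x a - eps) (cube h) x a).
  apply: avgs_le => //; first exact: jlb_cst.
  move=> y' /le_trans/(_ (cube_norm (ltW h0))) y'h.
  rewrite lerBlDr -lerBlDl /G -ipBr.
  apply: (le_trans (ip_le _ _)).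
  have y'a : `|y'| <= `|a| + 1.
    rewrite -[y'](subrK a) addrC (le_trans (ler_normD _ _))// lerD2l (le_trans y'h)//.
  have h3 : `|H x (a + w) - H x a - (H x (y' + w) - H x y')| <= 2 * L * (d%:R * h).
    rewrite (_ : _ - _ = (H x (a + w) - H x (y' + w)) - (H x a - H x y')); last first.
      by apply/matrixP => i j; rewrite !mxE; ring.
    apply: (le_trans (ler_normB _ _)); rewrite -mulrA mulr_natl mulr2n.
    apply: lerD.
      apply: (le_trans (HL _ _ _ _)).
      - by rewrite (le_trans (ler_normD _ _))// lerDl.
      - by rewrite (le_trans (ler_normD _ _))//; move: y'a; lra.
      by rewrite ler_wpM2l// distrC (_ : _ - _ = y' - a)// opprD addrACA subrr addr0.
    apply: (le_trans (HL _ _ _ _)).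
    - by have := normr_ge0 w; lra.
    - by have := normr_ge0 w; move: y'a; lra.
    by rewrite ler_wpM2l// distrC.
  apply: (@le_trans _ _ (K * h)).
    rewrite /K -!mulrA ler_wpM2l// ler_wpM2l//; move: h3; rewrite !mulrA; lra.
  by rewrite (le_trans _ hK)// mulrC ler_wpM2l ?(ltW h0)// lerDl.
rewrite -lerBlDr; apply: (le_trans lower).
(* The two averages are exchanged: for each [t], the inner one is now over a cube at [a + t *: w],
   and only its differentiability points matter. *)
rewrite {1}GF avgs_avg//; rewrite -[leRHS](avg_cst c w x a).
apply: avg_le; [exact: jlb_avgs|exact: jlb_cst|move=> t t01].
apply: avgs_diffpt_le (@basis_cube h) _ => // y' /le_trans/(_ (cube_norm (ltW h0))) y'h D'.
have jJ := diffpt_jacobian h0 D'.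
have := Bc (Jmx h x y' *m w).
rewrite /ip /F => Bc'; apply: le_trans (Bc' _).
  apply: ler_sum => k _; rewrite big_ord1 (dder_jacobian _ _ jJ)//.
exists (Jmx h x y') => //; exists t, y'; split=> //; split=> //.
exact: le_lt_trans dhe.
Qed.

End Q_matrix.

(** * Caratheodory functions and measurable selection *)

Lemma measurable_fun_lt d (S : measurableType d) (R : realType) (f : S -> R) :
  (forall c, mprop (fun x => f x < c)) -> measurable_fun setT f.
Proof.
move=> H; apply: (measurability _ (RGenInftyO.measurableE R)) => //.
move=> _ [_ [c ->] <-]; rewrite setTI.
by have := H c; rewrite /mprop; congr measurable; apply/seteqP; split => x /=; rewrite in_itv/=.
Qed.

Lemma inf_lt_iff (R : realType) (A : set R) c : has_inf A ->
  inf A < c <-> exists2 a, A a & a < c.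
Proof.
move=> hA; split=> [Ac|[a Aa ac]]; last first.
  by apply: le_lt_trans ac; apply: ge_inf => //; exact: hA.2.
have e0 : 0 < c - inf A by rewrite subr_gt0.
by have [a Aa ac] := inf_adherent e0 hA; exists a => //; move: ac; rewrite addrC subrK.
Qed.

Section caratheodory_functions.
Context {d} {S : measurableType d} {R : realType} {I : finType}.
Implicit Types (g : S -> (I -> R) -> R) (x : S) (w : I -> R).

Definition carath g := (forall w, measurable_fun setT (g ^~ w)) /\
  forall x w e, 0 < e -> exists delta, 0 < delta /\ forall w',
    (forall i, `|w' i - w i| < delta) -> `|g x w' - g x w| <= e.

Lemma carath_coord i : carath (fun _ w => w i).
Proof.
split=> [w|x w e e0]; first exact: measurable_cst.
by exists e; split => // w' H; exact: ltW.
Qed.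

Lemma carath_fun (f : S -> R) : measurable_fun setT f -> carath (fun x _ => f x).
Proof.
move=> mf; split=> // x w e e0; exists 1; split => // w' _.
by rewrite subrr normr0 ltW.
Qed.

Lemma carath_cst (c : R) : carath (fun _ _ => c).
Proof. by apply: carath_fun; exact: measurable_cst. Qed.

Lemma carathD g1 g2 : carath g1 -> carath g2 -> carath (fun x w => g1 x w + g2 x w).
Proof.
move=> [m1 c1] [m2 c2]; split=> [w|x w e e0]; first exact: measurable_funD.
have e2 : 0 < e / 2 by rewrite divr_gt0.
have [d1 [d10 H1]] := c1 x w _ e2; have [d2 [d20 H2]] := c2 x w _ e2.
exists (Num.min d1 d2); split; first by rewrite lt_min d10.
move=> w' H; rewrite opprD addrACA (splitr e) (le_trans (ler_normD _ _))// lerD//.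
  by apply: H1 => i; have := H i; rewrite lt_min => /andP[].
by apply: H2 => i; have := H i; rewrite lt_min => /andP[].
Qed.

Lemma carathM g1 g2 : carath g1 -> carath g2 -> carath (fun x w => g1 x w * g2 x w).
Proof.
move=> [m1 c1] [m2 c2]; split=> [w|x w e e0]; first exact: measurable_funM.
pose K := `|g1 x w| + `|g2 x w| + 1.
have K0 : 0 < K by rewrite ltr_wpDl// addr_ge0.
pose e' := Num.min 1 (e / K).
have e'0 : 0 < e' by rewrite lt_min ltr01 divr_gt0.
have e'1 : e' <= 1 by rewrite ge_min lexx.
have e'K : e' * K <= e by rewrite -ler_pdivlMr// ge_min lexx orbT.
have [d1 [d10 H1]] := c1 x w _ e'0; have [d2 [d20 H2]] := c2 x w _ e'0.
exists (Num.min d1 d2); split; first by rewrite lt_min d10.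
move=> w' H.
have {}H1 : `|g1 x w' - g1 x w| <= e'.
  by apply: H1 => i; have := H i; rewrite lt_min => /andP[].
have {}H2 : `|g2 x w' - g2 x w| <= e'.
  by apply: H2 => i; have := H i; rewrite lt_min => /andP[].
rewrite (_ : _ - _ = g1 x w * (g2 x w' - g2 x w) + (g1 x w' - g1 x w) * g2 x w +
  (g1 x w' - g1 x w) * (g2 x w' - g2 x w)); last by ring.
apply: le_trans e'K; rewrite (_ : e' * K = `|g1 x w| * e' + e' * `|g2 x w| + e'); last first.
  by rewrite /K; ring.
rewrite (le_trans (ler_normD _ _))// lerD//.
  by rewrite (le_trans (ler_normD _ _))// !normrM lerD// ?ler_wpM2l ?ler_wpM2r.
rewrite normrM -[leRHS]mulr1 ler_pM//; exact: le_trans e'1.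
Qed.

Lemma carathB g1 g2 : carath g1 -> carath g2 -> carath (fun x w => g1 x w - g2 x w).
Proof.
move=> c1 c2; have := carathD c1 (carathM (carath_cst (-1)) c2).
by under [X in carath X -> _]eq_fun do under eq_fun do rewrite mulN1r.
Qed.

Lemma carath_norm g : carath g -> carath (fun x w => `|g x w|).
Proof.
move=> [mg cg]; split=> [w|x w e e0]; first exact: measurable_norm.
have [del [del0 H]] := cg x w e e0; exists del; split => // w' /H.
exact: le_trans (ler_dist_dist _ _).
Qed.

Lemma carath_sum (J : Type) (s : seq J) (g : J -> S -> (I -> R) -> R) :
  (forall j, carath (g j)) -> carath (fun x w => \sum_(j <- s) g j x w).
Proof.
move=> cg; elim: s => [|j s IH].
  by under eq_fun do under eq_fun do rewrite big_nil; exact: carath_cst.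
by under eq_fun do under eq_fun do rewrite big_cons; exact: carathD.
Qed.

Section distance.
Context (L : finType) (a : L -> S -> (I -> R) -> R) (c : nat -> L -> S -> R) (h : nat -> R).
Hypothesis ca : forall l, carath (a l).
Hypothesis mc : forall k l, measurable_fun setT (c k l).
Hypothesis h0 : forall k, 0 <= h k.

Let E k x w := \sum_l `|c k l x - a l x w| + h k.

(** A distance to a countable family in which [h k] acts as one more coordinate with target 0: it
    vanishes when members with small [h k] come arbitrarily close. *)
Definition countable_dist x w := inf (range (fun k => \sum_l `|c k l x - a l x w| + h k)).

Let has_inf_E x w : has_inf (range (fun k => E k x w)).
Proof.
split; first by exists (E 0%N x w); exists 0%N.
by exists 0 => _ [k _ <-]; rewrite addr_ge0// sumr_ge0.
Qed.

Let carath_E k : carath (E k).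
Proof.
apply: carathD; last exact: carath_cst.
by apply: carath_sum => l; apply/carath_norm/carathB => //; exact: carath_fun.
Qed.

(** The infimum is countable, hence measurable. A change of [w] alters all terms by at most the same
    amount, whatever [k], so continuity survives the infimum. *)
Lemma carath_countable_dist : carath countable_dist.
Proof.
split=> [w|x w e e0].
  apply: measurable_fun_lt => r.
  have : mprop (fun x => exists k, E k x w < r).
    apply: mprop_exists => k; apply: mprop_lt; last exact: measurable_cst.
    by have [] := carath_E k.
  rewrite /mprop; congr measurable; apply/seteqP; split => x /=.
    by move=> [k Ek]; apply/(inf_lt_iff _ (has_inf_E x w)); exists (E k x w) => //; exists k.
  by move=> /(inf_lt_iff _ (has_inf_E x w))[_ [k _ <-] Ek]; exists k.
have [_ cA] : carath (fun x w' => \sum_l `|a l x w' - a l x w|).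
  apply: carath_sum => l; apply/carath_norm/carathB => //; apply: carath_fun.
  by have [+ _] := ca l; apply.
have [delta [delta0 H]] := cA x w e e0; exists delta; split => // w' /H.
rewrite [X in _ - X]big1 ?subr0; last by move=> l _; rewrite subrr normr0.
rewrite ger0_norm ?sumr_ge0// => ae.
have key w1 w2 : \sum_l `|a l x w1 - a l x w2| <= e ->
    countable_dist x w1 - countable_dist x w2 <= e.
  move=> ae'; rewrite lerBlDr -lerBlDl.
  apply: lb_le_inf; first by exists (E 0%N x w2); exists 0%N.
  move=> _ [k _ <-]; rewrite lerBlDl; apply: (@le_trans _ _ (E k x w1)).
    by apply: ge_inf; [exact: (has_inf_E x w1).2|exists k].
  rewrite /E addrA lerD2r; apply: (@le_trans _ _ (\sum_l `|a l x w1 - a l x w2| +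
    \sum_l `|c k l x - a l x w2|)); last by rewrite lerD2r.
  rewrite -big_split; apply: ler_sum => l _ /=.
  rewrite (_ : c k l x - a l x w1 = - (a l x w1 - a l x w2) + (c k l x - a l x w2)); last by ring.
  by rewrite (le_trans (ler_normD _ _))// normrN.
rewrite ler_norml lerNl opprB; apply/andP; split; last exact: key.
by apply: key; apply: le_trans ae; apply: ler_sum => l _; rewrite distrC.
Qed.

Lemma countable_dist_le0 x w : countable_dist x w <= 0 <->
  forall e, 0 < e -> exists k, \sum_l `|c k l x - a l x w| + h k < e.
Proof.
split=> [le0 e e0|H].
  have /(inf_lt_iff _ (has_inf_E x w))[_ [k _ <-] Ek] : inf (range (fun k => E k x w)) < e.
    exact: le_lt_trans e0.
  by exists k.
apply/ler_addgt0Pr => e e0; rewrite add0r ltW//.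
by apply/(inf_lt_iff _ (has_inf_E x w)); have [k Hk] := H e e0; exists (E k x w) => //; exists k.
Qed.

End distance.

End caratheodory_functions.

Section selection.
Context {d} {S : measurableType d} {R : realType} {I : finType}.
Implicit Types (g : nat -> S -> (I -> R) -> R) (x : S) (w : I -> R).

Definition sol g x w := forall m, g m x w <= 0.

Lemma sol_closed g x (u : nat -> I -> R) w (s : nat -> nat) :
  (forall m, carath (g m)) -> increasing_seq s ->
  (forall i, u (s k) i @[k --> \oo] --> w i) ->
  (forall k m, (m <= k)%N -> g m x (u k) <= k.+1%:R^-1) -> sol g x w.
Proof.
move=> cg si uw gu m; apply/ler_addgt0Pr => e e0; rewrite add0r.
have e2 : 0 < e / 2 by rewrite divr_gt0.
have [delta [delta0 H]] := (cg m).2 x w _ e2.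
have H' i : \forall k \near \oo, `|u (s k) i - w i| < delta.
  by have /cvgrPdist_lt/(_ _ delta0) := uw i; apply: filterS => k; rewrite distrC.
have H'' : \forall k \near \oo, forall i, `|u (s k) i - w i| < delta by exact: filter_forall.
near \oo => k.
have h1 : `|g m x (u (s k)) - g m x w| <= e / 2 by apply: H; near: k.
have h2 : g m x (u (s k)) <= (s k).+1%:R^-1.
  apply: gu; apply: leq_trans (increasing_seq_ge k si).
  by near: k; exact: nbhs_infty_ge.
have h3 : (s k).+1%:R^-1 <= e / 2 :> R.
  apply: (@le_trans _ _ k.+1%:R^-1).
    by rewrite lef_pV2 ?posrE// ler_nat ltnS increasing_seq_ge.
  by apply: ltW; near: k; exact: (near_infty_natSinv_lt (PosNum e2)).
by move: h1; rewrite ler_norml => /andP[h1 _]; move: h1 (le_trans h2 h3); lra.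
Unshelve. all: by end_near. Qed.

(** A solution in the box exists exactly when, for all [m], a rational point almost in the box
    solves the constraints up to index [m] with error [m.+1%:R^-1]: continuity gives one direction,
    compactness the other. *)
Lemma mprop_sol_box g (M : nat) : (forall m, carath (g m)) ->
  mprop (fun x => exists w, (forall i, `|w i| <= M%:R) /\ sol g x w).
Proof.
move=> cg.
have : mprop (fun x => forall m : nat, exists q : {ffun I -> rat},
    (forall i, `|ratr (q i)| <= M%:R + m.+1%:R^-1 :> R) /\
    forall j : nat, (j <= m)%N -> g j x (fun i => ratr (q i)) <= m.+1%:R^-1).
  apply: mprop_forall => m; apply: mprop_exists => q; apply: mprop_and; first exact: mprop_cst.
  apply: mprop_forall => j; apply: mprop_imp; first exact: mprop_cst.
  by apply: mprop_le; [have [] := cg j|exact: measurable_cst].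
rewrite /mprop; congr measurable; apply/seteqP; split => x /=; last first.
  move=> [w [wM Kw]] m.
  have m0 : 0 < m.+1%:R^-1 :> R by rewrite invr_gt0.
  have Hj (j : 'I_m.+1) : exists delta, 0 < delta /\ forall r, r < delta ->
      forall w', (forall i, `|w' i - w i| <= r) -> `|g j x w' - g j x w| <= m.+1%:R^-1.
    have [del [del0 H]] := (cg j).2 x w _ m0; exists del; split => // r rd w' w'r.
    by apply: H => i; exact: le_lt_trans rd.
  have [delta [delta0 Hd]] : exists delta, 0 < delta /\ forall (j : 'I_m.+1) r, r < delta ->
      forall w', (forall i, `|w' i - w i| <= r) -> `|g j x w' - g j x w| <= m.+1%:R^-1.
    have [f Hf] := choice Hj.
    exists (\big[Num.min/1]_i f i); split.
      by apply/bigmin_gtP; split => // i _; have [] := Hf i.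
    move=> j r re; have [_] := Hf j; apply; apply: (lt_le_trans re); exact: bigmin_le_cond.
  pose r := Num.min (delta / 2) m.+1%:R^-1.
  have r0 : 0 < r by rewrite lt_min divr_gt0.
  have rd : r < delta by rewrite gt_min ltr_pdivrMr// ltr_pMr// ltr1n.
  have [q Hq] := choice (fun i => rat_near (w i) r0).
  exists [ffun i => q i]; split=> [i|j jm].
    rewrite ffunE -[ratr _](subrK (w i)) addrC (le_trans (ler_normD _ _))// lerD//.
    by rewrite distrC ltW// (lt_le_trans (Hq i))// ge_min lexx orbT.
  set w' := fun i => _.
  have w'r i : `|w' i - w i| <= r by rewrite /w' ffunE distrC ltW.
  have h1 : g j x w' - g j x w <= m.+1%:R^-1.
    exact: le_trans (ler_norm _) (Hd (Ordinal (jm : (j < m.+1)%N)) r rd w' w'r).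
  by apply: le_trans h1; rewrite lerDl oppr_ge0.
move=> H; have [q Hq] := choice H.
have qM k i : `|ratr (q k i)| <= M%:R + 1 :> R.
  have [h _] := Hq k; apply: (le_trans (h i)); rewrite lerD2l invf_le1// ler1n//.
have [s [w [si Hw]]] := bounded_subsequence qM.
exists w; split.
  move=> i; apply/ler_addgt0Pr => e e0.
  have : `|ratr (q (s k) i)| @[k --> \oo] --> `|w i| by apply: cvg_norm; exact: Hw.
  move=> /cvgr_to_le; apply; near=> k.
  have [h _] := Hq (s k); apply: (le_trans (h i)); rewrite lerD2l.
  apply: (@le_trans _ _ k.+1%:R^-1).
    by rewrite lef_pV2 ?posrE// ler_nat ltnS increasing_seq_ge.
  by apply: ltW; near: k; exact: (near_infty_natSinv_lt (PosNum e0)).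
apply: (sol_closed cg si Hw) => k m mk; have [_] := Hq k; exact.
Unshelve. all: by end_near. Qed.

Lemma mprop_sol g : (forall m, carath (g m)) -> mprop (fun x => exists w, sol g x w).
Proof.
move=> cg; have := mprop_exists (fun M : nat => mprop_sol_box M cg).
rewrite /mprop; congr measurable; apply/seteqP; split => x /= [].
  by move=> M [w [_ Kw]]; exists w.
move=> w Kw.
have [M HM] : exists M : nat, forall i, `|w i| <= M%:R.
  exists (\max_i Num.bound `|w i|) => i.
  by rewrite ltW// (lt_le_trans (archi_boundP _))// ler_nat leq_bigmax.
by exists M, w.
Qed.

Definition cons_con (f : S -> (I -> R) -> R) g : nat -> S -> (I -> R) -> R :=
  fun m => if m is m'.+1 then g m' else f.

Lemma sol_cons f g x w : sol (cons_con f g) x w <-> f x w <= 0 /\ sol g x w.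
Proof.
split=> [H|[Hf Hg] [|m]]; [|exact: Hf|exact: Hg].
by split=> [|m]; [exact: (H 0%N)|exact: (H m.+1)].
Qed.

Lemma carath_cons f g : carath f -> (forall m, carath (g m)) ->
  forall m, carath (cons_con f g m).
Proof. by move=> cf cg [|m] //=. Qed.

Definition bounded_sol g := forall x, exists b, forall w, sol g x w -> forall i, `|w i| <= b.

Lemma sol_min g i : (forall m, carath (g m)) -> bounded_sol g ->
  let v x := inf [set w i | w in sol g x] in
  measurable_fun setT v /\ forall x, (exists w, sol g x w) -> exists w, sol g x w /\ w i = v x.
Proof.
move=> cg bg v.
have hinf x : (exists w, sol g x w) -> has_inf [set w i | w in sol g x].
  move=> [w Kw]; split; first by exists (w i); exists w.
  have [b Hb] := bg x; exists (- b) => _ [w' Kw' <-].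
  by have := Hb _ Kw' i; rewrite ler_norml => /andP[].
split.
  apply: measurable_fun_lt => c.
  (* The first clause reflects that the infimum of the empty set is 0. In the second, a value below
     [c] is detected by solving the system enlarged with [w i <= ratr r]. *)
  have : mprop (fun x => (~ (exists w, sol g x w) -> 0 < c) /\
     ((exists w, sol g x w) -> exists r : rat, ratr r < c /\
       exists w, sol (cons_con (fun _ w => w i - ratr r) g) x w)).
    apply: mprop_and; apply: mprop_imp; [|exact: mprop_cst| |].
    - exact/mprop_not/mprop_sol.
    - exact: mprop_sol.
    apply: mprop_exists => r; apply: mprop_and; first exact: mprop_cst.
    apply: mprop_sol; apply: carath_cons => //.
    by apply: carathB; [exact: carath_coord|exact: carath_cst].
  rewrite /mprop; congr measurable; apply/seteqP; split => x /=.
    have [ex|nex] := pselect (exists w, sol g x w).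
      move=> [_ /(_ ex)[r [rc [w /sol_cons[wr Kw]]]]].
      apply/(inf_lt_iff _ (hinf x ex)); exists (w i); first by exists w.
      by rewrite (le_lt_trans _ rc)// -subr_le0.
    move=> [/(_ nex) c0 _]; rewrite /v (_ : [set _ | _ in _] = set0) ?inf0//.
    by apply/seteqP; split => // t [w Kw _]; apply: nex; exists w.
  have [ex|nex] := pselect (exists w, sol g x w).
    move=> /(inf_lt_iff _ (hinf x ex))[_ [w Kw <-] wc]; split => // _.
    have [r] := rat_in_itvoo wc; rewrite in_itv/= => /andP[wr rc].
    by exists r; split => //; exists w; apply/sol_cons; rewrite subr_le0 ltW.
  rewrite /v (_ : [set _ | _ in _] = set0) ?inf0//.
  by apply/seteqP; split => // t [w Kw _]; apply: nex; exists w.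
move=> x ex; have hI := hinf x ex.
have H (k : nat) : exists w, sol g x w /\ w i < v x + k.+1%:R^-1.
  have k0 : 0 < k.+1%:R^-1 :> R by rewrite invr_gt0.
  by have [_ [w Kw <-] Hw] := inf_adherent k0 hI; exists w.
have [u Hu] := choice H.
have [b Hb] := bg x.
have uM k j : `|u k j| <= b by have [Ku _] := Hu k; exact: Hb.
have [s [w [si Hw]]] := bounded_subsequence uM.
exists w; split.
  apply: (sol_closed cg si Hw) => k m mk; have [Ku _] := Hu k.
  by apply: (le_trans (Ku m)); rewrite invr_ge0.
apply/eqP; rewrite eq_le; apply/andP; split.
  apply/ler_addgt0Pr => e e0; apply: (cvgr_to_le (Hw i)); near=> k.
  have [_ h] := Hu (s k); apply: (le_trans (ltW h)); rewrite lerD2l.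
  apply: (@le_trans _ _ k.+1%:R^-1).
    by rewrite lef_pV2 ?posrE// ler_nat ltnS increasing_seq_ge.
  by apply: ltW; near: k; exact: (near_infty_natSinv_lt (PosNum e0)).
apply: (cvgr_to_ge (Hw i)); near=> k; have [Ku _] := Hu (s k).
by apply: ge_inf; [exact: hI.2|exists (u (s k))].
Unshelve. all: by end_near. Qed.

Theorem measurable_selection g : (forall m, carath (g m)) -> bounded_sol g ->
  exists v : I -> S -> R, (forall i, measurable_fun setT (v i)) /\
    forall x, (exists w, sol g x w) -> sol g x (v ^~ x).
Proof.
move=> cg bg.
(* Invariant of the induction on coordinates: [g'] refines [g] without losing solvability, and it
   determines the coordinates already treated. At the end a single solution is left where one
   exists. *)
suff [g' [v [cg' sub nonempty mv Hv]]] : exists g' (v : I -> S -> R),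
    [/\ forall m, carath (g' m), forall x w, sol g' x w -> sol g x w,
      forall x, (exists w, sol g x w) -> exists w, sol g' x w,
      forall i, measurable_fun setT (v i) &
      forall x w i, i \in enum I -> sol g' x w -> w i = v i x].
  exists v; split => // x /nonempty[w Kw]; rewrite (_ : v ^~ x = w); first exact: sub.
  by apply/funext => i; rewrite (Hv x w i)// mem_enum.
elim: (enum I) => [|i s [g' [v [cg' sub nonempty mv Hv]]]].
  by exists g, (fun _ _ => 0); split => // i; exact: measurable_cst.
have bg' : bounded_sol g' by move=> x; have [b Hb] := bg x; exists b => w /sub; exact: Hb.
have [mvi Hvi] := sol_min i cg' bg'.
set vi := (fun x => _) in mvi Hvi.
exists (cons_con (fun x w => `|w i - vi x|) g'), (fun j => if j == i then vi else v j); split.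
- apply: carath_cons => //; apply/carath_norm/carathB; first exact: carath_coord.
  exact: carath_fun.
- by move=> x w /sol_cons[_ /sub].
- move=> x /nonempty/Hvi[w [Kw wi]]; exists w; apply/sol_cons; split => //.
  by rewrite wi subrr normr0.
- by move=> j; case: eqP.
- move=> x w j; rewrite in_cons => + /sol_cons[wi Kw]; case: eqP => [->|ji] /=.
    by move=> _; apply/eqP; rewrite -subr_eq0 -normr_le0.
  by move=> js; exact: Hv.
Qed.

End selection.

(** * Measurable description of the Clarke Jacobian along a segment *)

Lemma conv_hull_fin (R : realType) (V : lmodType R) (S : set V) (J : finType)
    (l : J -> R) (a : J -> V) :
  (forall j, 0 <= l j) -> \sum_j l j = 1 -> (forall j, S (a j)) ->
  conv_hull S (\sum_j l j *: a j).
Proof.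
move=> l0 l1 Sa; exists #|J|, (l \o enum_val), (a \o enum_val); split=> [i|]; first exact: l0.
split; first by rewrite -l1 [RHS](reindex _ (onW_bij _ (@enum_val_bij J))).
split=> [i|]; first exact: Sa.
by rewrite [LHS](reindex _ (onW_bij _ (@enum_val_bij J))).
Qed.

Lemma conv_hull_idem (R : realType) (n d : nat) (S S' : set 'M[R]_(n, d)) s :
  S `<=` conv_hull S' -> conv_hull S s -> conv_hull S' s.
Proof.
move=> SS' [m [l [a [l0 [l1 [Sa ->]]]]]].
have H i : exists q : ('I_(n * d).+1 -> R) * ('I_(n * d).+1 -> 'M[R]_(n, d)),
    [/\ forall j, 0 <= q.1 j, \sum_j q.1 j = 1, forall j, S' (q.2 j) &
       a i = \sum_j q.1 j *: q.2 j].
  by have [l' [a' [l'0 [l'1 [Sa' aE]]]]] := caratheodory (SS' _ (Sa i)); exists (l', a').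
have [q Hq] := choice H.
rewrite (_ : \sum_i _ = \sum_(ij : 'I_m * 'I_(n * d).+1)
    (l ij.1 * (q ij.1).1 ij.2) *: (q ij.1).2 ij.2).
  apply: conv_hull_fin => [[i j]||[i j]] /=.
  - by have [q0 _ _ _] := Hq i; rewrite mulr_ge0.
  - rewrite -(pair_bigA _ (fun i j => l i * (q i).1 j))/= -l1; apply: eq_bigr => i _.
    by have [_ q1 _ _] := Hq i; rewrite -mulr_sumr q1 mulr1.
  - by have [_ _ + _] := Hq i; apply.
rewrite -(pair_bigA _ (fun i j => (l i * (q i).1 j) *: (q i).2 j))/=.
apply: eq_bigr => i _; have [_ _ _ ->] := Hq i.
by rewrite scaler_sumr; apply: eq_bigr => j _; rewrite scalerA.
Qed.

Lemma rv_near (R : realType) (d : nat) (z : 'cV[R]_d) (e : R) : 0 < e ->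
  exists q : 'cV[rat]_d, `|rv q - z| < e.
Proof.
move=> e0; have [f Hf] := choice (fun j => rat_near (z j 0) e0).
exists (\col_j f j); apply: norm_lt_coord => // i j.
by rewrite ord1 !mxE distrC.
Qed.

Section clarke.
Context {R : realType} {d0 : measure_display} {T : measurableType d0} {d n : nat}.
Context (H : T -> 'cV[R]_d -> 'cV[R]_n).
Implicit Types (x : T) (z : 'cV[R]_d) (M : 'M[R]_(n, d)).

Hypothesis mH : forall k, jmeas (component H k).
Hypothesis lH : forall x, lip_balls (H x).

(* A countable description of a set lying between the limiting Jacobians and their convex hull:
   it is what makes the Clarke Jacobian measurable with respect to the parameter. *)
Definition Q_limits x z M := forall e : R, 0 < e -> exists (q : 'cV[rat]_d) (m : nat),
  [/\ `|rv q - z| < e, `|Qmx H m.+1%:R^-1 x (rv q) - M| < e & m.+1%:R^-1 < e].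

(** The order of choices matters: a differentiability point, then a scale at which [Qmx] is close to
    its Jacobian, then a rational point by continuity at that fixed scale. *)
Lemma limiting_Q_limits x z M : limiting_jacobians (H x) z M -> Q_limits x z M.
Proof.
move=> [zk [Mk [cz [jM cM]]]] e e0.
have e4 : 0 < e / 4 by rewrite divr_gt0.
have [k [h1 h2]] : exists k, `|zk k - z| < e / 4 /\ `|Mk k - M| < e / 4.
  have [N _ HN] : \forall k \near \oo, `|zk k - z| < e / 4 /\ `|Mk k - M| < e / 4.
    move/cvgrPdist_lt/(_ _ e4) : cz => cz; move/cvgrPdist_lt/(_ _ e4) : cM => cM.
    by apply: filterS2 cz cM => k; rewrite distrC => ? /=; rewrite distrC.
  by exists N; apply: HN => /=.
have [del [del0 Hdel]] := Qmx_limit mH lH (jM k) e4.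
have [m Hm] : exists m : nat, m.+1%:R^-1 < Num.min del e.
  by apply: inv_nat_lt; rewrite lt_min del0.
move: Hm; rewrite lt_min => /andP[mdel me].
have m0 : 0 < m.+1%:R^-1 :> R by rewrite invr_gt0.
have [del' [del'0 Hdel']] := Qmx_continuous mH lH x (zk k) m0 e4.
have [q Hq] : exists q : 'cV[rat]_d, `|rv q - zk k| < Num.min del' (e / 4).
  by apply: rv_near; rewrite lt_min del'0.
move: Hq; rewrite lt_min => /andP[qd qe].
exists q, m; split => //.
  rewrite (_ : rv q - z = (rv q - zk k) + (zk k - z)); last first.
    by apply/matrixP => i j; rewrite !mxE; ring.
  by rewrite (le_lt_trans (ler_normD _ _))//; move: qe h1; lra.
have h3 := Hdel' _ qd; rewrite (addrC (zk k)) subrK in h3.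
have h4 := Hdel _ (ltac:(by apply/andP; split; [exact: m0|exact: mdel])).
rewrite (_ : Qmx H m.+1%:R^-1 x (rv q) - M =
  (Qmx H m.+1%:R^-1 x (rv q) - Qmx H m.+1%:R^-1 x (zk k)) +
  (Qmx H m.+1%:R^-1 x (zk k) - Mk k) + (Mk k - M)); last first.
  by apply/matrixP => i j; rewrite !mxE; ring.
rewrite (le_lt_trans (ler_normD _ _))//.
have := ler_normD (Qmx H m.+1%:R^-1 x (rv q) - Qmx H m.+1%:R^-1 x (zk k))
  (Qmx H m.+1%:R^-1 x (zk k) - Mk k).
by move: h2 h3 h4; lra.
Qed.

(** Each approximating [Qmx] is close to a hull of Jacobians taken near [z]; [limiting_compact] on
    the degenerate segment from [z] to [z] passes to the limit. *)
Lemma Q_limits_clarke x z M : Q_limits x z M -> clarke_jacobian (H x) z M.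
Proof.
move=> QM.
have HA (k : nat) : exists A : 'M[R]_(n, d),
    conv_hull (near_jacobians (H x) z z k.+1%:R^-1) A /\ `|A - M| <= k.+1%:R^-1.
  have k0 : 0 < k.+1%:R^-1 :> R by rewrite invr_gt0.
  (* The cube reaches at most [d%:R * e] from its base point, which is within [e] of [z]; one more
     [e] is spare. *)
  pose e : R := k.+1%:R^-1 / d.+2%:R.
  have e0 : 0 < e by rewrite divr_gt0.
  have ed : d%:R * e + e + e = k.+1%:R^-1.
    rewrite (_ : d%:R * e + e + e = d.+2%:R * e).
      by rewrite mulrC divfK.
    by rewrite -[d.+2%:R]natr1 -[d.+1%:R]natr1; ring.
  have de0 : 0 <= d%:R * e by rewrite mulr_ge0// ltW.
  have [q [m [h1 h2 h3]]] := QM e e0.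
  have m0 : 0 < m.+1%:R^-1 :> R by rewrite invr_gt0.
  have [A [CA Ae]] := Qmx_near_hull mH lH x (rv q) m0 e0.
  exists A; split; last first.
    rewrite (_ : A - M = - (Qmx H m.+1%:R^-1 x (rv q) - A) + (Qmx H m.+1%:R^-1 x (rv q) - M)).
      apply: (le_trans (ler_normD _ _)); rewrite normrN.
      apply: (@le_trans _ _ (e + e)); first by rewrite lerD// ltW.
      by rewrite -ed -addrA lerDr.
    by apply/matrixP => i j; rewrite !mxE; ring.
  apply: conv_hull_mono CA => M' [y' [yy' jM']]; exists 0, y'; rewrite lexx ler01.
  split=> //; split=> //; rewrite scale0r addr0.
  rewrite (_ : y' - z = (y' - rv q) + (rv q - z)); last first.
    by apply/matrixP => i j; rewrite !mxE; ring.
  rewrite (le_lt_trans (ler_normD _ _))//.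
  have : d%:R * m.+1%:R^-1 <= d%:R * e by rewrite ler_wpM2l// ltW.
  move=> h4; apply: (@lt_le_trans _ _ (d%:R * e + e)).
    by rewrite ler_ltD// (le_trans yy').
  by rewrite -ed lerDl ltW.
have [A HA'] := choice HA.
have [A' [CA' [s [si As]]]] := limiting_compact (lH x) (fun k => (HA' k).1).
have AM : A @ \oo --> M.
  apply/cvgrPdist_le => e e0; near=> k; rewrite distrC.
  have [_ h] := HA' k; apply: (le_trans h); apply: ltW; near: k.
  exact: (near_infty_natSinv_lt (PosNum e0)).
have AsM : A \o s @ \oo --> M by exact: cvg_subsequence AM.
have -> : M = A' by apply: (cvg_unique _ AsM As); exact: norm_hausdorff.
apply: conv_hull_mono CA' => M' [t [_]].
by rewrite subrr scaler0 addr0.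
Unshelve. all: by end_near. Qed.

(** Nested hulls collapse, so matrices of the hull can be encoded by limiting Jacobians alone, which
    are known to satisfy [Q_limits]. *)
Lemma clarke_segment_limiting x a b M : conv_hull (clarke_segment (H x) a b) M ->
  conv_hull (limiting_segment (H x) a b) M.
Proof.
apply: conv_hull_idem => M' [t [t01]]; apply: conv_hull_mono => M'' LM.
by exists t.
Qed.

Lemma mean_value_limiting x a b : exists A, conv_hull (limiting_segment (H x) a b) A /\
  H x b - H x a = A *m (b - a).
Proof.
have HA (k : nat) : exists A : 'M[R]_(n, d),
    conv_hull (near_jacobians (H x) a b k.+1%:R^-1) A /\
    `|H x b - H x a - A *m (b - a)| < k.+1%:R^-1.
  apply: mean_value => //.
  by rewrite invr_gt0 ltr0n/= invf_le1// ler1n.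
have [A HA'] := choice HA.
have [A' [CA' [s [si As]]]] := limiting_compact (lH x) (fun k => (HA' k).1).
exists A'; split => //; apply/eqP; rewrite -subr_eq0 -normr_le0.
apply/ler_addgt0Pr => e e0; rewrite add0r.
have e2 : 0 < e / 2 by rewrite divr_gt0.
have K0 : 0 < d%:R * `|b - a| + 1 by rewrite ltr_wpDl// mulr_ge0.
have /cvgrPdist_le/(_ _ (divr_gt0 e2 K0)) HAs := As.
near \oo => k.
have h1 : `|A' - A (s k)| <= e / 2 / (d%:R * `|b - a| + 1) by near: k.
have [_ h2] := HA' (s k).
have h3 : (s k).+1%:R^-1 <= e / 2 :> R.
  apply: (@le_trans _ _ k.+1%:R^-1).
    by rewrite lef_pV2 ?posrE// ler_nat ltnS increasing_seq_ge.
  by apply: ltW; near: k; exact: (near_infty_natSinv_lt (PosNum e2)).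
rewrite (_ : _ - _ = (H x b - H x a - A (s k) *m (b - a)) - (A' - A (s k)) *m (b - a)); last first.
  by rewrite mulmxBl opprB [RHS]addrA subrK.
rewrite (le_trans (ler_normB _ _))// (splitr e) lerD//.
  by apply: le_trans h3; exact: ltW.
apply: (le_trans (norm_mulmx_le _ _)).
apply: (@le_trans _ _ ((d%:R * `|b - a| + 1) * `|A' - A (s k)|)).
  by rewrite mulrDl mul1r -mulrA [`|b - a| * _]mulrC lerDl.
by rewrite mulrC -ler_pdivlMr.
Unshelve. all: by end_near. Qed.

Context (u v : T -> 'cV[R]_d).
Hypothesis mu_ : mx_measurable u.
Hypothesis mv_ : mx_measurable v.
Hypothesis bH : forall x, exists b : R, forall t M, 0 <= t <= 1 ->
  clarke_jacobian (H x) (u x + t *: (v x - u x)) M -> `|M| <= b.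

Local Notation N := (n * d).+1.
Local Notation I := ('I_N * (bool + 'I_n * 'I_d))%type.
Implicit Types w : I -> R.

Definition wlam w (i : 'I_N) : R := w (i, inl true).
Definition wt w (i : 'I_N) : R := w (i, inl false).
Definition wM w (i : 'I_N) : 'M[R]_(n, d) := \matrix_(k, j) w (i, inr (k, j)).
Definition wz x w (i : 'I_N) : 'cV[R]_d := u x + wt w i *: (v x - u x).

(** [Q_limits] stands in for the Clarke Jacobian, being a countable condition; its solutions are
    still Clarke matrices. *)
Definition hull_data x w := [/\ forall i, 0 <= wlam w i, \sum_i wlam w i = 1,
  forall i, 0 <= wt w i <= 1 & forall i, Q_limits x (wz x w i) (wM w i)].

Local Notation L := ('I_d + 'I_n * 'I_d)%type.

(** Enumerates the pairs of a rational point and a scale; the default value is itself such a pair,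
    so it adds nothing to the family. *)
Let kap (k : nat) : 'cV[rat]_d * nat := odflt (0, 0%N) (unpickle k).

Let dist_a (i : 'I_N) (l : L) x w : R := match l with
  inl j => wz x w i j 0 | inr kj => wM w i kj.1 kj.2 end.

Let dist_c (k : nat) (l : L) x : R := match l with
  inl j => rv (kap k).1 j 0
| inr kj => Qmx H (kap k).2.+1%:R^-1 x (rv (kap k).1) kj.1 kj.2 end.

Let dist_h (k : nat) : R := (kap k).2.+1%:R^-1.

Let carath_dist_a i l : carath (dist_a i l).
Proof.
case: l => [j|[k j]] /=.
  rewrite (_ : dist_a i (inl j) = fun x w => u x j 0 + w (i, inl false) * (v x j 0 - u x j 0)).
    apply: carathD; first by apply: carath_fun; exact: mu_.
    apply: carathM; first exact: carath_coord.
    by apply: carath_fun; apply: measurable_funB; [exact: mv_|exact: mu_].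
  by apply/funext => x; apply/funext => w; rewrite /dist_a !mxE.
rewrite (_ : dist_a i _ = fun x w => w (i, inr (k, j))); first exact: carath_coord.
by apply/funext => x; apply/funext => w; rewrite /dist_a !mxE.
Qed.

Lemma measurable_jlb_section (F : T -> 'cV[R]_d -> R) y : jlb F ->
  measurable_fun setT (fun x => F x y).
Proof.
move=> [mF _]; apply: (jmeas_comp (a := id) mF) => [|i]; first exact: measurable_id.
exact: measurable_cst.
Qed.

Let measurable_dist_c k l : measurable_fun setT (dist_c k l).
Proof.
case: l => [j|[k' j]] /=; first exact: measurable_cst.
by apply: (measurable_jlb_section _ (Qmx_jlb mH lH _ k' j)).
Qed.

Let dist_h_ge0 k : 0 <= dist_h k.
Proof. by rewrite invr_ge0. Qed.

Let hdist i := countable_dist (dist_a i) dist_c dist_h.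

Let hdist_le0 i x w : hdist i x w <= 0 <-> Q_limits x (wz x w i) (wM w i).
Proof.
rewrite /hdist (countable_dist_le0 _ _ dist_h_ge0); split=> HQ e e0.
  have [k Hk] := HQ e e0; exists (kap k).1, (kap k).2.
  have h0 := dist_h_ge0 k.
  have hl l : `|dist_c k l x - dist_a i l x w| < e.
    apply: le_lt_trans Hk; rewrite (bigD1 l)//= -addrA lerDl addr_ge0// sumr_ge0//.
  split.
  - by apply: norm_lt_coord => // j j'; have := hl (inl j); rewrite /= !ord1 !mxE.
  - by apply: norm_lt_coord => // k' j; have := hl (inr (k', j)); rewrite /= !mxE.
  - by apply: le_lt_trans Hk; rewrite lerDr sumr_ge0.
pose K : R := #|{: L}|%:R + 1.
have K0 : 0 < K by rewrite ltr_wpDl.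
have [q [m [h1 h2 h3]]] := HQ (e / K) (divr_gt0 e0 K0).
exists (pickle (q, m)); have kE : kap (pickle (q, m)) = (q, m) by rewrite /kap pickleK.
rewrite (_ : e = (\sum_(l : L) e / K) + e / K); last first.
  rewrite sumr_const -mulr_natl -[X in _ = _ + X]mul1r -mulrDl mulrC divfK//.
  by rewrite gt_eqF.
rewrite ler_ltD//; last by rewrite /dist_h kE.
apply: ler_sum => [[j|[k j]]] _; rewrite /dist_c /dist_a kE/= ltW//.
  by apply: le_lt_trans h1; have := norm_coord_le (rv q - wz x w i) j 0; rewrite mxE [X in _ + X]mxE.
apply: le_lt_trans h2.
by have := norm_coord_le (Qmx H m.+1%:R^-1 x (rv q) - wM w i) k j; rewrite mxE [X in _ + X]mxE.
Qed.

(** [phi] leaves room for extra equations: the mean value equality in one application, equality with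
    a given matrix field in the other. Boundedness of the solutions comes from the weights, the
    parameters and [bH]. *)
Lemma hull_data_selection (E : finType) (phi : E -> T -> (I -> R) -> R) :
  (forall e, carath (phi e)) ->
  exists (D : T -> Prop) (W : I -> T -> R), [/\ mprop D, forall i, measurable_fun setT (W i),
    forall x, D x <-> exists w, hull_data x w /\ forall e, phi e x w = 0 &
    forall x, D x -> hull_data x (W ^~ x) /\ forall e, phi e x (W ^~ x) = 0].
Proof.
move=> cphi.
pose J := ('I_N * (bool * bool) + (unit + E))%type.
pose f (j : J) x w : R := match j with
  | inl (i, (true, true)) => - wlam w i
  | inl (i, (true, false)) => - wt w i
  | inl (i, (false, true)) => wt w i - 1
  | inl (i, (false, false)) => hdist i x w
  | inr (inl _) => `|\sum_i wlam w i - 1|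
  | inr (inr e) => `|phi e x w| end.
have cN (g : T -> (I -> R) -> R) : carath g -> carath (fun x w => - g x w).
  by move=> cg; have := carathB (carath_cst 0) cg; under [X in carath X -> _]eq_fun do under eq_fun do rewrite sub0r.
have cf j : carath (f j).
  case: j => [[i [[] []]]|[u0|e]] /=.
  - exact/cN/carath_coord.
  - exact/cN/carath_coord.
  - by apply: carathB; [exact: carath_coord|exact: carath_cst].
  - exact: carath_countable_dist.
  - apply/carath_norm/carathB; last exact: carath_cst.
    by apply: carath_sum => i; exact: carath_coord.
  - exact: carath_norm.
(* The finitely many constraints are enumerated by [nat]; numbers coding none get the trivial
   constraint. *)
pose g (m : nat) : T -> (I -> R) -> R := if unpickle m is Some j then f j else (fun _ _ => 0).
have cg m : carath (g m) by rewrite /g; case: (unpickle m) => [j|]; [exact: cf|exact: carath_cst].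
have solE x w : sol g x w <-> hull_data x w /\ forall e, phi e x w = 0.
  have -> : sol g x w <-> forall j, f j x w <= 0.
    split=> [Hs j|Hs m]; first by have := Hs (pickle j); rewrite /g pickleK.
    by rewrite /g; case: (unpickle m).
  split=> [Hf|[[l0 l1 t01 hQ] hphi]].
    split; last by move=> e; have := Hf (inr (inr e)); rewrite /= normr_le0 => /eqP.
    split=> [i||i|i].
    - by have := Hf (inl (i, (true, true))); rewrite /= oppr_le0.
    - by have := Hf (inr (inl tt)); rewrite /= normr_le0 subr_eq0 => /eqP.
    - have := Hf (inl (i, (true, false))); have := Hf (inl (i, (false, true))).
      by rewrite /= oppr_le0 subr_le0 => -> ->.
    - by apply/hdist_le0; exact: (Hf (inl (i, (false, false)))).
  case=> [[i [[] []]]|[u0|e]] /=.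
  - by rewrite oppr_le0.
  - by rewrite oppr_le0; have /andP[] := t01 i.
  - by rewrite subr_le0; have /andP[] := t01 i.
  - exact/hdist_le0.
  - by rewrite l1 subrr normr0.
  - by rewrite hphi normr0.
have bg : bounded_sol g.
  move=> x; have [b Hb] := bH x; exists (Num.max 1 b) => w /solE[[l0 l1 t01 hQ] _].
  case=> i [[]|[k j]]; rewrite le_max.
  - by rewrite ger0_norm ?l0// -l1 (bigD1 i)//= lerDl sumr_ge0.
  - by have /andP[t0 t1] := t01 i; rewrite ger0_norm// [w _ <= 1]t1.
  - apply/orP; right; have := Hb (wt w i) (wM w i) (t01 i) (Q_limits_clarke (hQ i)).
    by have := norm_coord_le (wM w i) k j; rewrite mxE; exact: le_trans.
have [W [mW HW]] := measurable_selection cg bg.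
exists (fun x => exists w, sol g x w), W; split=> //.
- exact: mprop_sol.
- by move=> x; split=> -[w /solE Hw]; exists w.
- by move=> x /HW/solE.
Qed.

Lemma hull_data_exists x A : conv_hull (limiting_segment (H x) (u x) (v x)) A ->
  exists w, hull_data x w /\ A = \sum_i wlam w i *: wM w i.
Proof.
move=> /caratheodory[l [M [l0 [l1 [SM AE]]]]].
have [t Ht] := choice SM.
pose w (i : I) : R := match i.2 with inl true => l i.1 | inl false => t i.1
  | inr kj => M i.1 kj.1 kj.2 end.
have ME i : wM w i = M i by apply/matrixP => k j; rewrite mxE.
exists w; split; last by rewrite AE; apply: eq_bigr => i _; rewrite ME.
split=> [//||i|i]; [by rewrite -[RHS]l1|by have [] := Ht i|].
by apply: limiting_Q_limits; rewrite ME; have [] := Ht i.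
Qed.

End clarke.

(** * Integrability and conclusion *)

Lemma powR_add_le (R : realType) (a b r : R) : 0 <= a -> 0 <= b -> 0 <= r ->
  (a + b) `^ r <= 2 `^ r * (a `^ r + b `^ r).
Proof.
move=> a0 b0 r0; have m0 : 0 <= Num.max a b by rewrite le_max a0.
have h : a + b <= 2 * Num.max a b.
  by rewrite mulr_natl mulr2n lerD// le_max lexx ?orbT.
apply: (le_trans (ge0_ler_powR r0 _ _ h)).
- by rewrite nnegrE addr_ge0.
- by rewrite nnegrE mulr_ge0.
rewrite powRM// ler_wpM2l ?powR_ge0//.
by case: (leP a b) => _; [rewrite lerDr|rewrite lerDl]; exact: powR_ge0.
Qed.

Lemma measurable_norm_mx (R : realType) d (T : measurableType d) (m k : nat)
    (f : T -> 'M[R]_(m, k)) :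
  mx_measurable f -> measurable_fun setT (fun x => `|f x|).
Proof.
move=> mf; apply: measurable_fun_lt => c.
have : mprop (fun x => 0 < c /\ forall ij : 'I_m * 'I_k, `|f x ij.1 ij.2| < c).
  apply: mprop_and; first exact: mprop_cst.
  apply: mprop_forall => ij; apply: mprop_lt; last exact: measurable_cst.
  by apply: measurable_norm; exact: mf.
rewrite /mprop; congr measurable; apply/seteqP; split => x /=.
  by move=> [c0 H]; apply: norm_lt_coord => // i j; exact: (H (i, j)).
move=> fc; split; first exact: le_lt_trans fc.
by move=> ij; apply: le_lt_trans fc; exact: norm_coord_le.
Qed.

Lemma inLp_dominated (R : realType) d (T : measurableType d)
    (mu : {finite_measure set T -> \bar R}) (n m k : nat) (p r C : R)
    (u v : T -> 'cV[R]_n) (A : T -> 'M[R]_(m, k)) :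
  0 <= C -> inLp mu p u -> inLp mu p v -> mx_measurable A ->
  (forall x, `|A x| `^ r <= C * (1 + (`|u x| `^ p + `|v x| `^ p))) -> inLp mu r A.
Proof.
move=> C0 Lu Lv mA Ale; split; first exact: mA.
have mu_ : mx_measurable u by case: Lu.
have mv : mx_measurable v by case: Lv.
have mN (q : R) (a b : nat) (f : T -> 'M[R]_(a, b)) : mx_measurable f ->
    measurable_fun setT (fun x => `|f x| `^ q).
  move=> mf; apply: (measurableT_comp (measurable_powR q)).
  exact: measurable_norm_mx.
pose g x : R := C * (1 + (`|u x| `^ p + `|v x| `^ p)).
have mg : measurable_fun setT (fun x => (1 + (`|u x| `^ p + `|v x| `^ p))).
  apply: measurable_funD; first exact: measurable_cst.
  by apply: measurable_funD; exact: mN.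
apply: (@le_lt_trans _ _ (\int[mu]_x (g x)%:E)%E).
  apply: ge0_le_integral => //.
  - by apply/measurable_EFinP; exact: mN.
  - by apply/measurable_EFinP; apply: measurable_funM => //; exact: measurable_cst.
  - by move=> x _; rewrite lee_fin; exact: Ale.
under eq_integral do rewrite EFinM.
have mE (q : R) (a b : nat) (f : T -> 'M[R]_(a, b)) : mx_measurable f ->
    measurable_fun setT (fun x => (`|f x| `^ q)%:E).
  by move=> mf; apply/measurable_EFinP; exact: mN.
have mgE : measurable_fun setT (fun x => (1 + (`|u x| `^ p + `|v x| `^ p))%:E).
  by apply/measurable_EFinP.
have ge (x : T) : (0 <= (1 + (`|u x| `^ p + `|v x| `^ p))%:E)%E.
  by rewrite lee_fin addr_ge0// addr_ge0// powR_ge0.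
have me2 : measurable_fun setT (fun x => (`|u x| `^ p)%:E + (`|v x| `^ p)%:E)%E.
  by apply: emeasurable_funD; exact: mE.
rewrite ge0_integralZl//.
under eq_integral do rewrite !EFinD.
rewrite ge0_integralD//; last by move=> x _; rewrite adde_ge0// lee_fin powR_ge0.
rewrite ge0_integralD//; try (by move=> x _; rewrite lee_fin powR_ge0); try exact: mE.
apply: lte_mul_pinfty; [by rewrite lee_fin|by []|].
apply: lte_add_pinfty; last by apply: lte_add_pinfty; [case: Lu|case: Lv].
by rewrite integral_cst// mul1e -ge0_fin_numE// fin_num_measure.
Qed.

Theorem mainTheorem11 (R : realType) (d0 : measure_display) (T : measurableType d0)
  (mu : {finite_measure set T -> \bar R}) (d n : nat)
  (H : T -> 'cV[R]_d -> 'cV[R]_n) (p q : R) :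
  measure_is_complete mu ->
  1 < q -> q <= p ->
  N1 H -> N2 H p q ->
  forall u v : T -> 'cV[R]_d, inLp mu p u -> inLp mu p v ->
  (exists A, Theta mu H p q u v A /\
     {ae mu, forall x, H x (u x) - H x (v x) = A x *m (u x - v x)}) /\
  (forall A, Theta mu H p q u v A ->
     {ae mu, forall x, H x (u x) - H x (v x) = A x *m (u x - v x)} ->
     exists (lam : 'I_(n * d).+1 -> T -> R) (As : 'I_(n * d).+1 -> T -> 'M[R]_(n, d)),
       (forall i, measurable_fun [set: T] (lam i)) /\
       (forall i x, 0 <= lam i x <= 1) /\
       (forall i, mx_measurable (As i)) /\
       (forall i, {ae mu, forall x, clarke_segment (H x) (u x) (v x) (As i x)}) /\
       (forall x, \sum_(i < (n * d).+1) lam i x = 1) /\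
       {ae mu, forall x, A x = \sum_(i < (n * d).+1) lam i x *: As i x}).
Proof.
move=> _ q1 qp [mH0 locH] [CH [CH0 growth]] u v Lu Lv.
have mH k : jmeas (component H k) by exact: mH0.
have lH x : lip_balls (H x) by exact: locally_lipschitz_lip_balls (locH x).
have [mu_ _] := Lu; have [mv _] := Lv.
have q0 : 0 < q by apply: lt_trans q1.
have s0 : 0 <= p / q - 1 by rewrite subr_ge0 ler_pdivlMr// mul1r.
pose beta x := CH * (1 + (`|u x| + `|v x|) `^ (p / q - 1)).
have bH x t M : 0 <= t <= 1 -> clarke_jacobian (H x) (u x + t *: (v x - u x)) M ->
    `|M| <= beta x.
  move=> t01 HM; have [_ /(_ _ HM) h] := growth x (u x + t *: (v x - u x)).
  apply: (le_trans h); rewrite ler_wpM2l ?(ltW CH0)// lerD2l.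
  apply: (ge0_ler_powR s0); [by rewrite nnegrE|by rewrite nnegrE addr_ge0|].
  exact: seg_norm.
have bH' x : exists b : R, forall t M, 0 <= t <= 1 ->
    clarke_jacobian (H x) (u x + t *: (v x - u x)) M -> `|M| <= b.
  by exists (beta x); exact: bH.
pose I := ('I_(n * d).+1 * (bool + 'I_n * 'I_d))%type.
have cA k j : carath (fun (x : T) (w : I -> R) => \sum_i wlam w i * wM w i k j).
  apply: carath_sum => i; apply: carathM; first exact: carath_coord.
  rewrite (_ : (fun _ _ => _) = fun (_ : T) (w : I -> R) => w (i, inr (k, j))).
    exact: carath_coord.
  by apply/funext => x; apply/funext => w; rewrite mxE.
have segM x w i : hull_data H u v x w -> clarke_segment (H x) (u x) (v x) (wM w i).
  move=> [_ _ t01 hQ]; exists (wt w i); split => //.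
  exact: (Q_limits_clarke mH lH (hQ i)).
have mH' f (k : 'I_n) : mx_measurable f -> measurable_fun [set: T] (fun x => H x (f x) k 0).
  by move=> mf; apply: (jmeas_comp (a := id) (mH k)) => [|i]; [exact: measurable_id|exact: mf].
split.
  pose phi (k : 'I_n) (x : T) (w : I -> R) : R :=
    \sum_j (\sum_i wlam w i * wM w i k j) * (u x j 0 - v x j 0) -
    (H x (u x) k 0 - H x (v x) k 0).
  have cphi k : carath (phi k).
    apply: carathB; last first.
      by apply: carath_fun; apply: measurable_funB; exact: mH'.
    apply: carath_sum => j; apply: carathM; first exact: cA.
    by apply: carath_fun; apply: measurable_funB; [exact: mu_|exact: mv].
  have [D [W [mD mW HD HW]]] := hull_data_selection mH lH mu_ mv bH' cphi.
  pose A x : 'M[R]_(n, d) := \sum_i wlam (W ^~ x) i *: wM (W ^~ x) i.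
  have AE x k j : A x k j = \sum_i wlam (W ^~ x) i * wM (W ^~ x) i k j.
    by rewrite summxE; apply: eq_bigr => i _; rewrite mxE.
  (* The mean value inclusion from [u x] to [v x] makes the system solvable at every point; both
     differences change sign. *)
  have DT x : D x.
    apply/HD; have [A' [CA' A'E]] := mean_value_limiting mH lH x (u x) (v x).
    have [w [hw A'w]] := hull_data_exists mH lH CA'.
    exists w; split => // k; apply/eqP; rewrite subr_eq0; apply/eqP.
    have : (A' *m (u x - v x)) k 0 = (H x (u x) - H x (v x)) k 0.
      by rewrite -opprB mulmxN -A'E opprB.
    rewrite !mxE => <-; apply: eq_bigr => j _; rewrite !mxE; congr (_ * _).
    by rewrite A'w summxE; apply: eq_bigr => i _; rewrite [RHS]mxE.
  have mA : mx_measurable A.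
    move=> k j; under eq_fun do rewrite AE.
    apply: measurable_sum => i; apply: measurable_funM; first exact: mW.
    by under eq_fun do rewrite mxE; exact: mW.
  have hA x : conv_hull (clarke_segment (H x) (u x) (v x)) (A x).
    have [hd _] := HW x (DT x); have [l0 l1 _ _] := hd.
    exists (n * d).+1, (wlam (W ^~ x)), (wM (W ^~ x)); split=> //; split=> //; split=> // i.
    exact: segM.
  have Ab x : `|A x| <= beta x.
    by apply: conv_hull_norm (hA x) => M [t [t01]]; exact: bH.
  exists A; split; last first.
    apply: aeW => x; have [_ Hphi] := HW x (DT x).
    apply/matrixP => k z; rewrite ord1 !mxE; have /eqP := Hphi k.
    rewrite subr_eq0 => /eqP <-; apply: eq_bigr => j _; rewrite !mxE AE//.
  split; last by apply: aeW.
  case: ifPn => [qp'|]; last first.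
    rewrite -leNgt => pq; have pq' : p = q by apply/eqP; rewrite eq_le pq.
    split => //; exists (CH * 2); apply: aeW => x; apply: (le_trans (Ab x)).
    by rewrite /beta pq' divff ?gt_eqF// subrr powRr0.
  set r := p * q / (p - q).
  have pq0 : 0 < p - q by rewrite subr_gt0.
  have p0 : 0 < p by apply: lt_trans qp'.
  have r0 : 0 <= r by rewrite divr_ge0 ?mulr_ge0 ?ltW.
  (* The origin of [r]: raised to the power [r], the growth [p / q - 1] of the Jacobians becomes
     [p]. *)
  have sr : (p / q - 1) * r = p.
    by rewrite /r; field; rewrite !gt_eqF.
  (* [2 ^ r] comes from splitting the sum in [beta], [2 ^ p] from splitting the sum of the norms of
     [u] and [v]. *)
  apply: (@inLp_dominated _ _ _ _ _ _ _ p r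
    (CH `^ r * (2 `^ r * (1 + 2 `^ p))) u v) => //.
    by rewrite !mulr_ge0 ?addr_ge0 ?powR_ge0.
  move=> x; set a := `|u x| `^ p + `|v x| `^ p.
  have a0 : 0 <= a by rewrite addr_ge0 ?powR_ge0.
  apply: (@le_trans _ _ (beta x `^ r)).
    rewrite ge0_ler_powR ?nnegrE// (le_trans _ (Ab x))//.
  rewrite /beta powRM ?(ltW CH0) ?addr_ge0 ?powR_ge0// -mulrA ler_wpM2l ?powR_ge0//.
  apply: (le_trans (powR_add_le _ _ r0)); rewrite ?powR_ge0// -mulrA ler_wpM2l ?powR_ge0//.
  rewrite powR1 -powRrM sr.
  have := @powR_add_le _ `|u x| `|v x| p (normr_ge0 _) (normr_ge0 _) (ltW p0).
  rewrite -/a => h.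
  apply: (@le_trans _ _ (1 + 2 `^ p * a)); first by rewrite lerD2l.
  have c0 : 0 <= 2 `^ p :> R by exact: powR_ge0.
  rewrite -subr_ge0 (_ : _ - _ = a + 2 `^ p); first exact: addr_ge0.
  by ring.
move=> A [inA hullA] _.
have mA : mx_measurable A by move: inA; case: ifP => _ [].
pose phi (kj : 'I_n * 'I_d) (x : T) (w : I -> R) : R :=
  \sum_i wlam w i * wM w i kj.1 kj.2 - A x kj.1 kj.2.
have cphi kj : carath (phi kj).
  by apply: carathB; [exact: cA|apply: carath_fun; exact: mA].
have [D [W [mD mW HD HW]]] := hull_data_selection mH lH mu_ mv bH' cphi.
have aeD : {ae mu, forall x, D x}.
  move: hullA; apply: filterS.
  move=> x /(clarke_segment_limiting (H := H)) CA; apply/HD.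
  have [w [hw Aw]] := hull_data_exists mH lH CA.
  exists w; split => // -[k j]; rewrite /phi Aw summxE; apply/eqP; rewrite subr_eq0; apply/eqP.
  by apply: eq_bigr => i _; rewrite [RHS]mxE.
pose ind x : R := (`[< D x >])%:R.
have mind : measurable_fun [set: T] ind by exact: (measurable_indic mD).
(* Off [D] the selected weights carry no information; all weight goes to index 0, so that the bounds
   and the sum hold at every point. *)
exists (fun i x => ind x * W (i, inl true) x + (1 - ind x) * (i == ord0)%:R).
exists (fun i x => wM (W ^~ x) i).
have indT x : D x -> ind x = 1 by move=> Dx; rewrite /ind asboolT.
have indF x : ~ D x -> ind x = 0 by move=> Dx; rewrite /ind asboolF.
split.
  move=> i; apply: measurable_funD; first exact: measurable_funM.
  apply: measurable_funM; last exact: measurable_cst.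
  by apply: measurable_funB => //; exact: measurable_cst.
split.
  move=> i x; have [Dx|nDx] := pselect (D x).
    rewrite indT// mul1r subrr mul0r addr0.
    have [[l0 l1 _ _] _] := HW x Dx.
    rewrite [0 <= _]l0/= -l1 (bigD1 i)//= /wlam lerDl sumr_ge0// => j _; exact: l0.
  by rewrite indF// mul0r add0r subr0 mul1r; case: eqP => _; rewrite ?lexx ?ler01.
split.
  by move=> i k j; under eq_fun do rewrite mxE; exact: mW.
split.
  move=> i; move: aeD; apply: filterS.
  by move=> x /HW[hd _]; exact: segM.
split.
  move=> x; have [Dx|nDx] := pselect (D x).
    have [[l0 l1 _ _] _] := HW x Dx; rewrite -[RHS]l1; apply: eq_bigr => i _.
    by rewrite indT// mul1r subrr mul0r addr0.
  rewrite (bigD1 ord0)//= big1 => [|i /negbTE i0]; rewrite indF//.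
    by rewrite mul0r add0r subr0 mul1r addr0.
  by rewrite i0 mul0r mulr0 addr0.
move: aeD; apply: filterS.
move=> x Dx; have [_ Hphi] := HW x Dx; apply/matrixP => k j.
have /eqP := Hphi (k, j); rewrite /phi subr_eq0 => /eqP <- /=.
rewrite summxE; apply: eq_bigr => i _; rewrite [RHS]mxE indT// mul1r subrr mul0r addr0//.
Qed.
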